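(* Let $\alpha,\beta,\varepsilon\in\mathbb C$ satisfy $\varepsilon,\ \varepsilon+\alpha,\ \varepsilon+\beta,\ \varepsilon+\alpha+\beta,\ 2\varepsilon+\alpha+\beta\notin\mathbb Z$, and let $k,l\ge 0$ be integers. Assume that one of the following holds: 1. $\alpha\in\mathbb Z$, $k\le|\alpha|$ and $l=0$; 2. $\beta\in\mathbb Z$, $l\le|\beta|$ and $k=0$; 3. $\alpha,\beta\in\mathbb Z$, $k\le|\alpha|$ and $l\le|\beta|$. Then every difference operator $L(n,T)\in\mathcal D^{(k,l)}_{\alpha,\beta;\varepsilon}$ is bispectral. More precisely, for every admissible choice of parameters, with corresponding operators $P(n,T)$ and $L(n,T)$, the function $\Psi(n,z)=P(n,T)\,p^{\alpha,\beta}_\varepsilon(n,z)$ (which satisfies $L(n,T)\Psi(n,z)=z\Psi(n,z)$) is also an eigenfunction of a differential operator in $z$: there exist a differential operator $B(z,\partial_z)$ of positive order with rational coefficients and a function $\theta:\mathbb Z\to\mathbb C$ such that $$B(z,\partial_z)\Psi(n,z)=\theta(n)\Psi(n,z)$$ for all $n\in\mathbb Z$ and all $z$ with $|z|<1$ that are not poles of the coefficients of $B$.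
   Context: Notation. $(a)_n=\Gamma(a+n)/\Gamma(a)$ for $n\in\mathbb Z$; $F(a,b;c;x)$ is Gauss' hypergeometric function ${}_2F_1$. $T$ is the shift operator in $n$, $(Tf)(n)=f(n+1)$; a difference operator is a finite sum $\sum_{i=p}^q b_i(n)T^i$ with coefficients $b_i:\mathbb Z\to\mathbb C$, acting on functions of $n\in\mathbb Z$. Jacobi operator: $$L_{\alpha,\beta;\varepsilon}(n,T)=\tfrac{2(n+\varepsilon+1)(n+\varepsilon+\alpha+\beta+1)}{(2n+2\varepsilon+\alpha+\beta+1)(2n+2\varepsilon+\alpha+\beta+2)}T+\tfrac{\beta^2-\alpha^2}{(2n+2\varepsilon+\alpha+\beta)(2n+2\varepsilon+\alpha+\beta+2)}+\tfrac{2(n+\varepsilon+\alpha)(n+\varepsilon+\beta)}{(2n+2\varepsilon+\alpha+\beta)(2n+2\varepsilon+\alpha+\beta+1)}T^{-1}.$$ The functions $p^{\alpha,\beta}_\varepsilon(n,z)$, $n\in\mathbb Z$, $|z|<1$: for $\alpha\notin\mathbb Z_{<0}$, $$p^{\alpha,\beta}_\varepsilon(n,z)=\tfrac{(\varepsilon+\alpha+1)_n}{(\varepsilon+1)_n}F\big(-(n+\varepsilon),n+\varepsilon+\alpha+\beta+1;\alpha+1;\tfrac{1-z}2\big),$$ and for $\alpha\in\mathbb Z_{<0}$, $$p^{\alpha,\beta}_\varepsilon(n,z)=\mathcal C\,\tfrac{(\varepsilon+\beta+1)_n}{(\varepsilon+\alpha+\beta+1)_n}\big(\tfrac{1-z}{2}\big)^{-\alpha}F\big(-(n+\varepsilon+\alpha),n+\varepsilon+\beta+1;-\alpha+1;\tfrac{1-z}2\big),\quad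 \mathcal C=\tfrac{(-1)^\alpha}{(-\alpha-1)!}\cdot\tfrac{(-\varepsilon)_{-\alpha}(\varepsilon+\alpha+\beta+1)_{-\alpha}}{(-\alpha)!}.$$ They satisfy $L_{\alpha,\beta;\varepsilon}(n,T)p^{\alpha,\beta}_\varepsilon(n,z)=z\,p^{\alpha,\beta}_\varepsilon(n,z)$. Define, for integers $i\ge 0$ (for $\varphi_+^{(i)},\psi_+^{(i)}$ with $i<|\alpha|$ if $\alpha\in\mathbb Z$; for $\varphi_-^{(i)},\psi_-^{(i)}$ with $i<|\beta|$ if $\beta\in\mathbb Z$), $$\varphi_{+}^{(i)}(n)=\tfrac{(\varepsilon+\alpha+1)_n}{(\varepsilon+1)_n}\tfrac{(-(n+\varepsilon))_i(n+\varepsilon+\alpha+\beta+1)_i}{(-2)^i\,i!\,(\alpha+1)_i},\qquad \psi_{+}^{(i)}(n)=\tfrac{(\varepsilon+\beta+1)_n}{(\varepsilon+\alpha+\beta+1)_n}\tfrac{(-(n+\varepsilon+\alpha+\beta))_i(n+\varepsilon+1)_i}{(-2)^i\,i!\,(-\alpha+1)_i},$$ $$\varphi_{-}^{(i)}(n)=\tfrac{(-1)^n(\varepsilon+\beta+1)_n}{(\varepsilon+1)_n}\tfrac{(-(n+\varepsilon))_i(n+\varepsilon+\alpha+\beta+1)_i}{2^i\,i!\,(\beta+1)_i},\qquad \psi_{-}^{(i)}(n)=\tfrac{(-1)^n(\varepsilon+\alpha+1)_n}{(\varepsilon+\alpha+\beta+1)_n}\tfrac{(-(n+\varepsilon+\alpha+\beta))_i(n+\varepsilon+1)_i}{2^i\,i!\,(-\beta+1)_i}.$$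 The set $\mathcal D^{(k,l)}_{\alpha,\beta;\varepsilon}$ (for $\alpha\notin\{-k+1,\dots,k-1\}$ if $k>0$, and $\beta\notin\{-l+1,\dots,l-1\}$ if $l>0$). Given complex numbers $A_i,B_i$ ($0\le i\le k-1$) and $C_j,D_j$ ($0\le j\le l-1$), put $$f^{(i)}(n)=\sum_{r=0}^i\big(A_r\varphi_+^{(i-r)}(n)+B_r\psi_+^{(i-r)}(n)\big)\ (0\le i\le k-1),$$ $$f^{(i)}(n)=\sum_{r=0}^{i-k}\big(C_r\varphi_-^{(i-k-r)}(n)+D_r\psi_-^{(i-k-r)}(n)\big)\ (k\le i\le k+l-1),$$ and $\det(n)=\det\big(f^{(i)}(n+j)\big)_{0\le i\le k+l-1,\ -k-l\le j\le -1}$. The parameters are admissible if $\det(n)\ne0$ for all $n\in\mathbb Z$. For admissible parameters let $$P(n,T)=\frac1{\det(n)}\begin{vmatrix} f^{(0)}(n-k-l)&\cdots&f^{(k+l-1)}(n-k-l)&T^{-(k+l)}\\ \cdots&\cdots&\cdots&\cdots\\ f^{(0)}(n)&\cdots&f^{(k+l-1)}(n)&1\end{vmatrix},$$ the determinant being expanded along the last column with powers of $T$ written to the right of the function coefficients ($P=1$ if $k=l=0$). Then there is a unique difference operator $L(n,T)$, of the form $a(n)T+b(n)+c(n)T^{-1}$, with $L(n,T)P(n,T)=P(n,T)L_{\alpha,\beta;\varepsilon}(n,T)$. The set of all such $L(n,T)$, over all admissible parameters, is $\mathcal D^{(k,l)}_{\alpha,\beta;\varepsilon}$. *)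

(* Defs.v *)
From HB Require Import structures.
From mathcomp Require Import all_boot all_order all_algebra.
From mathcomp Require Import fraction.
From mathcomp Require Import all_classical all_reals all_analysis.
From mathcomp.real_closed Require Export complex.
Set Implicit Arguments.
Unset Strict Implicit.
Unset Printing Implicit Defensive.
Import Order.TTheory GRing.Theory Num.Theory.
Import numFieldNormedType.Exports.
Local Open Scope classical_set_scope.
Local Open Scope ring_scope.

Definition isint (K : pzRingType) (x : K) : Prop := exists m : int, x = m%:~R.

(* The definitions below make sense over any numFieldType K; the theorem uses
   K = R[i], where limits and derivatives are the complex ones. *)
Section Jacobi.
Variable K : numFieldType.
Implicit Types (a b c x z alpha beta eps : K) (n : int).

(* (a)_n = Gamma(a + n) / Gamma(a); for n = -m < 0 this quotient is
   1 / ((a - 1) ... (a - m)). *)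
Definition poch a n : K :=
  match n with
  | Posz m => \prod_(i < m) (a + i%:R)
  | Negz m => (\prod_(i < m.+1) (a - i.+1%:R))^-1
  end.

Definition hypergeom a b c x : K :=
  limn (series (fun j : nat =>
    poch a j * poch b j / (poch c j * j`!%:R) * x ^+ j)).

Record tridiag := Tridiag {
  coef_up : int -> K;
  coef_mid : int -> K;
  coef_down : int -> K }.

Definition tridiag_app (L : tridiag) (g : int -> K) n : K :=
  coef_up L n * g (n + 1) + coef_mid L n * g n + coef_down L n * g (n - 1).

Definition jacobi_op alpha beta eps : tridiag := Tridiag
  (fun n => let N := n%:~R + eps in
    2 * (N + 1) * (N + alpha + beta + 1) /
      ((2 * N + alpha + beta + 1) * (2 * N + alpha + beta + 2)))
  (fun n => let N := n%:~R + eps in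
    (beta ^+ 2 - alpha ^+ 2) /
      ((2 * N + alpha + beta) * (2 * N + alpha + beta + 2)))
  (fun n => let N := n%:~R + eps in
    2 * (N + alpha) * (N + beta) /
      ((2 * N + alpha + beta) * (2 * N + alpha + beta + 1))).

(* m is -alpha if alpha is a negative integer, and 0 otherwise. *)
Definition jacobi_p alpha beta eps n z : K :=
  let m := xget 0%N [set m : nat | alpha = - m%:R] in
  let N := n%:~R + eps in
  let x := (1 - z) / 2 in
  if m == 0%N then
    poch (eps + alpha + 1) n / poch (eps + 1) n *
      hypergeom (- N) (N + alpha + beta + 1) (alpha + 1) x
  else
    (-1) ^+ m / (m.-1)`!%:R *
      (poch (- eps) m * poch (eps + alpha + beta + 1) m / m`!%:R) *
    (poch (eps + beta + 1) n / poch (eps + alpha + beta + 1) n) * x ^+ m *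
      hypergeom (- (N + alpha)) (N + beta + 1) (- alpha + 1) x.

Definition phi_plus alpha beta eps (i : nat) n : K :=
  let N := n%:~R + eps in
  poch (eps + alpha + 1) n / poch (eps + 1) n *
  (poch (- N) i * poch (N + alpha + beta + 1) i /
    ((-2) ^+ i * i`!%:R * poch (alpha + 1) i)).

Definition psi_plus alpha beta eps (i : nat) n : K :=
  let N := n%:~R + eps in
  poch (eps + beta + 1) n / poch (eps + alpha + beta + 1) n *
  (poch (- (N + alpha + beta)) i * poch (N + 1) i /
    ((-2) ^+ i * i`!%:R * poch (- alpha + 1) i)).

Definition phi_minus alpha beta eps (i : nat) n : K :=
  let N := n%:~R + eps in
  (-1) ^ n * poch (eps + beta + 1) n / poch (eps + 1) n *
  (poch (- N) i * poch (N + alpha + beta + 1) i /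
    (2 ^+ i * i`!%:R * poch (beta + 1) i)).

Definition psi_minus alpha beta eps (i : nat) n : K :=
  let N := n%:~R + eps in
  (-1) ^ n * poch (eps + alpha + 1) n / poch (eps + alpha + beta + 1) n *
  (poch (- (N + alpha + beta)) i * poch (N + 1) i /
    (2 ^+ i * i`!%:R * poch (- beta + 1) i)).

Section Darboux.
Variables (alpha beta eps : K) (k l : nat).
Variables (A B : 'I_k -> K) (C D : 'I_l -> K).

(* fintype.split sends an index i >= k to inr (i - k). *)
Definition kernel_fun (i : 'I_(k + l)) n : K :=
  match fintype.split i with
  | inl i' => \sum_(r < k | (r <= i')%N)
      (A r * phi_plus alpha beta eps (i' - r) n +
       B r * psi_plus alpha beta eps (i' - r) n)
  | inr i' => \sum_(r < l | (r <= i')%N)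
      (C r * phi_minus alpha beta eps (i' - r) n +
       D r * psi_minus alpha beta eps (i' - r) n)
  end.

Definition casorati n : K :=
  \det (\matrix_(i < k + l, j < k + l)
          kernel_fun i (n - (k + l)%:Z + (j : nat)%:Z)).

Definition admissible : Prop := forall n, casorati n != 0.

(* The action of P on g: the powers of T in the last column of the defining
   determinant stand to the right of the coefficients, so they act on g. *)
Definition darboux_P (g : int -> K) n : K :=
  (casorati n)^-1 *
  \det (row_mx
    (\matrix_(j < k + l + 1, i < k + l)
       kernel_fun i (n - (k + l)%:Z + (j : nat)%:Z))
    (\col_(j < k + l + 1) g (n - (k + l)%:Z + (j : nat)%:Z))).

(* Equality of difference operators is equality of their actions: the
   coefficients are recovered by acting on indicator functions of points. *)
Definition intertwines (L : tridiag) : Prop :=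
  forall (g : int -> K) n,
    tridiag_app L (darboux_P g) n =
    darboux_P (tridiag_app (jacobi_op alpha beta eps) g) n.

Definition darboux_Psi n z : K :=
  darboux_P (fun m => jacobi_p alpha beta eps m z) n.

End Darboux.

(* Numerator and denominator in lowest terms, so that the poles of r are
   exactly the roots of ratden r. *)
Definition ratnum (r : {fraction {poly K}}) : {poly K} :=
  (frac (repr r)).1 %/ gcdp (frac (repr r)).1 (frac (repr r)).2.

Definition ratden (r : {fraction {poly K}}) : {poly K} :=
  (frac (repr r)).2 %/ gcdp (frac (repr r)).1 (frac (repr r)).2.

Definition is_pole (r : {fraction {poly K}}) z : bool := root (ratden r) z.

Definition rateval (r : {fraction {poly K}}) z : K :=
  (ratnum r).[z] / (ratden r).[z].

(* The polynomial \sum_j b_j 'X^j stands for the operator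
   \sum_j b_j(z) (d/dz)^j, of order (size _).-1. Only the coefficients of the
   polynomial are used; its ring product is not composition. *)
Definition diffop_app (Q : {poly {fraction {poly K}}}) (f : K -> K) z : K :=
  \sum_(j < size Q) rateval Q`_j z * derive1n j f z.

End Jacobi.

(* Main.v *)
(* In the variable x = (1 - z) / 2 the Jacobi functions are, up to a gauge
   factor, the power series F(-N, N + s; a + 1; x) with N = n + eps (up to a
   shift) and s = a + b + 1, whose coefficients are polynomials in N. The
   reflection I : N |-> - N - s fixes them, and the operators that act on F
   both in N and in x are built from the three-term relation and from the
   hypergeometric equation: for every I-invariant operator in the algebra
   generated by T and the rational functions of N there is a differential
   operator in x with the same effect on F.
   For integral alpha (beta) the gauge factors of all kernel functions at z = 1
   (z = -1) agree up to rational functions of N, so that the Darboux transform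
   of F becomes U = det (...), a determinant with polynomial coefficients that
   is I-invariant after a shift of N by half a step; when the order k + l is
   odd, the step is made even by passing to the parameter a + 1. Hence U = S F
   with a differential operator S, up to a factor depending on N. Conversely
   the kernel of the Darboux operator P is annihilated by
   f(L) = (L - 1)^k (L + 1)^l, so f(L) = R P for a difference operator R, and
   f(z) F is obtained from U. Symmetrizing R and clearing denominators gives a
   differential operator A with A U = theta(N) f^M F, and conjugation by f
   combines A and S into a differential operator with eigenfunction U.
   Everything up to here is an identity between formal power series; it
   becomes a statement about functions because the series converge absolutely
   in the unit disc and may be differentiated termwise. *)
From HB Require Import structures.
Require Import Defs.
From mathcomp Require Import all_boot all_order all_algebra.
From mathcomp Require Import perm generic_quotient fraction ring lra zify.
From mathcomp Require Import all_classical all_reals all_analysis.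
Set Implicit Arguments.
Unset Strict Implicit.
Unset Printing Implicit Defensive.
Import Order.TTheory GRing.Theory Num.Theory.
Import numFieldNormedType.Exports.
Local Open Scope ring_scope.

(** * Formal series and differential operators *)

(** Why invariance matters: write λ = N (N + s), y = 2N + s, and let D be the differential operators
    in x. The hypergeometric equation makes λ an operator in x on F, and K[N] = K[λ] + y K[λ].
    Together with the three-term relation, a second relation of first order in x d/dx expresses F(N
    + 1) and F(N - 1) separately, so every shift of F lies, up to a denominator in N, in D F + y D
    F. Since y is odd under the reflection, invariance removes the second summand. This is why each
    multiplier (denominators, gauge ratios, the coefficients of R) is made symmetric before it is
    used. The other obstacle is triviality. A factor y^2 gives θ a root and so makes it
    non-constant; an operator of order zero is then excluded by the lowest coefficient of U in x.
    The factors cleared on the way are powers of f, which vanishes only at z = 1 and z = -1, and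
    powers of x, which vanish only at z = 1; hence clearing them creates no pole inside the unit
    disc. *)

Section Series.
Variable K : numFieldType.
Implicit Types (P Q : {poly K}).

(* A Laurent series in x with coefficients in E is a function int -> E. *)
Definition pmul (E : lmodType K) P (u : int -> E) : int -> E :=
  fun i => \sum_(a < size P) P`_a *: u (i - a%:Z).

Definition sder (E : lmodType K) (u : int -> E) : int -> E :=
  fun i => (i + 1)%:~R *: u (i + 1).

Definition sadd (E : zmodType) (u v : int -> E) : int -> E := fun i => u i + v i.

Section Theory.
Variable E : lmodType K.
Implicit Types u v : int -> E.

Lemma pmul_widen n P u i : (size P <= n)%N ->
  pmul P u i = \sum_(a < n) P`_a *: u (i - a%:Z).
Proof.
move=> le_n; rewrite /pmul (big_ord_widen n (fun a => P`_a *: u (i - a%:Z))) //.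
rewrite big_mkcond; apply: eq_bigr => a _; case: ltnP => // h.
by rewrite nth_default // scale0r.
Qed.

Lemma pmulDl P Q u : pmul (P + Q) u = sadd (pmul P u) (pmul Q u).
Proof.
apply/funext => i; rewrite /sadd.
rewrite !(@pmul_widen (maxn (size P) (size Q))) ?leq_maxl ?leq_maxr ?size_polyD //.
by rewrite -big_split; apply: eq_bigr => a _; rewrite coefD scalerDl.
Qed.

Lemma pmulDr P u v : pmul P (sadd u v) = sadd (pmul P u) (pmul P v).
Proof.
apply/funext => i; rewrite /sadd /pmul -big_split.
by apply: eq_bigr => a _; rewrite scalerDr.
Qed.

Lemma pmulZ (c : K) P u : pmul (c *: P) u = fun i => c *: pmul P u i.
Proof.
apply/funext => i; rewrite (@pmul_widen (size P)) ?size_scale_leq // /pmul scaler_sumr.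
by apply: eq_bigr => a _; rewrite coefZ scalerA.
Qed.

Lemma pmulC (c : K) u : pmul c%:P u = fun i => c *: u i.
Proof.
apply/funext => i; rewrite (@pmul_widen 1) ?size_polyC_leq1 //.
by rewrite big_ord1 coefC subr0.
Qed.

Lemma pmul0 u : pmul 0 u = fun=> 0.
Proof. by rewrite -polyC0 pmulC; apply/funext => i; rewrite scale0r. Qed.

Lemma pmul1 u : pmul 1 u = u.
Proof. by rewrite pmulC; apply/funext => i; rewrite scale1r. Qed.

Lemma pmulMX P u : pmul (P * 'X) u = fun i => pmul P u (i - 1).
Proof.
apply/funext => i.
rewrite (@pmul_widen (size P).+1); last first.
  by rewrite (leq_trans (size_polyMleq _ _)) // size_polyX addn2.
rewrite big_ord_recl coefMX scale0r add0r; apply: eq_bigr => a _.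
by rewrite coefMX lift0 /=; congr (_ *: u _); lia.
Qed.

Lemma pmulX u : pmul 'X u = fun i => u (i - 1).
Proof. by rewrite -['X]mul1r pmulMX pmul1. Qed.

Lemma pmulM P Q u : pmul (P * Q) u = pmul P (pmul Q u).
Proof.
elim/poly_ind: P u => [|P c IH] u; first by rewrite mul0r !pmul0.
rewrite mulrDl !pmulDl -mulrA ['X * Q]mulrC mulrA pmulMX IH mul_polyC pmulZ pmulC.
by rewrite pmulMX.
Qed.

Lemma pmul_sum d P (v : nat -> int -> E) :
  pmul P (fun i => \sum_(j < d) v j i) = fun i => \sum_(j < d) pmul P (v j) i.
Proof.
apply/funext => i; rewrite /pmul exchange_big /=; apply: eq_bigr => a _.
by rewrite scaler_sumr.
Qed.

Lemma pmulCA P Q u : pmul P (pmul Q u) = pmul Q (pmul P u).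
Proof. by rewrite -!pmulM mulrC. Qed.

Lemma sderD u v : sder (sadd u v) = sadd (sder u) (sder v).
Proof. by apply/funext => i; rewrite /sder /sadd scalerDr. Qed.

Lemma sder_pmul P u : sder (pmul P u) = sadd (pmul P^`() u) (pmul P (sder u)).
Proof.
elim/poly_ind: P u => [|P c IH] u.
  by rewrite deriv0 !pmul0; apply/funext => i; rewrite /sder /sadd scaler0 addr0.
rewrite derivD derivM derivX derivC addr0 mulr1.
apply/funext => i; have := congr1 (fun f => f (i - 1)) (IH u).
rewrite /sder /sadd subrK !pmulDl /sadd !pmulMX !pmulC.
have -> : i + 1 - 1 = i by lia.
move=> H; rewrite scalerDr [in LHS]intrD scalerDl H scale1r.
by rewrite scalerA mulrC -scalerA -!addrA intrD; congr (_ + _); rewrite addrCA.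
Qed.

End Theory.

Lemma pmul_map (E E' : lmodType K) (phi : E -> E') P (u : int -> E) :
  (forall x y, phi (x + y) = phi x + phi y) ->
  (forall a x, phi (a *: x) = a *: phi x) ->
  pmul P (phi \o u) = phi \o pmul P u.
Proof.
move=> phiD phiZ; have phi0 : phi 0 = 0 by rewrite -(scale0r 0) phiZ scale0r.
apply/funext => i; rewrite /pmul /=; apply/esym.
by rewrite (big_morph phi phiD phi0); apply: eq_bigr => a _; rewrite phiZ.
Qed.

(** Operators of the Weyl algebra are kept as syntax, so that one and the same operator acts on
    series over any K-module: on series of polynomials in N and on their values at a point. *)
Inductive wop : Type :=
  | WI
  | WP of {poly K} & wop
  | WD of wop
  | WA of wop & wop.

Fixpoint act (E : lmodType K) (w : wop) (u : int -> E) : int -> E :=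
  match w with
  | WI => u
  | WP P w => pmul P (act w u)
  | WD w => sder (act w u)
  | WA w1 w2 => sadd (act w1 u) (act w2 u)
  end.

Fixpoint wcomp w1 w2 :=
  match w1 with
  | WI => w2
  | WP P w => WP P (wcomp w w2)
  | WD w => WD (wcomp w w2)
  | WA w w' => WA (wcomp w w2) (wcomp w' w2)
  end.

Lemma act_comp (E : lmodType K) w1 w2 (u : int -> E) :
  act (wcomp w1 w2) u = act w1 (act w2 u).
Proof. by elim: w1 => //= [P w ->|w ->|w -> w' ->]. Qed.

(** Operators in x commute with every K-linear map of the coefficients. The maps that occur are
    multiplication by a polynomial in N, the shift, the reflection and the evaluation at a point. *)
Lemma act_map (E E' : lmodType K) (phi : E -> E') w (u : int -> E) :
  (forall x y, phi (x + y) = phi x + phi y) ->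
  (forall a x, phi (a *: x) = a *: phi x) ->
  act w (phi \o u) = phi \o act w u.
Proof.
move=> phiD phiZ; elim: w => //= [P w ->|w ->|w -> w' ->].
- exact: pmul_map.
- by apply/funext => i; rewrite /sder /= phiZ.
- by apply/funext => i; rewrite /sadd /= phiD.
Qed.

Lemma act_add (E : lmodType K) w (u v : int -> E) :
  act w (sadd u v) = sadd (act w u) (act w v).
Proof.
elim: w => //= [P w ->|w ->|w -> w' ->]; rewrite ?pmulDr ?sderD //.
by apply/funext => i; rewrite /sadd addrACA.
Qed.

(* The conjugate of w by the multiplication operator P has poles along P
   only, which a power of P clears. *)
Lemma act_conj_pmul P w : exists M w', forall (E : lmodType K) (u : int -> E),
  act w' (pmul P u) = pmul (P ^+ M.+1) (act w u).
Proof.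
elim: w => [|Q w [M [w' H]]|w [M [w' H]]|w1 [M1 [w1' H1]] w2 [M2 [w2' H2]]].
- by exists 0%N, WI => E u; rewrite expr1.
- by exists M, (WP Q w') => E u /=; rewrite H pmulCA.
(* By the Leibniz rule, P D - (M + 1) P' cancels the term in which D falls on P^(M + 1). *)
- exists M.+1, (WA (WP P (WD w')) (WP (- (M.+1%:R *: P^`())) w')) => E u /=.
  rewrite H sder_pmul pmulDr -!pmulM -exprS.
  apply/funext => i; rewrite /sadd -[RHS]add0r addrAC; congr (_ + _).
  rewrite -[_ + _]/(sadd (pmul _ _) (pmul _ _) i) -pmulDl.
  suff -> : P * (P ^+ M.+1)^`() + - (M.+1%:R *: P^`()) * P ^+ M.+1 = 0 by rewrite pmul0.
  by rewrite deriv_exp /= scaler_nat mulNr !mulrnAl mulrnAr mulrCA -exprS subrr.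
- exists (M1.+1 + M2)%N, (WA (WP (P ^+ M2.+1) w1') (WP (P ^+ M1.+1) w2')) => E u /=.
  rewrite H1 H2 pmulDr -!pmulM -!exprD.
  by congr (sadd (pmul (_ ^+ _) _) (pmul (_ ^+ _) _)); lia.
Qed.

Lemma act_conj_pmulX P w p : exists M w', forall (E : lmodType K) (u : int -> E),
  act w' (pmul (P ^+ p) u) = pmul (P ^+ M) (act w u).
Proof.
have [M [w' H]] := act_conj_pmul (P ^+ p) w.
by exists (p * M.+1)%N, w' => E u; rewrite H -exprM.
Qed.

(** The Leibniz rule moves all derivations to the right of the polynomials. The coefficients p_j of
    this normal form become those of the differential operator on functions. *)
Lemma act_normal w : exists d (p : nat -> {poly K}), forall (E : lmodType K) (u : int -> E),
  act w u = fun i => \sum_(j < d) pmul (p j) (iter j (@sder E) u) i.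
Proof.
elim: w => [|P w [d [p H]]|w [d [p H]]|w1 [d1 [p1 H1]] w2 [d2 [p2 H2]]].
- by exists 1%N, (fun=> 1) => E u; apply/funext => i; rewrite big_ord1 pmul1.
- exists d, (fun j => P * p j) => E u /=; rewrite H; apply/funext => i.
  under [RHS]eq_bigr => j _ do rewrite pmulM.
  by rewrite (pmul_sum d P (fun j => pmul (p j) (iter j (@sder E) u))).
- exists d.+1, (fun j => (if (j < d)%N then (p j)^`() else 0) +
                         (if j is j'.+1 then p j' else 0)) => E u /=.
  rewrite H; apply/funext => i.
  under [RHS]eq_bigr => j _ do rewrite pmulDl /sadd.
  rewrite big_split /=.
  rewrite [X in X + _]big_ord_recr /= ltnn pmul0 addr0.
  rewrite [X in _ + X]big_ord_recl /= pmul0 add0r.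
  rewrite /sder scaler_sumr -big_split; apply: eq_bigr => j _ /=.
  rewrite ltn_ord.
  by have := congr1 (fun f => f i) (sder_pmul (p j) (iter j (@sder E) u)).
- exists (d1 + d2)%N, (fun j => (if (j < d1)%N then p1 j else 0) +
                         (if (j < d2)%N then p2 j else 0)) => E u /=.
  rewrite H1 H2; apply/funext => i; rewrite /sadd.
  under [RHS]eq_bigr => j _ do rewrite pmulDl /sadd.
  rewrite big_split /=; congr (_ + _).
    rewrite (big_ord_widen (d1 + d2) (fun j => pmul (p1 j) (iter j (@sder E) u) i)) ?leq_addr //.
    by rewrite big_mkcond; apply: eq_bigr => j _; case: ifP => // _; rewrite pmul0.
  rewrite (big_ord_widen (d1 + d2) (fun j => pmul (p2 j) (iter j (@sder E) u) i)) ?leq_addl //.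
  by rewrite big_mkcond; apply: eq_bigr => j _; case: ifP => // _; rewrite pmul0.
Qed.

End Series.
Arguments WI {K}.

(** * Hypergeometric coefficients *)

Section HypergeometricCoefficients.
Variable K : numFieldType.
Implicit Types a b s N : K.

(* The coefficient of x^i in F(-N, N + s; a + 1; x). *)
Definition hcoef a s N (i : int) : K :=
  if i is Posz n then
    \prod_(t < n) ((t%:R * (t%:R + s) - N * (N + s)) / ((a + 1 + t%:R) * t.+1%:R))
  else 0.

Lemma hcoef0 a s N : hcoef a s N 0 = 1.
Proof. exact: big_ord0. Qed.

Lemma hcoef_nat a s N (n : nat) : hcoef a s N n.+1 =
  hcoef a s N n * ((n%:R * (n%:R + s) - N * (N + s)) / ((a + 1 + n%:R) * n.+1%:R)).
Proof. exact: big_ord_recr. Qed.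

Lemma hcoefS a s N (i : int) : (forall n : nat, i = n -> a + 1 + n%:R != 0) ->
  (i + 1)%:~R * (a + 1 + i%:~R) * hcoef a s N (i + 1) =
  (i%:~R * (i%:~R + s) - N * (N + s)) * hcoef a s N i.
Proof.
case: i => [n|n] Hn.
  have -> : n%:Z + 1 = n.+1%:Z by lia.
  rewrite /hcoef big_ord_recr /= -!pmulrn; have := Hn n erefl.
  by move=> h; field; rewrite h nat1r pnatr_eq0.
case: n Hn => [|n] _; first by rewrite (_ : Negz 0 + 1 = 0) // !mul0r mulr0.
have -> : Negz n.+1 + 1 = Negz n by lia.
by rewrite !mulr0.
Qed.

Let yy s N := 2 * N + s.
Let up a s N := (yy s N - 1) * (2 * (N + a + 1) * (N + s)).
Let dn b s N := (yy s N + 1) * (2 * N * (N + b)).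

(** With y = 2N + s and θ = x d/dx, the sum is the three-term relation for z = 1 - 2x with its
    denominators y (y^2 - 1) cleared, and the difference is a relation of first order in θ. They are
    proved together because the induction step of each uses both. *)
Lemma hcoef_shift a b N (n : nat) (s := a + b + 1) :
  (forall t, (t < n)%N -> a + 1 + t%:R != 0) ->
  up a s N * hcoef a s (N + 1) n + dn b s N * hcoef a s (N - 1) n =
    yy s N * ((yy s N ^+ 2 - 1) * (hcoef a s N n - 2 * hcoef a s N (n%:Z - 1))
              - (b ^+ 2 - a ^+ 2) * hcoef a s N n) /\
  up a s N * hcoef a s (N + 1) n - dn b s N * hcoef a s (N - 1) n =
    (yy s N ^+ 2 - 1) * ((4 * n%:R + 2 * a + 1) * hcoef a s N n
                         - 2 * (2 * n%:R + s - 2) * hcoef a s N (n%:Z - 1))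
    + (b ^+ 2 - a ^+ 2) * hcoef a s N n.
Proof.
elim: n => [|n IH] Ha.
  rewrite !hcoef0 /= /up /dn /yy /s; split; ring.
have [IH1 IH2] := IH (fun t h => Ha t (ltnW h)).
have an0 : a + 1 + n%:R != 0 by exact: Ha.
have HS N' : (n%:R + 1) * (a + 1 + n%:R) * hcoef a s N' n.+1 =
    (n%:R * (n%:R + s) - N' * (N' + s)) * hcoef a s N' n.
  have := @hcoefS a s N' n; rewrite -pmulrn -addn1 PoszD intrD -pmulrn; apply.
  by move=> m [<-].
have HP : n%:R * (a + n%:R) * hcoef a s N n =
    ((n%:R - 1) * (n%:R - 1 + s) - N * (N + s)) * hcoef a s N (n%:Z - 1).
  have := @hcoefS a s N (n%:Z - 1); rewrite subrK intrB -pmulrn.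
  have -> : a + 1 + (n%:R - 1%:~R) = a + n%:R by ring.
  apply=> m hm; have hn : n = m.+1 by lia.
  by apply: Ha; rewrite hn; lia.
have c0 : (n%:R + 1) * (a + 1 + n%:R) != 0.
  by rewrite mulf_neq0 // -natr1 pnatr_eq0.
have -> : n.+1%:Z - 1 = n by lia.
rewrite -[n.+1%:R]natr1.
move: (HS (N + 1)) (HS (N - 1)) (HS N) HP IH1 IH2.
set F1 := hcoef a s (N + 1) n; set F2 := hcoef a s (N - 1) n.
set F1' := hcoef a s (N + 1) n.+1; set F2' := hcoef a s (N - 1) n.+1.
set F := hcoef a s N n; set F' := hcoef a s N n.+1; set Fp := hcoef a s N (n%:Z - 1).
move=> E1 E2 E3 E4 E5 E6.
split; apply: (mulfI c0); apply/subr0_eq.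
(* The difference of the two sides of the goal is written as an explicit combination of the
   coefficient recurrences at N + 1, N - 1, N and of both relations at n; each bracket vanishes by
   one of [E1] to [E6]. *)
- transitivity (
    up a s N * ((n%:R + 1) * (a + 1 + n%:R) * F1' - (n%:R * (n%:R + s) - (N + 1) * (N + 1 + s)) * F1)
    + dn b s N * ((n%:R + 1) * (a + 1 + n%:R) * F2' - (n%:R * (n%:R + s) - (N - 1) * (N - 1 + s)) * F2)
    - (yy s N * (yy s N ^+ 2 - 1) - yy s N * (b ^+ 2 - a ^+ 2)) *
       ((n%:R + 1) * (a + 1 + n%:R) * F' - (n%:R * (n%:R + s) - N * (N + s)) * F)
    + 2 * yy s N * (yy s N ^+ 2 - 1) * (n%:R * (a + n%:R) * F -
        ((n%:R - 1) * (n%:R - 1 + s) - N * (N + s)) * Fp)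
    + (n%:R * (n%:R + s) - N * (N + s) - 1) * (up a s N * F1 + dn b s N * F2 -
       yy s N * ((yy s N ^+ 2 - 1) * (F - 2 * Fp) - (b ^+ 2 - a ^+ 2) * F))
    - yy s N * (up a s N * F1 - dn b s N * F2 -
       ((yy s N ^+ 2 - 1) * ((4 * n%:R + 2 * a + 1) * F - 2 * (2 * n%:R + s - 2) * Fp)
       + (b ^+ 2 - a ^+ 2) * F))); last by rewrite E1 E2 E3 E4 E5 E6 !subrr !mulr0; ring.
  rewrite /up /dn /yy /s; ring.
- transitivity (
    up a s N * ((n%:R + 1) * (a + 1 + n%:R) * F1' - (n%:R * (n%:R + s) - (N + 1) * (N + 1 + s)) * F1)
    - dn b s N * ((n%:R + 1) * (a + 1 + n%:R) * F2' - (n%:R * (n%:R + s) - (N - 1) * (N - 1 + s)) * F2)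
    - ((yy s N ^+ 2 - 1) * (4 * n%:R + 2 * a + 5) + (b ^+ 2 - a ^+ 2)) *
       ((n%:R + 1) * (a + 1 + n%:R) * F' - (n%:R * (n%:R + s) - N * (N + s)) * F)
    + 2 * (2 * n%:R + s + 2) * (yy s N ^+ 2 - 1) * (n%:R * (a + n%:R) * F -
        ((n%:R - 1) * (n%:R - 1 + s) - N * (N + s)) * Fp)
    + (n%:R * (n%:R + s) - N * (N + s) - 1) * (up a s N * F1 - dn b s N * F2 -
       ((yy s N ^+ 2 - 1) * ((4 * n%:R + 2 * a + 1) * F - 2 * (2 * n%:R + s - 2) * Fp)
       + (b ^+ 2 - a ^+ 2) * F))
    - yy s N * (up a s N * F1 + dn b s N * F2 -
       yy s N * ((yy s N ^+ 2 - 1) * (F - 2 * Fp) - (b ^+ 2 - a ^+ 2) * F)));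
     last by rewrite E1 E2 E3 E4 E5 E6 !subrr !mulr0; ring.
  rewrite /up /dn /yy /s; ring.
Qed.

(* Raising and lowering the parameter a by one moves N by half a step: these
   relations turn an operator of odd order into one of even order. *)
Lemma hcoef_raise a s N (n : nat) (b := s - a - 1) :
  (forall t : nat, a + 1 + t%:R != 0) ->
  (a + 1) * (2 * N + s) * hcoef a s N n =
  (N + s) * (N + a + 1) * hcoef (a + 1) (s + 1) N n
  - N * (N + b) * hcoef (a + 1) (s + 1) (N - 1) n.
Proof.
move=> Ha.
have a1 : a + 1 != 0 by have := Ha 0%N; rewrite addr0.
(* The factor N + s + n raises the parameters N + s and a + 1 of F by one; in [H2] the factor N - n
   does the same for -N and a + 1. The weights N + a + 1 and N + b are chosen so that n remains only
   in the common factor a + 1 + n: (N + a + 1) (N + s + n) - (N + b) (N - n) = (2N + s) (a + 1 +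
   n). *)
have H1 : forall n : nat, (a + 1) * (hcoef a s N n * (N + s + n%:R)) =
   (a + 1 + n%:R) * (N + s) * hcoef (a + 1) (s + 1) N n.
  elim=> [|m IH]; first by rewrite !hcoef0; ring.
  rewrite !hcoef_nat.
  have h1 := Ha m; have h2 := Ha m.+1; rewrite -natr1 in h2 *.
  have m0 : m%:R + 1 != 0 :> K by rewrite natr1 pnatr_eq0.
  have h3 : a + 1 + 1 + m%:R != 0 by rewrite (_ : _ + m%:R = a + 1 + (m%:R + 1)) //; ring.
  apply: (mulfI h1); apply: (mulfI h3); apply: (mulfI m0).
  transitivity ((a + 1 + 1 + m%:R) * (m%:R - N) * (N + s + (m%:R + 1)) *
    ((a + 1) * (hcoef a s N m * (N + s + m%:R)))).
    by field; rewrite m0 h1.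
  by rewrite IH; field; rewrite m0 h3.
have H2 : forall n : nat, (a + 1) * (hcoef a s N n * (N - n%:R)) =
   (a + 1 + n%:R) * N * hcoef (a + 1) (s + 1) (N - 1) n.
  elim=> [|m IH]; first by rewrite !hcoef0; ring.
  rewrite !hcoef_nat.
  have h1 := Ha m; have h2 := Ha m.+1; rewrite -natr1 in h2 *.
  have m0 : m%:R + 1 != 0 :> K by rewrite natr1 pnatr_eq0.
  have h3 : a + 1 + 1 + m%:R != 0 by rewrite (_ : _ + m%:R = a + 1 + (m%:R + 1)) //; ring.
  apply: (mulfI h1); apply: (mulfI h3); apply: (mulfI m0).
  transitivity ((a + 1 + 1 + m%:R) * (m%:R + N + s) * (m%:R + 1 - N) *
    ((a + 1) * (hcoef a s N m * (N - m%:R)))).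
    by field; rewrite m0 h1.
  by rewrite IH; field; rewrite m0 h3.
have hn := Ha n.
apply: (mulfI hn); transitivity (
   (N + a + 1) * ((a + 1) * (hcoef a s N n * (N + s + n%:R))) -
   (N + b) * ((a + 1) * (hcoef a s N n * (N - n%:R)))); first by rewrite /b; ring.
by rewrite H1 H2; ring.
Qed.

(** Both coefficients on the left are multiples of the one on the right, and the difference of the
    multipliers contains the factor n + 1. As series: F(N) - F(N - 1) is a multiple of x times F
    with raised parameters. *)
Lemma hcoef_lower a s N (n : nat) :
  (forall t : nat, a + 1 + t%:R != 0) ->
  (a + 1) * (hcoef a s N n.+1 - hcoef a s (N - 1) n.+1) =
  - (2 * N + s - 1) * hcoef (a + 1) (s + 1) (N - 1) n.
Proof.
move=> Ha.
have a1 : a + 1 != 0 by have := Ha 0%N; rewrite addr0.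
have H : (a + 1) * hcoef a s N n.+1 * n.+1%:R =
     - N * (N + s + n%:R) * hcoef (a + 1) (s + 1) (N - 1) n.
  elim: n => [|m IH].
    rewrite /hcoef big_ord1 big_ord0 /=; by field; rewrite a1.
  rewrite [hcoef _ _ _ m.+2]hcoef_nat [hcoef _ _ _ m.+1 in RHS]hcoef_nat.
  have h1 := Ha m.+1; rewrite -!natr1 in h1 IH *.
  have m0 : m%:R + 1 != 0 :> K by rewrite natr1 pnatr_eq0.
  have m1 : m%:R + 1 + 1 != 0 :> K by rewrite !natr1 pnatr_eq0.
  have h3 : a + 1 + 1 + m%:R != 0 by rewrite (_ : _ + m%:R = a + 1 + (m%:R + 1)) //; ring.
  apply: (mulfI h1); apply: (mulfI m0).
  transitivity ((m%:R + 1 - N) * (m%:R + 1 + N + s) *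
     ((a + 1) * hcoef a s N m.+1 * (m%:R + 1))).
    by field; rewrite h1 m1.
  by rewrite IH; field; rewrite h3 m0.
have H2 : (a + 1) * hcoef a s (N - 1) n.+1 * n.+1%:R =
     (N + s - 1) * (n%:R + 1 - N) * hcoef (a + 1) (s + 1) (N - 1) n.
  elim: n {H} => [|m IH].
    rewrite /hcoef big_ord1 big_ord0 /=; by field; rewrite a1.
  rewrite [hcoef _ _ _ m.+2]hcoef_nat [hcoef _ _ _ m.+1 in RHS]hcoef_nat.
  have h1 := Ha m.+1; rewrite -!natr1 in h1 IH *.
  have m0 : m%:R + 1 != 0 :> K by rewrite natr1 pnatr_eq0.
  have m1 : m%:R + 1 + 1 != 0 :> K by rewrite !natr1 pnatr_eq0.
  have h3 : a + 1 + 1 + m%:R != 0 by rewrite (_ : _ + m%:R = a + 1 + (m%:R + 1)) //; ring.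
  apply: (mulfI h1); apply: (mulfI m0).
  transitivity ((m%:R + 1 - N + 1) * (m%:R + N + s) *
     ((a + 1) * hcoef a s (N - 1) m.+1 * (m%:R + 1))).
    by field; rewrite h1 m1.
  by rewrite IH; field; rewrite h3 m0.
have n0 : n.+1%:R != 0 :> K by rewrite pnatr_eq0.
apply: (mulIf n0).
by rewrite mulrBr mulrBl H H2 -natr1; ring.
Qed.

End HypergeometricCoefficients.

(** * Polynomials in N: shifts, reflections and the modules spanned by a series *)

Section PolynomialCoefficients.
Variable K : numFieldType.
Implicit Types (p q : {poly K}) (u v : int -> {poly K}) (s : K) (m n : int).

(** The lattice n + e is infinite. This turns identities between functions of the integer n into
    identities in the indeterminate N. *)
Lemma poly_eq_int (e : K) p q :
  (forall n, p.[n%:~R + e] = q.[n%:~R + e]) -> p = q.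
Proof.
move=> H; apply/subr0_eq/eqP; apply: contraT => nz.
pose rs := [seq (i%:R + e : K) | i <- iota 0 (size (p - q))].
have H1 : all (root (p - q)) rs.
  apply/allP => x /mapP[i _ ->].
  by rewrite /root hornerD hornerN -(H i) subrr.
have H2 : uniq rs.
  rewrite map_inj_uniq ?iota_uniq // => i j /addIr /eqP.
  by rewrite eqr_nat => /eqP.
by have := max_poly_roots nz H1 H2; rewrite /rs size_map size_iota ltnn.
Qed.

Lemma poly_eq p q : (forall x, p.[x] = q.[x]) -> p = q.
Proof. by move=> H; apply: (@poly_eq_int 0) => n. Qed.

Definition sh m p := p \Po ('X + (m%:~R)%:P).
Definition refl s p := p \Po (- 'X - s%:P).

Lemma sh_horner m p x : (sh m p).[x] = p.[x + m%:~R].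
Proof. by rewrite /sh horner_comp !hornerE. Qed.
Lemma refl_horner s p x : (refl s p).[x] = p.[- x - s].
Proof. by rewrite /refl horner_comp !hornerE. Qed.

Lemma shD m p q : sh m (p + q) = sh m p + sh m q.
Proof. exact: comp_polyD. Qed.
Lemma shM m p q : sh m (p * q) = sh m p * sh m q.
Proof. exact: comp_polyM. Qed.
Lemma shZ m c p : sh m (c *: p) = c *: sh m p.
Proof. exact: comp_polyZ. Qed.
Lemma reflD s p q : refl s (p + q) = refl s p + refl s q.
Proof. exact: comp_polyD. Qed.
Lemma reflM s p q : refl s (p * q) = refl s p * refl s q.
Proof. exact: comp_polyM. Qed.
Lemma reflZ s c p : refl s (c *: p) = c *: refl s p.
Proof. exact: comp_polyZ. Qed.

Lemma sh_prod m (n : nat) (f : 'I_n -> {poly K}) :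
  sh m (\prod_(i < n) f i) = \prod_(i < n) sh m (f i).
Proof. exact: (rmorph_prod (comp_poly _)). Qed.
Lemma refl_prod s (n : nat) (f : 'I_n -> {poly K}) :
  refl s (\prod_(i < n) f i) = \prod_(i < n) refl s (f i).
Proof. exact: (rmorph_prod (comp_poly _)). Qed.
Lemma refl_sum s (n : nat) (f : 'I_n -> {poly K}) :
  refl s (\sum_(i < n) f i) = \sum_(i < n) refl s (f i).
Proof. exact: (raddf_sum (comp_poly _)). Qed.
Lemma sh_sum m (n : nat) (f : 'I_n -> {poly K}) :
  sh m (\sum_(i < n) f i) = \sum_(i < n) sh m (f i).
Proof. exact: (raddf_sum (comp_poly _)). Qed.

Lemma sh0 p : sh 0 p = p.
Proof. by apply: poly_eq => x; rewrite sh_horner addr0. Qed.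
Lemma sh_sh m n p : sh m (sh n p) = sh (m + n) p.
Proof. by apply: poly_eq => x; rewrite !sh_horner intrD addrA. Qed.
Lemma reflK s p : refl s (refl s p) = p.
Proof. by apply: poly_eq => x; rewrite !refl_horner opprD !opprK addrK. Qed.
Lemma refl_sh s m p : refl s (sh m p) = sh (- m) (refl s p).
Proof.
by apply: poly_eq => x; rewrite !(refl_horner, sh_horner) intrN; congr (p.[_]); ring.
Qed.
Lemma sh_eq0 m p : (sh m p == 0) = (p == 0).
Proof.
apply/eqP/eqP => [H|->]; last exact: comp_poly0.
by rewrite -[p]sh0 -(addNr m) -sh_sh H; apply: comp_poly0.
Qed.
Lemma refl_eq0 s p : (refl s p == 0) = (p == 0).
Proof.
apply/eqP/eqP => [H|->]; last exact: comp_poly0.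
by rewrite -[p](reflK s) H; apply: comp_poly0.
Qed.

Definition smul p u : int -> {poly K} := fun i => p * u i.
Definition shs m u : int -> {poly K} := fun i => sh m (u i).
Definition refls s u : int -> {poly K} := fun i => refl s (u i).

Lemma act_smul w p u : act w (smul p u) = smul p (act w u).
Proof. by apply: act_map => [x y|c x]; rewrite ?mulrDr ?scalerAr. Qed.
Lemma act_shs w m u : act w (shs m u) = shs m (act w u).
Proof. by apply: act_map => [x y|c x]; rewrite ?shD ?shZ. Qed.
Lemma act_refls w s u : act w (refls s u) = refls s (act w u).
Proof. by apply: act_map => [x y|c x]; rewrite ?reflD ?reflZ. Qed.

Lemma smulM p q u : smul p (smul q u) = smul (p * q) u.
Proof. by apply/funext => i; rewrite /smul mulrA. Qed.
Lemma smul1 u : smul 1 u = u.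
Proof. by apply/funext => i; rewrite /smul mul1r. Qed.
Lemma smulDl p q u : smul (p + q) u = sadd (smul p u) (smul q u).
Proof. by apply/funext => i; rewrite /smul /sadd mulrDl. Qed.
Lemma smulDr p u v : smul p (sadd u v) = sadd (smul p u) (smul p v).
Proof. by apply/funext => i; rewrite /smul /sadd mulrDr. Qed.
Lemma shs_smul m p u : shs m (smul p u) = smul (sh m p) (shs m u).
Proof. by apply/funext => i; rewrite /smul /shs shM. Qed.
Lemma refls_smul s p u : refls s (smul p u) = smul (refl s p) (refls s u).
Proof. by apply/funext => i; rewrite /smul /refls reflM. Qed.
Lemma shs_sadd m u v : shs m (sadd u v) = sadd (shs m u) (shs m v).
Proof. by apply/funext => i; rewrite /sadd /shs shD. Qed.
Lemma refls_sadd s u v : refls s (sadd u v) = sadd (refls s u) (refls s v).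
Proof. by apply/funext => i; rewrite /sadd /refls reflD. Qed.
Lemma shs_shs m n u : shs m (shs n u) = shs (m + n) u.
Proof. by apply/funext => i; rewrite /shs sh_sh. Qed.
Lemma shs0 u : shs 0 u = u.
Proof. by apply/funext => i; rewrite /shs sh0. Qed.
Lemma reflsK s u : refls s (refls s u) = u.
Proof. by apply/funext => i; rewrite /refls reflK. Qed.
Lemma smulI p u v : p != 0 -> smul p u = smul p v -> u = v.
Proof.
move=> p0 H; apply/funext => i; apply: (mulfI p0).
exact: (congr1 (fun f => f i) H).
Qed.

(* The K(N)[T, T^-1]-submodule generated by u. *)
Inductive span u : (int -> {poly K}) -> Prop :=
  | span_id : span u u
  | span_add v v' : span u v -> span u v' -> span u (sadd v v')
  | span_smul p v : span u v -> span u (smul p v)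
  | span_shs m v : span u v -> span u (shs m v)
  | span_div d v : d != 0 -> span u (smul d v) -> span u v.

Lemma span_trans u v v' : span u v -> span v v' -> span u v'.
Proof.
move=> uv; elim=> //.
- by move=> *; apply: span_add.
- by move=> *; apply: span_smul.
- by move=> *; apply: span_shs.
- by move=> d v0 d0 _ ?; apply: span_div d0 _.
Qed.

Lemma span_act w u v : span u v -> span (act w u) (act w v).
Proof.
elim=> [|v1 v2 _ ? _ ?|p v1 _ ?|m v1 _ ?|d v1 d0 _ H].
- exact: span_id.
- by rewrite act_add; apply: span_add.
- by rewrite act_smul; apply: span_smul.
- by rewrite act_shs; apply: span_shs.
- by apply: span_div d0 _; rewrite -act_smul.
Qed.

Lemma span_sum u (n : nat) (c : nat -> int -> {poly K}) :
  (0 < n)%N -> (forall j, (j < n)%N -> span u (c j)) ->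
  span u (fun i => \sum_(j < n) c j i).
Proof.
case: n => // n _; elim: n => [|n IH] H.
  have -> : (fun i => \sum_(j < 1) c j i) = c 0%N.
    by apply/funext => i; rewrite big_ord1.
  exact: H.
have -> : (fun i => \sum_(j < n.+2) c j i) = sadd (fun i => \sum_(j < n.+1) c j i) (c n.+1).
  by apply/funext => i; rewrite big_ord_recr.
apply: span_add; last exact: H.
by apply: IH => j jn; apply: H; apply: ltnW.
Qed.

(** The difference operator with coefficient W_j at T^(j - R). The window from -R to R is symmetric,
    so conjugation by a reflection maps such operators to themselves, reversing j. *)
Definition comb R (W : nat -> {poly K}) u : int -> {poly K} :=
  fun i => \sum_(j < R.*2.+1) W j * sh (j%:Z - R%:Z) (u i).

Lemma comb_widen R R' W u : (R <= R')%N -> exists W', comb R W u = comb R' W' u.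
Proof.
move=> le_R; rewrite -(subnK le_R) addnC; elim: (R' - R)%N => [|k [W' ->]].
  by exists W; rewrite addn0.
exists (fun j => if j is j'.+1 then if (j' < (R + k).*2.+1)%N then W' j' else 0 else 0).
apply/funext => i; rewrite /comb addnS doubleS [RHS]big_ord_recl mul0r add0r.
rewrite [RHS]big_ord_recr /= ltnn mul0r addr0; apply: eq_bigr => j _ /=.
rewrite ifT; last by have := ltn_ord j; rewrite /bump; lia.
by congr (_ * sh _ _); rewrite /bump; lia.
Qed.

(** All divisions are collected in one factor d on the left, which leaves a difference operator with
    polynomial coefficients. *)
Lemma span_comb u v : span u v -> exists d R W, d != 0 /\ smul d v = comb R W u.
Proof.
elim=> [|v1 v2 _ [d1 [R1 [W1 [d10 H1]]]] _ [d2 [R2 [W2 [d20 H2]]]]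
        |p v1 _ [d [R [W [d0 H]]]]|m v1 _ [d [R [W [d0 H]]]]|d v1 d0 _ [d' [R [W [d'0 H]]]]].
- exists 1, 0%N, (fun=> 1); split; first exact: oner_neq0.
  by apply/funext => i; rewrite /comb big_ord1 /smul !mul1r sh0.
- have [W1' H1'] := comb_widen W1 u (leq_maxl R1 R2).
  have [W2' H2'] := comb_widen W2 u (leq_maxr R1 R2).
  exists (d1 * d2), (maxn R1 R2), (fun j => d2 * W1' j + d1 * W2' j); split.
    by rewrite mulf_neq0.
  apply/funext => i.
  have E1 := congr1 (fun f => f i) (etrans H1 H1').
  have E2 := congr1 (fun f => f i) (etrans H2 H2').
  rewrite /smul /sadd /comb in E1 E2 *; rewrite mulrDr.
  transitivity (d2 * (d1 * v1 i) + d1 * (d2 * v2 i)); first by ring.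
  rewrite E1 E2 !mulr_sumr -big_split; apply: eq_bigr => j _.
  by rewrite mulrDl !mulrA.
- exists d, R, (fun j => p * W j); split=> //.
  apply/funext => i; have E := congr1 (fun f => f i) H.
  rewrite /smul /comb in E *; rewrite mulrCA E mulr_sumr.
  by apply: eq_bigr => j _; rewrite mulrA.
(* The window grows by [k] = |m| on either side, the coefficients move up by k + m >= 0 places, and
   the places that are not filled carry 0. *)
- pose k := absz m; exists (sh m d), (R + k)%N,
    (fun j => if (k%:Z + m <= j%:Z) && (j%:Z - k%:Z - m < R.*2.+1%:Z)
              then sh m (W (absz (j%:Z - k%:Z - m)%R)) else 0); split; first by rewrite sh_eq0.
  apply/funext => i; have E := congr1 (fun f => f i) H.
  rewrite /smul /comb /shs in E *; rewrite -shM E sh_sum.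
  pose G (x : int) := if (0 <= x) && (x < R.*2.+1%:Z) then
    sh m (W (absz x) * sh (x - R%:Z) (u i)) else 0.
  transitivity (\sum_(j < R.*2.+1) G j%:Z).
    by apply: eq_bigr => j _; rewrite /G ifT //; have := ltn_ord j; lia.
  pose t := absz (k%:Z + m)%R.
  have tE : t%:Z = k%:Z + m by rewrite /t /k; lia.
  have le_t : (t + R.*2.+1 <= (R + k).*2.+1)%N by rewrite -lez_nat !PoszD tE; rewrite /k; lia.
  transitivity (\sum_(j < (R + k).*2.+1) G (j%:Z - t%:Z)).
    rewrite -(big_mkord xpredT (fun j => G (j%:Z - t%:Z))).
    rewrite (@big_cat_nat _ _ _ t) //; last by lia.
    rewrite [X in _ = X + _]big1_seq ?add0r; last first.
      by move=> j /andP[_]; rewrite mem_index_iota => /andP[_ h]; rewrite /G ifF //; lia.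
    rewrite (@big_cat_nat _ _ _ (t + R.*2.+1)) //; last by lia.
    rewrite [X in _ = _ + X]big1_seq ?addr0; last first.
      by move=> j /andP[_]; rewrite mem_index_iota => /andP[h _]; rewrite /G ifF //; lia.
    rewrite -[X in index_iota X _]add0n big_addn addKn big_mkord; apply: eq_bigr => j _.
    by congr G; lia.
  apply: eq_bigr => j _; rewrite /G tE.
  have -> : (0 <= j%:Z - (k%:Z + m)) = (k%:Z + m <= j%:Z) by lia.
  have -> : j%:Z - (k%:Z + m) = j%:Z - k%:Z - m by lia.
  case: ifP => _; last by rewrite mul0r.
  by rewrite shM sh_sh; congr (_ * sh _ _); lia.
- exists (d' * d), R, W; split; first by rewrite mulf_neq0.
  by rewrite -smulM.
Qed.

End PolynomialCoefficients.

(** * Differential operators acting on the hypergeometric series *)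

Section Base.
Variables (K : numFieldType) (a b s : K).
Hypothesis a_generic : forall t : nat, a + 1 + t%:R != 0.
Hypothesis sE : s = a + b + 1.

(** Here N is the indeterminate 'X. The factors (t - N) (t + N + s) are written as t (t + s) - N (N
    + s), which depends on N only through an invariant. *)
Definition fser (i : int) : {poly K} :=
  if i is Posz n then
    \prod_(t < n) (((a + 1 + t%:R) * t.+1%:R)^-1 *:
       ((t%:R * (t%:R + s))%:P - 'X * ('X + s%:P)))
  else 0.

Arguments fser : simpl never.

Lemma fser_horner i N : (fser i).[N] = hcoef a s N i.
Proof.
case: i => [n|n]; rewrite /fser; last by rewrite horner0.
by rewrite horner_prod; apply: eq_bigr => t _; rewrite !hornerE mulrC.
Qed.

Lemma fser0 : fser 0 = 1. Proof. exact: big_ord0. Qed.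

Lemma refls_fser : refls s fser = fser.
Proof.
apply/funext => i; apply: poly_eq => N; rewrite refl_horner !fser_horner.
case: i => //= n; apply: eq_bigr => t _; congr (_ / _); ring.
Qed.

(** [ypol] is odd and [lam] even under the reflection, and K[N] is the direct sum of K[lam] and ypol
    K[lam]. *)
Definition ypol : {poly K} := 2 *: 'X + s%:P.
Definition lam : {poly K} := 'X * ('X + s%:P).

Lemma refl_ypol : refl s ypol = - ypol.
Proof. by apply: poly_eq => N; rewrite refl_horner /ypol /lam !hornerE /=; ring. Qed.

Lemma ypol_sqr : ypol ^+ 2 = 4 *: lam + (s ^+ 2)%:P.
Proof. by apply: poly_eq => N; rewrite /ypol /lam !hornerE /=; ring. Qed.

Definition theta_op (w : wop K) := WP 'X (WD w).

Lemma act_theta (E : lmodType K) w (u : int -> E) i :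
  act (theta_op w) u i = i%:~R *: act w u i.
Proof. by rewrite /= pmulX /sder subrK. Qed.

(** With θ = x d/dx this is θ^2 + s θ - (d/dx) (θ + a): the hypergeometric equation says that F is
    an eigenfunction with eigenvalue [lam]. *)
Definition B0 : wop K :=
  WA (theta_op (theta_op WI)) (WA (WP s%:P (theta_op WI))
   (WA (WP (-1)%:P (WD (theta_op WI))) (WP (- a)%:P (WD WI)))).

Lemma act_B0 : act B0 fser = smul lam fser.
Proof.
apply/funext => i.
change (act (theta_op (theta_op WI)) fser i + (pmul s%:P (act (theta_op WI) fser) i +
  (pmul (-1)%:P (sder (act (theta_op WI) fser)) i + pmul (- a)%:P (sder fser) i))
  = smul lam fser i).
rewrite !pmulC /sder !act_theta.
apply: poly_eq => N; rewrite /smul /lam !hornerE /= !fser_horner.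
have := @hcoefS _ a s N i; rewrite intrD => /(_ (fun n _ => a_generic n)) H.
apply/subr0_eq; move: H => /eqP; rewrite -subr_eq0 => /eqP H.
transitivity (- ((i%:~R + 1%:~R) * (a + 1 + i%:~R) * hcoef a s N (i + 1) -
     (i%:~R * (i%:~R + s) - N * (N + s)) * hcoef a s N i)); last by rewrite H oppr0.
ring.
Qed.

Definition inD (u : int -> {poly K}) := exists w, u = act w fser.

Lemma inD_add u v : inD u -> inD v -> inD (sadd u v).
Proof. by move=> [w1 ->] [w2 ->]; exists (WA w1 w2). Qed.

Lemma inD_act w u : inD u -> inD (act w u).
Proof. by move=> [w' ->]; exists (wcomp w w'); rewrite act_comp. Qed.

Lemma inD_const (c : K) u : inD u -> inD (smul c%:P u).
Proof.
move=> H; have := inD_act (WP c%:P WI) H; congr inD.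
by apply/funext => i; rewrite /= pmulC /smul mul_polyC.
Qed.

Lemma inD_lam u : inD u -> inD (smul lam u).
Proof.
by move=> [w ->]; exists (wcomp w B0); rewrite act_comp act_B0 act_smul.
Qed.

Lemma inD_y2 u : inD u -> inD (smul (ypol ^+ 2) u).
Proof.
move=> H; rewrite ypol_sqr smulDl -mul_polyC -smulM.
by apply: inD_add; apply: inD_const => //; apply: inD_lam.
Qed.

Lemma inD_fser : inD fser. Proof. by exists WI. Qed.

Lemma inD_refls u : inD u -> refls s u = u.
Proof. by move=> [w ->]; rewrite -act_refls refls_fser. Qed.

(** Since multiplication by [lam] acts on F as an operator in x, this set is closed under
    multiplication by all polynomials in N, not only by the invariant ones. *)
Definition inDy (u : int -> {poly K}) :=
  exists v v', [/\ inD v, inD v' & u = sadd v (smul ypol v')].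

Lemma inD0 : inD (fun=> 0).
Proof. by exists (WP 0 WI); rewrite /= pmul0. Qed.

Lemma inDy_inD u : inD u -> inDy u.
Proof.
move=> H; exists u, (fun=> 0); split=> //; first exact: inD0.
by apply/funext => i; rewrite /sadd /smul mulr0 addr0.
Qed.

Lemma inDy_add u v : inDy u -> inDy v -> inDy (sadd u v).
Proof.
move=> [u1 [u2 [H1 H2 ->]]] [v1 [v2 [H3 H4 ->]]].
exists (sadd u1 v1), (sadd u2 v2); split; [exact: inD_add|exact: inD_add|].
by apply/funext => i; rewrite /sadd /smul mulrDr addrACA.
Qed.

Lemma inDy_act w u : inDy u -> inDy (act w u).
Proof.
move=> [u1 [u2 [H1 H2 ->]]]; exists (act w u1), (act w u2).
by split; [exact: inD_act|exact: inD_act|rewrite act_add act_smul].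
Qed.

Lemma inDy_const (c : K) u : inDy u -> inDy (smul c%:P u).
Proof.
move=> [u1 [u2 [H1 H2 ->]]]; exists (smul c%:P u1), (smul c%:P u2).
split; [exact: inD_const|exact: inD_const|].
by rewrite smulDr !smulM mulrC.
Qed.

Lemma inDy_y u : inDy u -> inDy (smul ypol u).
Proof.
move=> [u1 [u2 [H1 H2 ->]]]; exists (smul (ypol ^+ 2) u2), u1.
split; [exact: inD_y2|by []|].
by apply/funext => i; rewrite /sadd /smul; ring.
Qed.

Lemma inDy_smul p u : inDy u -> inDy (smul p u).
Proof.
elim/poly_ind: p u => [|p c IH] u H.
  by have := inDy_const 0 H; rewrite polyC0.
rewrite smulDl -smulM; apply: inDy_add; last exact: inDy_const.
apply: IH; have -> : 'X = (2^-1)%:P * (ypol + (- s)%:P).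
  by apply: poly_eq => N; rewrite /ypol !hornerE /=; field.
rewrite -smulM; apply: inDy_const; rewrite smulDl; apply: inDy_add.
  exact: inDy_y.
exact: inDy_const.
Qed.

(** [ypol] changes sign under the reflection, so the invariance of v + ypol v' forces ypol v' =
    0. *)
Lemma inDy_refls u : inDy u -> refls s u = u -> inD u.
Proof.
move=> [u1 [u2 [H1 H2 ->]]].
rewrite refls_sadd refls_smul refl_ypol !inD_refls // => H.
suff -> : sadd u1 (smul ypol u2) = u1 by [].
apply/funext => i; have := congr1 (fun f => f i) H; rewrite /sadd /smul => /addrI E.
have E2 : ypol * u2 i = 0.
  apply/eqP; have : 2 *: (ypol * u2 i) == 0.
    by rewrite scaler_nat mulr2n -{1}E mulNr addNr.
  by rewrite scaler_eq0 pnatr_eq0.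
by rewrite E2 addr0.
Qed.

Definition inQ u := exists2 d, d != 0 & inDy (smul d u).

Lemma inQ_inDy u : inDy u -> inQ u.
Proof. by move=> H; exists 1; rewrite ?oner_neq0 // smul1. Qed.

Lemma inQ_add u v : inQ u -> inQ v -> inQ (sadd u v).
Proof.
move=> [d d0 H] [d' d'0 H']; exists (d * d'); first by rewrite mulf_neq0.
rewrite smulDr; apply: inDy_add; first by rewrite mulrC -smulM; apply: inDy_smul.
by rewrite -smulM; apply: inDy_smul.
Qed.

Lemma inQ_smul p u : inQ u -> inQ (smul p u).
Proof.
move=> [d d0 H]; exists d => //; rewrite smulM mulrC -smulM; exact: inDy_smul.
Qed.

Lemma inQ_act w u : inQ u -> inQ (act w u).
Proof. by move=> [d d0 H]; exists d => //; rewrite -act_smul; exact: inDy_act. Qed.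

Lemma inQ_div d u : d != 0 -> inQ (smul d u) -> inQ u.
Proof.
by move=> d0 [d' d'0 H]; exists (d' * d); rewrite ?mulf_neq0 // -smulM.
Qed.

Let upp : {poly K} := (ypol - 1) * (2 *: (('X + (a + 1)%:P) * ('X + s%:P))).
Let dnp : {poly K} := (ypol + 1) * (2 *: ('X * ('X + b%:P))).

Lemma Xpc_neq0 (c : K) : 'X + c%:P != 0.
Proof. by rewrite -[c]opprK polyCN polyXsubC_eq0. Qed.

Lemma polyCN1 : (-1)%:P = -1 :> {poly K}.
Proof. by rewrite polyCN polyC1. Qed.

Lemma ypolc_neq0 (c : K) : ypol + c%:P != 0.
Proof.
have -> : ypol + c%:P = 2 *: ('X + ((s + c) / 2)%:P).
  by apply: poly_eq => N; rewrite /ypol !hornerE /=; field.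
by rewrite scaler_eq0 pnatr_eq0 /=; apply: Xpc_neq0.
Qed.

Lemma ypol_neq0 : ypol != 0.
Proof. by rewrite -[ypol]addr0; apply: (ypolc_neq0 0). Qed.

(** [M1] is multiplication by z = 1 - 2x and [M2] is 4 θ + 2a + 1 - 2x (2 θ + s): the operators that
    occur in the two relations of [hcoef_shift]. *)
Let M1 : wop K := WP (1 - 2 *: 'X) WI.
Let M2 : wop K := WA (WA (WP 4%:P (theta_op WI)) (WP (2 * a + 1)%:P WI))
   (WP (- 2 *: 'X) (WA (WP 2%:P (theta_op WI)) (WP s%:P WI))).

Lemma fser_shift i :
  let R1 := (ypol ^+ 2 - 1) * act M1 fser i - (b ^+ 2 - a ^+ 2)%:P * fser i in
  let R2 := (ypol ^+ 2 - 1) * act M2 fser i + (b ^+ 2 - a ^+ 2)%:P * fser i in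
  upp * sh 1 (fser i) + dnp * sh (-1) (fser i) = ypol * R1 /\
  upp * sh 1 (fser i) - dnp * sh (-1) (fser i) = R2.
Proof.
have E1 : act M1 fser i = fser i - 2 *: fser (i - 1).
  rewrite /= pmulDl /sadd pmul1 -scaleNr pmulZ pmulX; congr (_ + _).
  by rewrite scaleNr.
have E2 : act M2 fser i = (4 * i%:~R + 2 * a + 1) *: fser i
    - (2 * (2 * i%:~R + s - 2)) *: fser (i - 1).
  change (pmul 4%:P (act (theta_op WI) fser) i + pmul (2 * a + 1)%:P fser i +
    pmul (- 2 *: 'X) (sadd (pmul 2%:P (act (theta_op WI) fser)) (pmul s%:P fser)) i = 
    (4 * i%:~R + 2 * a + 1) *: fser i - (2 * (2 * i%:~R + s - 2)) *: fser (i - 1)).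
  rewrite pmulZ pmulX !pmulC /sadd !act_theta /= intrB; apply: poly_eq => N; rewrite !hornerE /=; ring.
move=> R1 R2; rewrite /R1 /R2 E1 E2.
case: i {E1 E2 R1 R2} => [n|n].
  split; apply: poly_eq => N;
  have [H1 H2] := @hcoef_shift K a b N n (fun t _ => a_generic t);
  rewrite /upp /dnp /ypol !hornerE /= !sh_horner !fser_horner sE rmorphN1 rmorph1.
    etransitivity; [|etransitivity; [exact: H1|]]; ring.
  etransitivity; [|etransitivity; [exact: H2|]]; rewrite -?pmulrn; ring.
have -> : fser (Negz n - 1) = 0.
  by rewrite (_ : Negz n - 1 = Negz n.+1) //; lia.
by rewrite /sh !comp_poly0; split; ring.
Qed.

(** Half the sum and half the difference of the two relations isolate F(N + 1) and F(N - 1). Their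
    right-hand sides are in D F and in ypol D F, because y^2 and constants preserve D F. *)
Lemma inQ_fser_shift : inQ (shs 1 fser) /\ inQ (shs (-1) fser).
Proof.
pose R1 := sadd (smul (ypol ^+ 2 - 1) (act M1 fser)) (smul (- (b ^+ 2 - a ^+ 2))%:P fser).
pose R2 := sadd (smul (ypol ^+ 2 - 1) (act M2 fser)) (smul (b ^+ 2 - a ^+ 2)%:P fser).
have D0 := inD_fser.
have H1 : inD R1.
  apply: inD_add; last exact: inD_const.
  rewrite -polyCN1 smulDl; apply: inD_add; last by apply: inD_const; apply: inD_act.
  by apply: inD_y2; apply: inD_act.
have H2 : inD R2.
  apply: inD_add; last exact: inD_const.
  rewrite -polyCN1 smulDl; apply: inD_add; last by apply: inD_const; apply: inD_act.
  by apply: inD_y2; apply: inD_act.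
have up0 : upp != 0.
  rewrite mulf_neq0 //; first by rewrite -polyCN1; apply: ypolc_neq0.
  by rewrite scaler_eq0 pnatr_eq0 /= mulf_neq0 ?Xpc_neq0.
have dn0 : dnp != 0.
  rewrite mulf_neq0 //; first by rewrite -polyC1; apply: ypolc_neq0.
  by rewrite scaler_eq0 pnatr_eq0 /= mulf_neq0 ?Xpc_neq0 ?polyX_eq0.
split.
  apply: (inQ_div up0); apply: inQ_inDy.
  suff -> : smul upp (shs 1 fser) = smul (2^-1)%:P (sadd R2 (smul ypol R1)).
    by apply: inDy_const; exists R2, R1.
  apply/funext => i; have [A1 A2] := fser_shift i.
  have : 2%:P * (upp * sh 1 (fser i)) = R2 i + ypol * R1 i.
    rewrite /R1 /R2 /sadd /smul [(- (b ^+ 2 - a ^+ 2))%:P]polyCN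
      [- (b ^+ 2 - a ^+ 2)%:P * _]mulNr -A1 -A2.
    by rewrite polyC_natr; ring.
  rewrite /smul /shs /sadd => <-; rewrite [RHS]mulrA -polyCM mulVf ?pnatr_eq0 //.
  by rewrite polyC1 mul1r.
apply: (inQ_div dn0); apply: inQ_inDy.
suff -> : smul dnp (shs (-1) fser) =
    smul (2^-1)%:P (sadd (smul (-1)%:P R2) (smul ypol R1)).
  by apply: inDy_const; exists (smul (-1)%:P R2), R1; split=> //; apply: inD_const.
apply/funext => i; have [A1 A2] := fser_shift i.
have : 2%:P * (dnp * sh (-1) (fser i)) = (-1)%:P * R2 i + ypol * R1 i.
  rewrite /R1 /R2 /sadd /smul [(- (b ^+ 2 - a ^+ 2))%:P]polyCN
      [- (b ^+ 2 - a ^+ 2)%:P * _]mulNr -A1 -A2.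
  by rewrite polyCN1 polyC_natr; ring.
rewrite /smul /shs /sadd => <-; rewrite [RHS]mulrA -polyCM mulVf ?pnatr_eq0 //.
by rewrite polyC1 mul1r.
Qed.

(** Operators in x commute with the shift of N, so it is enough to shift F itself, one step at a
    time. *)
Lemma inQ_shs m u : inQ u -> inQ (shs m u).
Proof.
have step e : inQ (shs e fser) -> forall u, inQ u -> inQ (shs e u).
  move=> He {}u [d d0 [_ [_ [[w1 ->] [w2 ->] E]]]].
  apply: (@inQ_div (sh e d)); first by rewrite sh_eq0.
  rewrite -shs_smul E shs_sadd shs_smul -!act_shs.
  by apply: inQ_add; [|apply: inQ_smul]; apply: inQ_act.
have [H1 H2] := inQ_fser_shift.
have pos (n : nat) v : inQ v -> inQ (shs n v).
  elim: n v => [|n IH] v Hv; first by rewrite shs0.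
  have -> : n.+1%:Z = n%:Z + 1 by lia.
  by rewrite -shs_shs; apply: IH; apply: step.
have neg (n : nat) v : inQ v -> inQ (shs (- n%:Z) v).
  elim: n v => [|n IH] v Hv; first by rewrite shs0.
  have -> : - n.+1%:Z = - n%:Z + (-1) by lia.
  by rewrite -shs_shs; apply: IH; apply: step.
by case: m => n Hu; [apply: pos|rewrite NegzE; apply: neg].
Qed.

Lemma inQ_span u : span fser u -> inQ u.
Proof.
elim=> [|v v' _ ? _ ?|p v _ ?|m v _ ?|d v d0 _ ?].
- exact/inQ_inDy/inDy_inD/inD_fser.
- exact: inQ_add.
- exact: inQ_smul.
- exact: inQ_shs.
- exact: (inQ_div d0).
Qed.

(** The denominator d is replaced by the invariant d * refl s d; the product with u is then
    invariant and has no component in ypol D F. *)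
Lemma inQ_refl u : inQ u -> refls s u = u ->
  exists e, [/\ e != 0, refl s e = e & inD (smul e u)].
Proof.
move=> [d d0 H] Hu; exists (d * refl s d); split.
- by rewrite mulf_neq0 ?refl_eq0.
- by rewrite reflM reflK mulrC.
- apply: inDy_refls; first by rewrite mulrC -smulM; apply: inDy_smul.
  by rewrite refls_smul Hu reflM reflK mulrC.
Qed.

(** One denominator for the whole window, again a product of terms d * refl s d, so that multiplying
    by it preserves invariance. *)
Lemma common_denominator R : exists Z, [/\ Z != 0, refl s Z = Z &
  forall j : nat, (j < R.*2.+1)%N -> inDy (smul Z (shs (j%:Z - R%:Z) fser))].
Proof.
elim: (R.*2.+1) => [|n [Z [Z0 Zr H]]].
  by exists 1; split=> //; rewrite ?oner_neq0 // /refl comp_polyC.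
have [d d0 Hd] : inQ (shs (n%:Z - R%:Z) fser).
  exact/inQ_shs/inQ_inDy/inDy_inD/inD_fser.
exists (Z * (d * refl s d)); split.
- by rewrite !mulf_neq0 ?refl_eq0.
- by rewrite !reflM reflK Zr [refl s d * d]mulrC.
- move=> j; rewrite ltnS leq_eqVlt => /orP[/eqP ->|jn].
    by rewrite [d * _]mulrC mulrA -smulM; apply: inDy_smul.
  by rewrite mulrC -smulM; apply: inDy_smul; apply: H.
Qed.

End Base.
Arguments fser : simpl never.

(** * Differential images of F are not annihilated by difference operators *)

Section Core.
Variables (K : numFieldType) (a s : K).
Hypothesis a_generic : forall t : nat, a + 1 + t%:R != 0.
Local Notation F := (fser a s).

Lemma eventually_horner_neq0 (p : {poly K}) (c : K) : p != 0 ->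
  exists B : nat, forall n : nat, (B <= n)%N -> p.[n%:R + c] != 0.
Proof.
move: {2}(size p) (leqnn (size p)) => k; elim: k p => [|k IH] p sp p0.
  by rewrite -size_poly_gt0 ltnNge sp in p0.
have [[n0 rt]|nex] := pselect (exists n0 : nat, p.[n0%:R + c] == 0); last first.
  by exists 0%N => n _; apply/negP => h; apply: nex; exists n.
have /factor_theorem[q pE] : root p (n0%:R + c) by [].
have q0 : q != 0 by apply: contraNneq p0 => q0; rewrite pE q0 mul0r.
have [|B HB] := IH q _ q0.
  move: sp; rewrite pE size_Mmonic ?monicXsubC // size_XsubC addn2 /=.
  by rewrite ltnS.
exists (maxn B n0.+1) => n; rewrite geq_max => /andP[h1 h2].
rewrite pE !hornerE mulf_neq0 ?HB //.
rewrite opprD addrACA subrr addr0 subr_eq0 eqr_nat.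
by rewrite gtn_eqF.
Qed.

Lemma eventually_shift_neq0 : exists B : nat, forall M t : nat, (B <= M)%N ->
  t%:R + M%:R + s != 0.
Proof.
have [[n0 /eqP h]|nex] := pselect (exists n0 : nat, n0%:R + s == 0); last first.
  by exists 0%N => M t _; apply/negP => h; apply: nex; exists (t + M)%N; rewrite natrD.
exists n0.+1 => M t hM; have -> : s = - n0%:R by rewrite -[s](addKr n0%:R) h addr0.
rewrite subr_eq0 -natrD eqr_nat; lia.
Qed.

Lemma fser_nat_eq0 (M : nat) (i : int) : M%:Z < i -> (F i).[M%:R] = 0.
Proof.
case: i => [n|n] h; rewrite fser_horner //.
have hn : (M < n)%N by lia.
by rewrite /hcoef (bigD1 (Ordinal hn)) //= subrr mul0r mul0r.
Qed.

(** At N = M the series F terminates. The coefficient of x^M can vanish only if t + M + s = 0 for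
    some t < M, which is impossible once M is large. *)
Lemma fser_nat_neq0 : exists B : nat, forall M : nat, (B <= M)%N -> (F M).[M%:R] != 0.
Proof.
have [B HB] := eventually_shift_neq0; exists B => M hM.
rewrite fser_horner /hcoef; apply/prodf_neq0 => t _.
rewrite mulf_neq0 ?invr_eq0 ?mulf_neq0 ?pnatr_eq0 //.
rewrite (_ : _ - _ = (t%:R - M%:R) * (t%:R + M%:R + s)); last by ring.
rewrite mulf_neq0 ?HB // subr_eq0 eqr_nat.
by rewrite neq_ltn ltn_ord.
Qed.

Lemma fser_neg (i : int) : i < 0 -> F i = 0.
Proof. by case: i. Qed.

(** On coefficients an operator in x acts by shifts of the index i and by polynomials in i, which do
    not involve N. This form makes the degree in x visible when N is a natural number. *)
Definition expands (u : int -> {poly K}) := exists l : seq ({poly K} * int),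
  forall i, u i = \sum_(x <- l) x.1.[i%:~R] *: F (i + x.2).

Lemma expands_add u v : expands u -> expands v -> expands (sadd u v).
Proof.
by move=> [l Hl] [l' Hl']; exists (l ++ l') => i; rewrite big_cat /sadd Hl Hl'.
Qed.

Lemma expands_shift c u : expands u -> expands (fun i => u (i + c)).
Proof.
move=> [l Hl]; exists [seq (sh c x.1, c + x.2) | x <- l] => i.
rewrite Hl big_map; apply: eq_bigr => x _ /=.
by rewrite sh_horner intrD addrA.
Qed.

Lemma expands_mul p u : expands u -> expands (fun i => p.[i%:~R] *: u i).
Proof.
move=> [l Hl]; exists [seq (p * x.1, x.2) | x <- l] => i.
rewrite Hl big_map scaler_sumr; apply: eq_bigr => x _ /=.
by rewrite hornerM scalerA.
Qed.

Lemma expands_ext u v : u =1 v -> expands u -> expands v.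
Proof. by move=> /funext ->. Qed.

Lemma expands_act w : expands (act w F).
Proof.
elim: w => [|P w IH|w IH|w1 IH1 w2 IH2] /=; last exact: expands_add.
- by exists [:: (1, 0)] => i; rewrite big_seq1 hornerC scale1r addr0.
- elim/poly_ind: P => [|P c IHP].
    by rewrite pmul0; exists [::] => i; rewrite big_nil.
  rewrite pmulDl; apply: expands_add; first by rewrite pmulMX; apply: (expands_shift (-1) IHP).
  by rewrite pmulC; apply: expands_ext (expands_mul c%:P IH) => i; rewrite hornerC.
- apply: expands_ext (expands_shift 1 (expands_mul 'X IH)) => i.
  by rewrite hornerX.
Qed.

Lemma expands_normal u : expands u -> exists o n (q : nat -> {poly K}),
  forall i, u i = \sum_(c < n) (q c).[i%:~R] *: F (i + o + c%:Z).
Proof.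
move=> [l Hl].
have [B HB] : exists B : nat, forall x, x \in l -> - B%:Z <= x.2 <= B%:Z.
  elim: l {Hl} => [|[p k] l [B HB]]; first by exists 0%N.
  exists (B + absz k)%N => -[p' k']; rewrite inE => /orP[/eqP[_ ->]|/HB] /=; lia.
exists (- B%:Z), (B.*2.+1), (fun c => \sum_(x <- l | x.2 == c%:Z - B%:Z) x.1) => i.
rewrite Hl.
under [RHS]eq_bigr => c _ do rewrite horner_sum scaler_suml big_mkcond.
rewrite exchange_big /= big_seq [RHS]big_seq; apply: eq_bigr => -[p k] /HB /= hx.
have hlt : (absz (k + B%:Z)%R < B.*2.+1)%N by lia.
rewrite (bigD1 (Ordinal hlt)) //= ifT; last by lia.
rewrite big1 ?addr0; last first.
  move=> c /eqP/val_eqP /= hc; rewrite ifF //; apply/negP => /eqP h.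
  by move: hc; rewrite h; lia.
by congr (_ *: F _); lia.
Qed.

(** A degree count. At a large natural number N = M, F is a polynomial in x of degree M, and an
    operator in x lowers this degree by a fixed integer k + c0, where c0 is the first index with
    q_c0 != 0. So the degree of v in x grows strictly with M, and the highest shift in W contributes
    a leading term that the other shifts cannot cancel. *)
Lemma annihilated_eq0 e v R W : e != 0 -> inD a s (smul e v) ->
  (exists2 j, (j < R.*2.+1)%N & W j != 0) -> comb R W v = (fun=> 0) ->
  v = (fun=> 0).
Proof.
move=> e0 [w Hw] [j0 j0R Wj0] H0.
have [k [n [q Hq]]] := expands_normal (expands_act w).
have [nz|az] := pselect (exists c, (c < n)%N && (q c != 0)); last first.
  apply: (smulI e0); rewrite Hw; apply/funext => i; rewrite Hq /smul mulr0.
  apply: big1 => c _; have -> : q c = 0; last by rewrite horner0 scale0r.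
  by apply/eqP/negPn/negP => h; apply: az; exists c; rewrite ltn_ord.
exfalso; have [c0 /andP[c0n qc0] c0min] := ex_minnP nz.
have exj : exists j, (j < R.*2.+1)%N && (W j != 0) by exists j0; rewrite j0R.
have bdW j : (j < R.*2.+1)%N && (W j != 0) -> (j <= R.*2)%N by case/andP.
have [jm /andP[jmR Wjm] jmmax] := ex_maxnP exj bdW.
have [B1 HB1] := eventually_horner_neq0 (- (k + c0%:Z)%:~R) qc0.
have [B2 HB2] := eventually_horner_neq0 0 e0.
have [B3 HB3] := eventually_horner_neq0 (R%:R - jm%:R) Wjm.
have [B4 HB4] := fser_nat_neq0.
(* Large enough for the four values involved (of q_c0, of e, of the top coefficient of W and of the
   coefficient of x^M in F) to be non-zero, with 2R + 1 to spare for the shifts to the left of M. *)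
pose M := (B1 + B2 + B3 + B4 + R.*2.+1)%N.
pose idx := M%:Z - (k + c0%:Z).
have val (M' : nat) : (M' <= M)%N -> e.[M'%:R] * (v idx).[M'%:R] =
    if M' == M then (q c0).[idx%:~R] * (F M).[M%:R] else 0.
  move=> hM'; rewrite -hornerM -[e * _]/(smul e v idx) Hw Hq horner_sum.
  rewrite (bigD1 (Ordinal c0n)) //= big1 ?addr0 => [|c /eqP/val_eqP /= hc].
    have -> : idx + k + c0%:Z = M by rewrite /idx; lia.
    rewrite hornerZ; case: eqP => [->//|hne].
    by rewrite fser_nat_eq0 ?mulr0 //; lia.
  have [lt|ge] := ltnP c c0.
    suff -> : q c = 0 by rewrite horner0 scale0r horner0.
    apply/eqP/negPn/negP => h; have := c0min c; rewrite h ltn_ord => /(_ isT); lia.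
  rewrite hornerZ fser_nat_eq0 ?mulr0 //; rewrite /idx; lia.
have v0 (M' : nat) : (B2 <= M')%N -> (M' < M)%N -> (v idx).[M'%:R] = 0.
  move=> h1 h2; have := val M' (ltnW h2); rewrite ltn_eqF // => /eqP.
  by rewrite mulf_eq0 => /orP[|/eqP//]; rewrite -[M'%:R]addr0 (negbTE (HB2 _ h1)).
have vM : (v idx).[M%:R] != 0.
  have := val M (leqnn _); rewrite eqxx => E.
  apply/negP => /eqP h; move: E; rewrite h mulr0 => /esym/eqP; apply/negP.
  rewrite mulf_neq0 ?HB4 //; last by rewrite /M; lia.
  by rewrite /idx intrB -pmulrn; apply: HB1; rewrite /M; lia.
(* At this point the shift by jm - R lands on M, and the lower shifts land below M, where [v idx]
   vanishes. *)
have := congr1 (fun f => (f idx).[M%:R + R%:R - jm%:R]) H0.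
rewrite horner0 /comb horner_sum.
have jmR' : (jm < R.*2.+1)%N by [].
rewrite (bigD1 (Ordinal jmR')) //= big1 ?addr0 => [|j /eqP/val_eqP /= hj].
  rewrite hornerM sh_horner => /eqP; apply/negP; rewrite mulf_neq0 //.
    by rewrite -addrA; apply: HB3; rewrite /M; lia.
  have -> : M%:R + R%:R - jm%:R + (jm%:Z - R%:Z)%:~R = M%:R :> K.
    by rewrite intrB -!pmulrn; ring.
  exact: vM.
have [lt|ge] := ltnP jm j.
  suff -> : W j = 0 by rewrite mul0r horner0.
  apply/eqP/negPn/negP => h; have := jmmax j; rewrite h ltn_ord => /(_ isT); lia.
have lt : (j < jm)%N by lia.
rewrite hornerM sh_horner.
have -> : M%:R + R%:R - jm%:R + (j%:Z - R%:Z)%:~R = (M - (jm - j))%N%:R :> K.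
  have h2 : (jm - j <= M)%N by rewrite /M; lia.
  by rewrite intrB -!pmulrn (natrB _ h2) (natrB _ (ltnW lt)); ring.
by rewrite v0 ?mulr0 //; rewrite /M; lia.
Qed.

End Core.

(** * The bispectral theorem for invariant series *)

Section CoreTheorem.
Variables (K : numFieldType) (a b s : K).
Hypothesis a_generic : forall t : nat, a + 1 + t%:R != 0.
Hypothesis sE : s = a + b + 1.
Local Notation F := (fser a s).
Implicit Types (u v : int -> {poly K}) (W : nat -> {poly K}).

Lemma pmul_lowest (E : lmodType K) (f : {poly K}) (u : int -> E) (i0 : int) (a0 : nat) :
  (forall i, i < i0 -> u i = 0) -> (forall c : nat, (c < a0)%N -> f`_c = 0) ->
  pmul f u (i0 + a0%:Z) = f`_a0 *: u i0.
Proof.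
move=> Hu Hf; rewrite (@pmul_widen _ _ (size f + a0.+1)) ?leq_addr //.
have h : (a0 < size f + a0.+1)%N by rewrite addnS ltnS leq_addl.
rewrite (bigD1 (Ordinal h)) //= addrK big1 ?addr0 // => c /eqP/val_eqP /= hc.
have [lt|ge] := ltnP c a0; first by rewrite Hf // scale0r.
by rewrite Hu ?scaler0 //; lia.
Qed.

Lemma lowest_coef (f : {poly K}) : f != 0 ->
  exists2 a0 : nat, f`_a0 != 0 & forall c : nat, (c < a0)%N -> f`_c = 0.
Proof.
move=> f0; have ex : exists c, f`_c != 0.
  by exists (size f).-1; rewrite -lead_coefE lead_coef_eq0.
have [a0 h hmin] := ex_minnP ex; exists a0 => // c lt.
by apply/eqP/negPn/negP => /hmin; rewrite leqNgt lt.
Qed.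

Lemma comb_act w R W u : comb R W (act w u) = act w (comb R W u).
Proof.
rewrite /comb; have E n : act w (fun i => \sum_(j < n) W j * sh (j%:Z - R%:Z) (u i)) =
    fun i => \sum_(j < n) W j * sh (j%:Z - R%:Z) (act w u i).
  elim: n => [|n IH].
    have -> : (fun i => \sum_(j < 0) W j * sh (j%:Z - R%:Z) (u i)) = smul 0 u.
      by apply/funext => i; rewrite big_ord0 /smul mul0r.
    by rewrite act_smul; apply/funext => i; rewrite big_ord0 /smul mul0r.
  have -> : (fun i => \sum_(j < n.+1) W j * sh (j%:Z - R%:Z) (u i)) =
      sadd (fun i => \sum_(j < n) W j * sh (j%:Z - R%:Z) (u i))
           (smul (W n) (shs (n%:Z - R%:Z) u)).
    by apply/funext => i; rewrite big_ord_recr.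
  by rewrite act_add IH act_smul act_shs; apply/funext => i; rewrite big_ord_recr.
by rewrite E.
Qed.

Lemma comb_add R W u v : comb R W (sadd u v) = sadd (comb R W u) (comb R W v).
Proof.
apply/funext => i; rewrite /comb /sadd -big_split; apply: eq_bigr => j _.
by rewrite shD mulrDr.
Qed.

Lemma refls_comb R W u : refls s u = u ->
  refls s (comb R W u) = comb R (fun j => refl s (W (R.*2 - j)%N)) u.
Proof.
move=> Hu; apply/funext => i; rewrite /refls /comb refl_sum.
rewrite (reindex_inj rev_ord_inj) /=; apply: eq_bigr => j _.
have hj := ltn_ord j.
rewrite subSS reflM refl_sh; congr (_ * sh _ _); first by lia.
exact: (congr1 (fun f => f i) Hu).
Qed.

Lemma eq_comb R W W' u : (forall j, (j < R.*2.+1)%N -> W j = W' j) ->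
  comb R W u = comb R W' u.
Proof. by move=> H; apply/funext => i; apply: eq_bigr => j _; rewrite H. Qed.

Lemma inDy_sum n (c : nat -> int -> {poly K}) :
  (forall j : nat, (j < n)%N -> inDy a s (c j)) -> inDy a s (fun i => \sum_(j < n) c j i).
Proof.
elim: n => [|n IH] H.
  have := inDy_inD (@inD0 K a s); congr inDy; apply/funext => i; by rewrite big_ord0.
have -> : (fun i => \sum_(j < n.+1) c j i) = sadd (fun i => \sum_(j < n) c j i) (c n).
  by apply/funext => i; rewrite big_ord_recr.
by apply: inDy_add; [apply: IH => j hj; apply: H; apply: ltnW|apply: H].
Qed.

(* S carries F to u up to a factor e(N). Dividing f(x) F = W u by suitable
   symmetric polynomials in N gives a difference operator that acts on F as a
   differential operator A, and A undoes S: the discrepancy lies in D F and is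
   annihilated by W, hence zero. *)
Theorem bispectral_core u f : f != 0 -> refls s u = u -> span F u ->
  span u (pmul f F) ->
  exists w M (theta : {poly K}), (1 < size theta)%N /\ act w u = smul theta (pmul (f ^+ M) u).
Proof.
move=> f0 Hu Fu uF; pose fF := pmul f F.
have [d [R [W [d0 HW]]]] := span_comb uF.
have rF : refls s F = F := refls_fser a s.
have rfF : refls s fF = fF by rewrite /fF -[pmul f F]/(act (WP f WI) F) -act_refls rF.
(* The relation d f F = W u and its reflection are added after cross-multiplication; u and f F are
   invariant, so only the coefficients change. The factor becomes D = 2 d (refl d). *)
pose W' (j : nat) := refl s d * W j + d * refl s (W (R.*2 - j)%N).
pose D := 2 *: (d * refl s d).
have D0 : D != 0 by rewrite scaler_eq0 pnatr_eq0 /= mulf_neq0 ?refl_eq0.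
have rD : refl s D = D by rewrite /D reflZ reflM reflK mulrC.
have HW' : comb R W' u = smul D fF.
  have E1 i : d * fF i = comb R W u i := congr1 (fun f => f i) HW.
  have E2 i : refl s d * fF i = comb R (fun j => refl s (W (R.*2 - j)%N)) u i.
    have := congr1 (fun f => refls s f i) HW.
    by rewrite refls_smul rfF refls_comb.
  apply/funext => i; rewrite /smul /D scaler_nat mulr2n mulrDl.
  rewrite -{1}mulrA [d * _]mulrC -mulrA {1}[_ * fF i]mulrC -[RHS]addrC.
  transitivity (refl s d * (d * fF i) + d * (refl s d * fF i)); last by ring.
  rewrite E1 E2 /comb !mulr_sumr -big_split; apply: eq_bigr => j _ /=.
  by rewrite /W'; ring.
have symW' j : (j < R.*2.+1)%N -> refl s (W' (R.*2 - j)%N) = W' j.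
  by move=> hj; rewrite /W' reflD !reflM !reflK subKn // addrC.
have [e [e0 re eS]] := inQ_refl a_generic (inQ_span a_generic sE Fu) Hu.
have [Z [Z0 rZ HZ]] := common_denominator a_generic sE R.
pose y := ypol s.
(* The even factor y^2 plants the root N = -s/2 in [G], hence in θ = G e; this makes θ
   non-constant. *)
pose DZ := D * (Z * y ^+ 2).
have y0 : y != 0 by exact: ypol_neq0.
have DZ0 : DZ != 0 by rewrite !mulf_neq0 ?expf_neq0.
have rDZ : refl s DZ = DZ by rewrite /DZ !reflM rD rZ refl_ypol mulrNN.
(* The product runs over the whole window, so each shift of G by j - R is still divisible by D Z:
   the factor of index 2R - j is brought to shift 0. *)
pose G := \prod_(c < R.*2.+1) sh (c%:Z - R%:Z) DZ.
have G0 : G != 0 by apply/prodf_neq0 => c _; rewrite sh_eq0.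
have rG : refl s G = G.
  rewrite /G refl_prod (reindex_inj rev_ord_inj); apply: eq_bigr => c _ /=.
  have hc := ltn_ord c.
  by rewrite refl_sh rDZ; congr sh; lia.
have shG (j : nat) : (j < R.*2.+1)%N -> exists g, sh (j%:Z - R%:Z) G = D * Z * g.
  move=> hj; have hj' : (R.*2 - j < R.*2.+1)%N by lia.
  rewrite /G sh_prod (bigD1 (Ordinal hj')) //= sh_sh.
  have -> : j%:Z - R%:Z + ((R.*2 - j)%N%:Z - R%:Z) = 0 by lia.
  by rewrite sh0 /DZ; eexists; rewrite -!mulrA; congr (_ * (_ * _)).
have {}[g Hg] : exists g : nat -> {poly K},
    forall j, (j < R.*2.+1)%N -> sh (j%:Z - R%:Z) G = D * Z * g j.
  have H j : exists g, (j < R.*2.+1)%N -> sh (j%:Z - R%:Z) G = D * Z * g.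
    have [/shG[g Hg]|_] := boolP (j < R.*2.+1)%N; first by exists g.
    by exists 0.
  by exists (fun j => sval (cid (H j))) => j; exact: (svalP (cid (H j))).
(* This is W' (G F) divided by D. It is invariant, and the factor Z puts it in D F + ypol D F, so it
   equals A F for a differential operator [A]. *)
pose Om i := \sum_(j < R.*2.+1) (W' j * g j) * (smul Z (shs (j%:Z - R%:Z) F) i).
have DOm : smul D Om = comb R W' (smul G F).
  apply/funext => i; rewrite /smul /Om /comb mulr_sumr; apply: eq_bigr => j _.
  by rewrite shM Hg // /smul /shs; ring.
have rOm : refls s Om = Om.
  apply: (smulI D0); rewrite -{1}rD -refls_smul DOm refls_comb; last first.
    by rewrite refls_smul rG rF.
  exact: eq_comb.
have [A HA] : inD a s Om.
  apply: inDy_refls rOm => //.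
  apply: (@inDy_sum _ (fun j => smul (W' j * g j) (smul Z (shs (j%:Z - R%:Z) F)))) => j hj.
  by apply: (inDy_smul a_generic); apply: HZ.
have [M [A' HA']] := act_conj_pmulX f A 1.
pose H := sadd (act A' u) (smul (- G) (pmul (f ^+ M) F)).
have He : inD a s (smul e H).
  rewrite /H smulDr; apply: inD_add; first by rewrite -act_smul; apply: inD_act.
  rewrite smulM -[pmul _ F]/(act (WP (f ^+ M) WI) F) -act_smul; apply: inD_act.
  apply: inDy_refls; first by apply: (inDy_smul a_generic); exact/inDy_inD/inD_fser.
  by rewrite refls_smul rF -scaleN1r !reflM reflZ re rG.
have cH : comb R W' H = (fun=> 0).
  rewrite /H comb_add comb_act HW' act_smul.
  have -> : smul (- G) (pmul (f ^+ M) F) = act (WP (- f ^+ M) WI) (smul G F).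
    rewrite act_smul /= -[- (f ^+ M)]scaleN1r pmulZ; apply/funext => i.
    by rewrite /smul scaleN1r mulNr mulrN.
  rewrite comb_act -DOm act_smul HA /fF -[f in pmul f F]expr1 HA' /=.
  rewrite -[- (f ^+ M)]scaleN1r pmulZ; apply/funext => i.
  by rewrite /sadd /smul scaleN1r mulrN subrr.
have exW : exists2 j, (j < R.*2.+1)%N & W' j != 0.
  apply: contrapT => nex.
  have : smul D fF = (fun=> 0).
    rewrite -HW'; apply/funext => i; apply: big1 => j _.
    have -> : W' j = 0; last by rewrite mul0r.
    by apply/eqP/negPn/negP => h; apply: nex; exists j.
  have [a0 fa0 fmin] := lowest_coef f0.
  move/(congr1 (fun f => f (0 + a0%:Z))); rewrite /smul /fF.
  rewrite (pmul_lowest (i0 := 0) _ fmin) ?fser0 => [/eqP|i]; last exact: fser_neg.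
  by rewrite mulf_eq0 (negbTE D0) scaler_eq0 (negbTE fa0) oner_eq0.
have {cH} H0 : H = (fun=> 0) := annihilated_eq0 a_generic e0 He exW cH.
have Au : act A' u = smul G (pmul (f ^+ M) F).
  apply/funext => i; have := congr1 (fun f => f i) H0.
  by rewrite /H /sadd /smul mulNr => /subr0_eq.
have [S HS] := eS.
have [M2 [S' HS']] := act_conj_pmulX f S M.
exists (wcomp S' A'), M2, (G * e); split; last first.
  rewrite act_comp Au act_smul HS' -HS -smulM; congr smul.
  by rewrite -[pmul _ (smul e u)]/(act (WP (f ^+ M2) WI) _) act_smul.
rewrite ltnNge; apply/negP => /size1_polyC E.
have : (G * e).[- s / 2] = 0.
  rewrite hornerM /G horner_prod.
  have hR : (R < R.*2.+1)%N by lia.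
  rewrite (bigD1 (Ordinal hR)) //= subrr sh0 /DZ !hornerM.
  have -> : y.[- s / 2] = 0 by rewrite /y /ypol !hornerE /=; field.
  by rewrite !(mulr0, mul0r).
rewrite E hornerC => c0; move: E; rewrite c0 polyC0 => /eqP.
by rewrite mulf_eq0 (negbTE G0) (negbTE e0).
Qed.

End CoreTheorem.

(** * Series with another centre of reflection, and operators of order zero *)

Section Twisted.
Variable K : numFieldType.
Implicit Types (u v : int -> {poly K}).

Lemma size_sh m (p : {poly K}) : size (sh m p) = size p.
Proof.
by apply: size_comp_poly2; rewrite -[_%:P]opprK -polyCN size_XsubC.
Qed.

Lemma pmul_smul f p u : pmul f (smul p u) = smul p (pmul f u).
Proof. exact: (act_smul (WP f WI)). Qed.
Lemma pmul_shs f m u : pmul f (shs m u) = shs m (pmul f u).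
Proof. exact: (act_shs (WP f WI)). Qed.

(** If u is proportional over K(N) to its reflection, it is proportional to an invariant series: to
    u + refls s u, or to ypol u when u is odd. Proportional series span the same module and satisfy
    the same equation in x. *)
Lemma bispectral_quasi_inv (a b s : K) u f A B :
  (forall t : nat, a + 1 + t%:R != 0) -> s = a + b + 1 -> f != 0 ->
  A != 0 -> B != 0 -> smul B (refls s u) = smul A u ->
  span (fser a s) u -> span u (pmul f (fser a s)) ->
  exists w M (theta : {poly K}),
    (1 < size theta)%N /\ act w u = smul theta (pmul (f ^+ M) u).
Proof.
move=> Ha sE f0 A0 B0 HAB Fu uF.
have [v [P [Q [P0 Q0 rv PQ]]]] : exists v P Q,
    [/\ P != 0, Q != 0, refls s v = v & smul P v = smul Q u].
  have [AB0|AB0] := eqVneq (A + B) 0.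
    have ru : refls s u = smul (-1) u.
      apply: (smulI B0); rewrite HAB smulM mulrN1; congr smul.
      by apply/eqP; rewrite -addr_eq0 AB0.
    exists (smul (ypol s) u), 1, (ypol s); split; rewrite ?oner_neq0 ?ypol_neq0 ?smul1 //.
    by rewrite refls_smul refl_ypol ru smulM mulrN1 opprK.
  exists (sadd u (refls s u)), B, (A + B); split=> //.
    rewrite refls_sadd reflsK; apply/funext => i; exact: addrC.
  by rewrite smulDr HAB smulDl; apply/funext => i; exact: addrC.
have uv : span u v by apply: (span_div P0); rewrite PQ; apply/span_smul/span_id.
have vu : span v u by apply: (span_div Q0); rewrite -PQ; apply/span_smul/span_id.
have [w [M [theta [th E]]]] :=
  bispectral_core Ha sE f0 rv (span_trans Fu uv) (span_trans vu uF).
exists w, M, theta; split=> //; apply: (smulI Q0).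
rewrite -act_smul -PQ act_smul E smulM mulrC -smulM -pmul_smul PQ.
by rewrite pmul_smul !smulM mulrC.
Qed.

Lemma span_raise (a b s : K) : (forall t : nat, a + 1 + t%:R != 0) ->
  s = a + b + 1 -> span (fser (a + 1) (s + 1)) (fser a s).
Proof.
move=> Ha sE.
have a1 : a + 1 != 0 by have := Ha 0%N; rewrite addr0.
apply: (@span_div _ _ ((a + 1) *: ypol s)).
  by rewrite scaler_eq0 (negbTE a1) ypol_neq0.
have -> : smul ((a + 1) *: ypol s) (fser a s) =
    sadd (smul (('X + s%:P) * ('X + (a + 1)%:P)) (fser (a + 1) (s + 1)))
         (smul (- ('X * ('X + b%:P))) (shs (-1) (fser (a + 1) (s + 1)))).
  apply/funext => i; rewrite /smul /sadd /shs.
  case: i => [n|n]; last by rewrite /fser /sh comp_poly0 !mulr0 addr0.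
  apply: poly_eq => N; rewrite /ypol !hornerE !sh_horner !fser_horner rmorphN1.
  have := hcoef_raise s N n Ha; have -> : s - a - 1 = b by rewrite sE; ring.
  move=> H; transitivity ((a + 1) * (2 * N + s) * hcoef a s N n); first by ring.
  by rewrite H /=; ring.
by apply: span_add; apply: span_smul; [|apply: span_shs]; apply: span_id.
Qed.

Lemma span_lower (a s : K) : (forall t : nat, a + 1 + t%:R != 0) ->
  span (fser a s) (pmul 'X (fser (a + 1) (s + 1))).
Proof.
move=> Ha; rewrite -[pmul _ _]shs0 -[X in shs X](subrr 1) -shs_shs.
apply: span_shs; apply: (@span_div _ _ (- (ypol s + (-1)%:P))).
  by rewrite oppr_eq0 ypolc_neq0.
have -> : smul (- (ypol s + (-1)%:P)) (shs (-1) (pmul 'X (fser (a + 1) (s + 1)))) =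
    sadd (smul (a + 1)%:P (fser a s)) (smul (- (a + 1))%:P (shs (-1) (fser a s))).
  rewrite pmulX; apply/funext => i; rewrite /smul /sadd /shs.
  case: i => [[|n]|n].
  - rewrite !fser0 /sh comp_polyC -[X in _ * (X \Po _)]polyC1 comp_polyC polyC0 mulr0.
    by rewrite -mulrDl -polyCD subrr polyC0 mul0r.
  - have -> : n.+1%:Z - 1 = n by lia.
    apply: poly_eq => N; rewrite /ypol !hornerE !sh_horner !fser_horner rmorphN1.
    have H := hcoef_lower s N n Ha.
    transitivity ((a + 1) * (hcoef a s N n.+1 - hcoef a s (N - 1) n.+1)); last by ring.
    by rewrite H /=; ring.
  - by rewrite !fser_neg /sh ?comp_poly0 ?mulr0 ?addr0 //; lia.
by apply: span_add; apply: span_smul; [|apply: span_shs]; apply: span_id.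
Qed.

(** Shifting N by r changes the reflection constant s - m into s - m + 2r. An even m leads back to
    s; an odd m leads to s + 1, the constant that belongs to the parameters a + 1 and b. *)
Theorem bispectral_twisted (a b s : K) u f (m : nat) A B :
  (forall t : nat, a + 1 + t%:R != 0) -> s = a + b + 1 -> f != 0 ->
  A != 0 -> B != 0 -> smul B (refls (s - m%:R) u) = smul A u ->
  span (fser a s) u -> span u (pmul f (fser a s)) ->
  exists w i j (theta : {poly K}),
    (1 < size theta)%N /\ act w u = smul theta (pmul ('X^i * f ^+ j) u).
Proof.
move=> Ha sE f0 A0 B0 HAB Fu uF.
have back (r : nat) (s' : K) f' : s' = s + r%:R *+ 2 - m%:R ->
  (smul (sh r B) (refls s' (shs r u)) = smul (sh r A) (shs r u) ->
   exists w M (theta : {poly K}),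
    (1 < size theta)%N /\ act w (shs r u) = smul theta (pmul (f' ^+ M) (shs r u))) ->
  exists w M (theta : {poly K}),
    (1 < size theta)%N /\ act w u = smul theta (pmul (f' ^+ M) u).
  move=> s'E; case.
    rewrite -shs_smul -HAB shs_smul; congr smul.
    apply/funext => i; apply: poly_eq => N.
    rewrite refl_horner !sh_horner refl_horner -pmulrn s'E; congr (_.[_]); ring.
  move=> w [M [theta [th E]]]; exists w, M, (sh (- r%:Z) theta); rewrite size_sh; split=> //.
  have := congr1 (shs (- r%:Z)) E.
  rewrite -act_shs shs_smul -pmul_shs shs_shs.
  by rewrite addNr shs0.
have sp v (r : nat) : span v u -> span v (shs r u) by move=> ?; apply: span_shs.
have sp' (r : nat) : span (shs r u) u.
  by rewrite -{2}[u]shs0 -(addNr r%:Z) -shs_shs; apply/span_shs/span_id.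
have [mE|mO] : m = (m./2).*2 \/ m.+1 = (m.+1./2).*2.
  by case: (boolP (odd m)) => h; [right|left]; rewrite -[LHS]odd_double_half /= ?h ?(negbTE h).
- have [] := back m./2 s f.
    by rewrite -mulrnA muln2 -mE addrK.
    move=> H; apply: (bispectral_quasi_inv Ha sE f0 _ _ H); rewrite ?sh_eq0 //.
      exact: sp.
    exact: span_trans (sp' _) uF.
  by move=> w [M [theta [th E]]]; exists w, 0%N, M, theta; rewrite expr0 mul1r.
- have Ha' (t : nat) : a + 1 + 1 + t%:R != 0.
    by have := Ha t.+1; rewrite -natr1 [t%:R + 1]addrC !addrA.
  have sE' : s + 1 = a + 1 + b + 1 by rewrite sE; ring.
  (* The factor 'X enters because the lowering relation gives only x times the series with raised
     parameters. *)
  have [] := back m.+1./2 (s + 1) ('X * f).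
    by rewrite -mulrnA muln2 -mO -natr1; ring.
    move=> H; apply: (bispectral_quasi_inv Ha' sE' _ _ _ H); rewrite ?sh_eq0 //.
    + by rewrite mulf_neq0 ?polyX_eq0.
    + by apply: sp; apply: span_trans Fu; apply: span_raise sE.
    + apply: span_trans (sp' _) _; apply: span_trans uF _.
      rewrite mulrC pmulM.
      by apply: (span_act (WP f WI)); apply: span_lower.
  by move=> w [M [theta [th E]]]; exists w, M, M, theta; rewrite -exprMn.
Qed.

(** Comparing the lowest coefficients in x of both sides expresses theta as a quotient of two
    coefficients of p and f, so theta would be constant. *)
Lemma no_order0 (u : int -> {poly K}) (p f theta : {poly K}) :
  (forall i, i < 0 -> u i = 0) -> u <> (fun=> 0) -> f != 0 -> (1 < size theta)%N ->
  pmul p u <> smul theta (pmul f u).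
Proof.
move=> Hneg nz f0 th E.
have ex : exists n : nat, u n != 0.
  apply: contrapT => nex; apply: nz; apply/funext => -[n|n]; last exact: Hneg.
  by apply/eqP/negPn/negP => h; apply: nex; exists n.
have [i0 ui0 umin] := ex_minnP ex.
have Hu i : i < i0%:Z -> u i = 0.
  case: i => [n|n] h; last exact: Hneg.
  by apply/eqP/negPn/negP => /umin; lia.
have [a0 fa0 fmin] := lowest_coef f0.
have E1 := congr1 (fun g => g (i0%:Z + a0%:Z)) E.
rewrite /smul (pmul_lowest Hu fmin) in E1.
have [p0|p0] := eqVneq p 0.
  move: E1; rewrite p0 pmul0 => /esym/eqP; rewrite mulf_eq0 scaler_eq0.
  by rewrite (negbTE fa0) (negbTE ui0) -size_poly_eq0; case: (size theta) th.
have [b0 pb0 pmin] := lowest_coef p0.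
have th0 : theta != 0 by rewrite -size_poly_eq0; case: (size theta) th.
have [lt|gt|eq] := ltngtP a0 b0.
- move: E1; rewrite (pmul_lowest Hu (a0 := a0)) => [|c h]; last by apply: pmin; lia.
  rewrite pmin // scale0r => /esym/eqP; rewrite mulf_eq0 scaler_eq0.
  by rewrite (negbTE fa0) (negbTE ui0) (negbTE th0).
- have := congr1 (fun g => g (i0%:Z + b0%:Z)) E.
  rewrite /smul (pmul_lowest Hu pmin) (pmul_lowest Hu (a0 := b0)) => [/eqP|c h]; last by apply: fmin; lia.
  by rewrite fmin // scale0r mulr0 scaler_eq0 (negbTE pb0) (negbTE ui0).
- move: E1; rewrite eq (pmul_lowest Hu pmin) -eq -scalerAr scalerAl => /eqP.
  rewrite -subr_eq0 -mul_polyC -mulrBl mulf_eq0 (negbTE ui0) orbF subr_eq0 => /eqP.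
  move/(congr1 (fun q => size (q : {poly K}))) => h.
  move: th; rewrite -(size_scale theta fa0) -h => /leq_trans /(_ (size_polyC_leq1 _)).
  by rewrite ltnn.
Qed.

End Twisted.

(** * Difference operators and Casorati determinants *)

Section Operators.
Variables (K : numFieldType) (C : (int -> K) -> Prop).
Hypothesis C0 : C (fun=> 0).
Hypothesis C1 : C (fun=> 1).
Hypothesis CD : forall x y, C x -> C y -> C (fun n => x n + y n).
Hypothesis CN : forall x, C x -> C (fun n => - x n).
Hypothesis CM : forall x y, C x -> C y -> C (fun n => x n * y n).
Hypothesis Cshift : forall x (e : int), C x -> C (fun n => x (n + e)).

Definition opsum (c : int) d (x : nat -> int -> K) (g : int -> K) (n : int) : K :=
  \sum_(j < d) x j n * g (n + c + j%:Z).

(** [c] is the lowest shift and [d] the number of consecutive shifts. The coefficient class [C] is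
    instantiated twice: by all functions, and by the rational functions without poles on the
    lattice. *)
Definition isop (c : int) d (X : (int -> K) -> int -> K) :=
  exists x, (forall j, C (x j)) /\ forall g n, X g n = opsum c d x g n.

Lemma isop_ext c d X Y : (forall g n, X g n = Y g n) -> isop c d X -> isop c d Y.
Proof. by move=> E [x [Cx Hx]]; exists x; split=> // g n; rewrite -E. Qed.

Lemma isop_id : isop 0 1 (fun g => g).
Proof.
exists (fun _ _ => 1); split=> // g n; by rewrite /opsum big_ord1 mul1r !addr0.
Qed.

Lemma isop_add c d X Y : isop c d X -> isop c d Y ->
  isop c d (fun g n => X g n + Y g n).
Proof.
move=> [x [Cx Hx]] [y [Cy Hy]]; exists (fun j n => x j n + y j n).
split=> [j|g n]; first exact: CD.
rewrite Hx Hy /opsum -big_split; apply: eq_bigr => j _; by rewrite mulrDl.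
Qed.

Lemma isop_widenr c d X : isop c d X -> isop c d.+1 X.
Proof.
move=> [x [Cx Hx]]; exists (fun j => if (j < d)%N then x j else fun=> 0).
split=> [j|g n]; first by case: ifP.
rewrite Hx /opsum big_ord_recr /= ltnn mul0r addr0; apply: eq_bigr => j _.
by rewrite ltn_ord.
Qed.

Lemma isop_widenl c d X : isop c d X -> isop (c - 1) d.+1 X.
Proof.
move=> [x [Cx Hx]]; exists (fun j => if j is j'.+1 then x j' else fun=> 0).
split=> [[|j] //|g n].
rewrite Hx /opsum big_ord_recl /= mul0r add0r; apply: eq_bigr => j _ /=.
by congr (_ * g _); rewrite /bump; lia.
Qed.

Lemma isop_shiftr c d X (e : int) : isop c d X ->
  isop (c + e) d (fun g => X (fun n => g (n + e))).
Proof.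
move=> [x [Cx Hx]]; exists x; split=> // g n.
by rewrite Hx; apply: eq_bigr => j _; congr (_ * g _); lia.
Qed.

Lemma isop_mulr c d X a : C a -> isop c d X ->
  isop c d (fun g => X (fun n => a n * g n)).
Proof.
move=> Ca [x [Cx Hx]]; exists (fun j n => x j n * a (n + (c + j%:Z))).
split=> [j|g n]; first by apply: CM => //; apply: Cshift.
by rewrite Hx; apply: eq_bigr => j _; rewrite !addrA mulrA.
Qed.

Lemma isop_tridiag c d X L : C (coef_up L) -> C (coef_mid L) -> C (coef_down L) ->
  isop c d X -> isop (c - 1) d.+2 (fun g => X (tridiag_app L g)).
Proof.
move=> Cu Cm Cd HX.
have Hu := isop_widenl (isop_widenl (isop_shiftr 1 (isop_mulr Cu HX))).
have Hm := isop_widenr (isop_widenl (isop_mulr Cm HX)).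
have Hd := isop_widenr (isop_widenr (isop_shiftr (-1) (isop_mulr Cd HX))).
have e1 : c + 1 - 1 - 1 = c - 1 by lia.
rewrite e1 in Hu; apply: isop_ext (isop_add (isop_add Hu Hm) Hd) => g n.
have [x [_ Hx]] := HX; rewrite !Hx /opsum -!big_split; apply: eq_bigr => j _.
by rewrite /tridiag_app /= -!mulrDr.
Qed.

(** Right division with remainder by the operator with coefficients v, removing one leading term at
    a time; the leading coefficient v_m has to be invertible within the class [C]. *)
Lemma op_div m (v : nat -> int -> K) c d X :
  (forall j, C (v j)) -> (forall n, v m n != 0) -> C (fun n => (v m n)^-1) ->
  isop c (d + m) X ->
  exists (q r : nat -> int -> K), (forall i, C (q i)) /\ forall g n, X g n =
    \sum_(i < d) q i n * opsum (- m%:Z) m.+1 v g (n + c + m%:Z + i%:Z) +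
    \sum_(j < m) r j n * g (n + c + j%:Z).
Proof.
move=> Cv v0 Cvi; elim: d X => [|d IH] X.
  move=> [x [Cx Hx]]; exists (fun _ _ => 0), x; split=> // g n.
  by rewrite big_ord0 add0r Hx.
move=> [x [Cx Hx]].
(* The shift in front of the divisor moves past v_m, so v_m is inverted at the shifted point. *)
pose qd n := x (d + m)%N n * (v m (n + (c + m%:Z + d%:Z)))^-1.
have Cqd : C qd by apply: CM => //; exact: (Cshift (c + m%:Z + d%:Z) Cvi).
have [|q [r [Cq Hq]]] := IH (fun g n => X g n - qd n * opsum (- m%:Z) m.+1 v g (n + (c + m%:Z + d%:Z))).
  exists (fun j n => x j n - (if (d <= j)%N then qd n * v (j - d)%N (n + (c + m%:Z + d%:Z)) else 0)).
  split=> [j|g n].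
    apply: CD => //; apply: CN; case: leqP => // _; apply: CM => //; exact: Cshift.
  rewrite Hx /opsum.
  under [RHS]eq_bigr => j _ do rewrite mulrBl.
  rewrite sumrB addSn big_ord_recr /= [X in qd n * X]big_ord_recr /= mulrDr.
  set t := n + (c + m%:Z + d%:Z).
  have -> : qd n * (v m t * g (t + - m%:Z + m%:Z)) = x (d + m)%N n * g (n + c + (d + m)%N%:Z).
    by rewrite mulrA /qd mulfVK //; congr (_ * g _); rewrite /t; lia.
  rewrite opprD addrACA subrr addr0; congr (_ - _).
  rewrite -(big_mkord xpredT (fun j => (if (d <= j)%N then
     qd n * v (j - d)%N t else 0) * g (n + c + j%:Z))).
  rewrite (@big_cat_nat _ _ _ d) ?leq_addr //=.
  rewrite [X in _ = X + _]big1_seq ?add0r; last first.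
    by move=> j /andP[_]; rewrite mem_index_iota => /andP[_ hj]; rewrite leqNgt hj mul0r.
  rewrite -[X in index_iota X _]add0n big_addn addKn big_mkord mulr_sumr.
  apply: eq_bigr => j _; rewrite leq_addl addnK mulrA; congr (_ * _ * g _); rewrite /t; lia.
exists (fun j => if (j < d)%N then q j else qd), r; split=> [i|g n]; first by case: ifP.
have := Hq g n => /eqP; rewrite subr_eq => /eqP ->.
rewrite big_ord_recr /= ltnn addrAC; congr (_ + _ * _ + _); last by rewrite !addrA.
by apply: eq_bigr => i _; rewrite ltn_ord.
Qed.

End Operators.

Section LastColumn.
Variable R : comPzRingType.

(** Each cofactor is kept as the same determinant with a unit last column; the coefficients of the
    Darboux operator then remain determinants of the full size. *)
Lemma det_last_column p (M : 'M[R]_(p + 1, p)) (v : 'cV[R]_(p + 1)) :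
  \det (row_mx M v) =
  \sum_j v j 0 * \det (row_mx M (\col_i (((i : nat) == j)%:R : R))).
Proof.
pose last := rshift p (ord0 : 'I_1).
have cof w w' j : cofactor (row_mx M w) j last = cofactor (row_mx M w') j last.
  rewrite /cofactor; congr (_ * \det _); apply/matrixP => x y; rewrite !mxE.
  case: splitP => // c h; exfalso; move/eqP: (neq_lift last y); apply.
  by apply: val_inj; rewrite ord1 in h; exact: (esym h).
rewrite (expand_det_col _ last); apply: eq_bigr => j _.
rewrite row_mxEr (expand_det_col _ last) (bigD1 j) //= row_mxEr mxE eqxx mul1r.
rewrite big1 ?addr0 => [|i hi]; first by congr (_ * _); exact: cof.
by rewrite row_mxEr mxE val_eqE (negbTE hi) mul0r.
Qed.

Lemma det_last_entry p (M : 'M[R]_(p + 1, p)) :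
  \det (row_mx M (\col_i (((i : nat) == p)%:R : R))) = \det (usubmx M).
Proof.
have -> : \col_i (((i : nat) == p)%:R : R) = col_mx 0 (1%:M) :> 'cV_(p + 1).
  apply/matrixP => i j; rewrite mxE; case: (split_ordP i) => i' ->.
    by rewrite col_mxEu mxE /= ltn_eqF.
  by rewrite col_mxEd !mxE !ord1 /= addn0 eqxx.
rewrite -[M in LHS]vsubmxK -block_mxEh.
by rewrite det_lblock det1 mulr1.
Qed.

Lemma det_repeated_column p (M : 'M[R]_(p + 1, p)) i :
  \det (row_mx M (col i M)) = 0.
Proof.
rewrite -det_tr; apply: (@determinant_alternate _ _ _ (lshift 1 i) (rshift p ord0)).
  by rewrite -val_eqE /= addn0 neq_ltn ltn_ord.
by move=> j; rewrite !mxE (unsplitK (inl i)) (unsplitK (inr ord0)) mxE.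
Qed.

End LastColumn.

(** * Casorati determinants, existence and uniqueness of the intertwiner *)

Section Casorati.
Variables (K : numFieldType) (p : nat) (f : 'I_p -> int -> K).

Definition shift_mx (n : int) : 'M[K]_(p + 1, p) :=
  \matrix_(j < p + 1, i < p) f i (n - p%:Z + (j : nat)%:Z).

Definition caso (n : int) : K :=
  \det (\matrix_(i < p, j < p) f i (n - p%:Z + (j : nat)%:Z)).

Definition wronsk (g : int -> K) (n : int) : K :=
  \det (row_mx (shift_mx n) (\col_(j < p + 1) g (n - p%:Z + (j : nat)%:Z))).

Definition wcoef (j : nat) (n : int) : K :=
  \det (row_mx (shift_mx n) (\col_i (((i : nat) == j)%:R : K))).

Lemma wronskE g n : wronsk g n = opsum (- p%:Z) p.+1 wcoef g n.
Proof.
transitivity (\sum_(j < p + 1) wcoef j n * g (n + - p%:Z + j%:Z)).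
  by rewrite /wronsk det_last_column; apply: eq_bigr => j _; rewrite mxE mulrC.
by rewrite /opsum addn1.
Qed.

Lemma wcoef_top n : wcoef p n = caso n.
Proof.
rewrite /wcoef det_last_entry -det_tr; congr (\det _); apply/matrixP => i j.
by rewrite !mxE.
Qed.

Lemma wronsk_kernel i n : wronsk (f i) n = 0.
Proof.
rewrite /wronsk -(det_repeated_column (shift_mx n) i); congr (\det (row_mx _ _)).
by apply/matrixP => j c; rewrite !mxE.
Qed.

Lemma wronsk_lin (c : K) g g' n :
  wronsk (fun x => c * g x + g' x) n = c * wronsk g n + wronsk g' n.
Proof.
rewrite !wronskE /opsum mulr_sumr -big_split; apply: eq_bigr => j _ /=; ring.
Qed.

(** The Casorati matrix is invertible, so a difference operator with p consecutive shifts that kills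
    all f_i is zero. This is what makes remainders of right divisions vanish. *)
Lemma caso_kill (r : nat -> K) n : caso n != 0 ->
  (forall i, \sum_(j < p) r j * f i (n - p%:Z + (j : nat)%:Z) = 0) ->
  forall j, (j < p)%N -> r j = 0.
Proof.
move=> c0 H j hj.
pose M := \matrix_(i < p, j < p) f i (n - p%:Z + (j : nat)%:Z).
have Mu : M \in unitmx by rewrite unitmxE unitfE.
have : M *m (\col_j r j) = 0.
  apply/matrixP => i x; rewrite !mxE -[RHS](H i); apply: eq_bigr => y _.
  by rewrite !mxE mulrC.
move/(congr1 (mulmx (invmx M))); rewrite mulKmx // mulmx0.
by move/matrixP/(_ (Ordinal hj) 0); rewrite !mxE.
Qed.

Hypothesis caso0 : forall n, caso n != 0.

Definition darboux (g : int -> K) n := (caso n)^-1 * wronsk g n.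

Definition dcoef j n := (caso n)^-1 * wcoef j n.

Lemma darbouxE g n : darboux g n = opsum (- p%:Z) p.+1 dcoef g n.
Proof.
by rewrite /darboux wronskE /opsum mulr_sumr; apply: eq_bigr => j _; rewrite mulrA.
Qed.

Lemma dcoef_top n : dcoef p n = 1.
Proof. by rewrite /dcoef wcoef_top mulVf. Qed.

Let delta (n : int) : int -> K := fun x => (x == n)%:R.

Lemma darboux_delta0 n x : x < n -> darboux (delta n) x = 0.
Proof.
move=> h; rewrite darbouxE; apply: big1 => j _.
by rewrite /delta [_ == _](_ : _ = false) ?mulr0 //; have := ltn_ord j; lia.
Qed.

Lemma darboux_delta1 n : darboux (delta n) n = 1.
Proof.
rewrite darbouxE /opsum big_ord_recr /= big1 ?add0r => [|j _].
  by rewrite dcoef_top /delta subrK eqxx mulr1.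
by rewrite /delta [_ == _](_ : _ = false) ?mulr0 //; have := ltn_ord j; lia.
Qed.

(** P is triangular with leading coefficient 1: the image of the indicator of n vanishes to the left
    of n and equals 1 at n. Testing with the indicators of n + 1, n and n - 1 gives the three
    coefficients in this order. *)
Lemma intertwiner_inj (L L' : tridiag K) :
  (forall g n, tridiag_app L (darboux g) n = tridiag_app L' (darboux g) n) -> L = L'.
Proof.
case: L L' => [u m d] [u' m' d'] H.
have Hu n : u n = u' n.
  have := H (delta (n + 1)) n; rewrite /tridiag_app /= darboux_delta1 mulr1.
  by rewrite !darboux_delta0 ?mulr0 ?addr0 ?mulr1; lia || move=> ->.
have Hm n : m n = m' n.
  have := H (delta n) n; rewrite /tridiag_app /= darboux_delta1 Hu.
  rewrite [darboux _ (n - 1)]darboux_delta0; last by lia.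
  by rewrite !mulr0 !addr0 !mulr1 => /addrI.
have Hd n : d n = d' n.
  have := H (delta (n - 1)) n; rewrite /tridiag_app /= darboux_delta1 Hu Hm.
  by rewrite !mulr1 => /addrI.
by congr Tridiag; apply/funext.
Qed.

(** P L0 is divided by P on the right. The quotient has three terms; the remainder kills every f_i,
    because L0 maps the f_i into the kernel of P, and so it is zero. *)
Lemma intertwiner_exists (L0 : tridiag K) :
  (forall i n, wronsk (tridiag_app L0 (f i)) n = 0) ->
  exists L, forall g n, tridiag_app L (darboux g) n = darboux (tridiag_app L0 g) n.
Proof.
pose T := fun (_ : int -> K) => True; move=> Hc.
have Hop : isop T (- p%:Z) p.+1 darboux by exists dcoef; split=> // g n; rewrite darbouxE.
have HX : isop T (- p%:Z - 1) (3 + p) (fun g => darboux (tridiag_app L0 g)).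
  exact: isop_tridiag.
have top0 n : dcoef p n != 0 by rewrite dcoef_top oner_eq0.
have [q [r [_ Hq]]] : exists q r : nat -> int -> K, (forall i, T (q i)) /\
    forall g n, darboux (tridiag_app L0 g) n =
    \sum_(i < 3) q i n * opsum (- p%:Z) p.+1 dcoef g (n + (- p%:Z - 1) + p%:Z + i%:Z) +
    \sum_(j < p) r j n * g (n + (- p%:Z - 1) + j%:Z).
  exact: op_div.
have r0 n j : (j < p)%N -> r j n = 0.
  apply: (@caso_kill (fun j => r j n) (n - 1)) => // i.
  have := Hq (f i) n.
  rewrite {1}/darboux Hc mulr0 [X in X + _]big1 ?add0r => [H|x _]; last first.
    by rewrite -darbouxE /darboux wronsk_kernel !mulr0.
  by rewrite [RHS]H; apply: eq_bigr => x _; congr (_ * f i _); lia.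
exists (Tridiag (q 2%N) (q 1%N) (q 0%N)) => g n.
rewrite Hq [X in _ + X]big1 ?addr0 => [|j _]; last by rewrite r0 ?mul0r.
rewrite !big_ord_recr big_ord0 /= add0r -!darbouxE /tridiag_app /=.
transitivity (q 0%N n * darboux g (n - 1) + q 1%N n * darboux g n +
              q 2%N n * darboux g (n + 1)); first by ring.
by congr (_ * darboux _ _ + _ * darboux _ _ + _ * darboux _ _); lia.
Qed.

End Casorati.

(** * The determinant with polynomial entries *)

Section Rational.
Variables (K : numFieldType) (e : K).

Definition ratfun (g : int -> K) := exists P Q : {poly K},
  (forall n : int, Q.[n%:~R + e] != 0) /\
  (forall n : int, g n = P.[n%:~R + e] / Q.[n%:~R + e]).

Lemma ratfun_poly (P : {poly K}) : ratfun (fun n => P.[n%:~R + e]).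
Proof.
exists P, 1; split=> n; first by rewrite hornerC oner_eq0.
by rewrite hornerC divr1.
Qed.

Lemma ratfun_cst c : ratfun (fun=> c).
Proof.
have [P [Q [H1 H2]]] := ratfun_poly c%:P.
by exists P, Q; split=> // n; rewrite -H2 hornerC.
Qed.

Lemma ratfunD x y : ratfun x -> ratfun y -> ratfun (fun n => x n + y n).
Proof.
move=> [P [Q [Q0 H]]] [P' [Q' [Q'0 H']]]; exists (P * Q' + P' * Q), (Q * Q').
split=> n; first by rewrite hornerM mulf_neq0.
by rewrite H H' hornerD !hornerM; field; rewrite Q0 Q'0.
Qed.

Lemma ratfunM x y : ratfun x -> ratfun y -> ratfun (fun n => x n * y n).
Proof.
move=> [P [Q [Q0 H]]] [P' [Q' [Q'0 H']]]; exists (P * P'), (Q * Q').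
split=> n; first by rewrite hornerM mulf_neq0.
by rewrite H H' !hornerM; field; rewrite Q0 Q'0.
Qed.

Lemma ratfunN x : ratfun x -> ratfun (fun n => - x n).
Proof.
move=> [P [Q [Q0 H]]]; exists (- P), Q; split=> // n.
by rewrite H hornerN mulNr.
Qed.

Lemma ratfunV x : ratfun x -> (forall n, x n != 0) -> ratfun (fun n => (x n)^-1).
Proof.
move=> [P [Q [Q0 H]]] x0; exists Q, P; split=> n; last by rewrite H invf_div.
by apply: contraNneq (x0 n) => P0; rewrite H P0 mul0r.
Qed.

Lemma ratfun_shift x (c : int) : ratfun x -> ratfun (fun n => x (n + c)).
Proof.
move=> [P [Q [Q0 H]]]; exists (sh c P), (sh c Q); split=> n.
  by rewrite sh_horner -addrAC -intrD.
by rewrite H !sh_horner [n%:~R + e + _]addrAC -intrD.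
Qed.

Lemma ratfun_common (q : nat -> int -> K) d : (forall i, ratfun (q i)) ->
  exists (D : {poly K}) (P : nat -> {poly K}), (forall n : int, D.[n%:~R + e] != 0) /\
  forall i n, (i < d)%N -> D.[n%:~R + e] * q i n = (P i).[n%:~R + e].
Proof.
move=> Hq; elim: d => [|d [D [P [D0 H]]]].
  by exists 1, (fun=> 0); split=> // n; rewrite hornerC oner_eq0.
have [P' [Q' [Q'0 H']]] := Hq d.
exists (D * Q'), (fun i => if (i < d)%N then P i * Q' else D * P'); split=> [n|i n].
  by rewrite hornerM mulf_neq0.
rewrite ltnS leq_eqVlt => /orP[/eqP ->|lt].
  by rewrite ltnn !hornerM H' -mulrA; congr (_ * _); rewrite mulrC mulfVK.
by rewrite lt !hornerM -(H _ _ lt); ring.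
Qed.

End Rational.

Section DeterminantFamily.
Variables (K : numFieldType) (s bt e : K) (p : nat).
Variables (pl : 'I_p -> bool) (pi : 'I_p -> {poly K}) (kap : {poly K}).
Variables (F : int -> {poly K}) (t Gam : int -> K) (f : 'I_p -> int -> K).
Hypothesis rpi : forall i, refl s (pi i) = pi i.
Hypothesis rkap : refl s kap = kap.
Hypothesis rF : refls s F = F.
Hypothesis qn0 : forall n : int, n%:~R + e + s + 1 - bt != 0.
Hypothesis t0 : forall n, t n != 0.
Hypothesis tS : forall n, t (n + 1) * (n%:~R + e + s + 1 - bt) = - (t n * (n%:~R + e + bt)).
Hypothesis Gam0 : forall n, Gam n != 0.
Hypothesis fE : forall i n,
  f i n = Gam n * ((if pl i then 1 else t n) * (pi i).[n%:~R + e]).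

Let qf : {poly K} := 'X + (s + 1 - bt)%:P.
Let pf : {poly K} := 'X + bt%:P.
(** [Gam] is the gauge shared by the kernel functions at z = 1, and [t] the ratio to it of the gauge
    at z = -1. By the recurrence of [t], t(n - p + j) = t(n - p) dd_j / cc_j, so multiplying row j
    by cc_j makes all entries polynomial. *)
Definition cc (j : nat) : {poly K} := \prod_(i < j) sh (i%:Z - p%:Z) qf.
Definition dd (j : nat) : {poly K} := \prod_(i < j) - sh (i%:Z - p%:Z) pf.
Definition pol_mx : 'M[{poly K}]_(p + 1, p) :=
  \matrix_(j < p + 1, i < p) ((if pl i then cc j else dd j) * sh (j%:Z - p%:Z) (pi i)).
Definition pol_det (g : {poly K}) : {poly K} :=
  \det (row_mx pol_mx (\col_(j < p + 1) (cc j * sh (j%:Z - p%:Z) g))).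
Definition pol_coef (j : nat) : {poly K} :=
  cc j * \det (row_mx pol_mx (\col_i (((i : nat) == j)%:R))).
Definition useries : int -> {poly K} := fun i => pol_det (kap * F i).

Lemma pol_detE g : pol_det g = \sum_(j < p.+1) pol_coef j * sh (j%:Z - p%:Z) g.
Proof.
transitivity (\sum_(j < p + 1) pol_coef j * sh (j%:Z - p%:Z) g); last by rewrite addn1.
rewrite /pol_det det_last_column; apply: eq_bigr => j _.
by rewrite mxE /pol_coef -!mulrA; congr (_ * _); rewrite mulrC.
Qed.

Lemma span_useries : span F useries.
Proof.
have -> : useries = fun i => \sum_(j < p.+1)
    smul (pol_coef j) (shs (j%:Z - p%:Z) (smul kap F)) i.
  by apply/funext => i; rewrite /useries pol_detE.
apply: (@span_sum _ F p.+1 (fun j => smul (pol_coef j) (shs (j%:Z - p%:Z) (smul kap F)))) => // j _.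
by apply/span_smul/span_shs/span_smul/span_id.
Qed.

Lemma cc_neq0 j : cc j != 0.
Proof. by apply/prodf_neq0 => i _; rewrite sh_eq0; apply: Xpc_neq0. Qed.
Lemma dd_neq0 j : dd j != 0.
Proof. by apply/prodf_neq0 => i _; rewrite oppr_eq0 sh_eq0; apply: Xpc_neq0. Qed.

Lemma refl_sh_inv (g : {poly K}) j : refl s g = g ->
  refl (s - p%:R) (sh (j%:Z - p%:Z) g) = sh (- j%:Z) g.
Proof.
move=> rg; rewrite -[in RHS]rg; apply: poly_eq => N.
rewrite refl_horner !sh_horner refl_horner; congr (_.[_]).
by rewrite intrB intrN -!pmulrn; ring.
Qed.

(** The reflection with constant s - p is centred in the middle of the p + 1 shifts. It sends the
    factor i of cc to the factor p - 1 - i of dd, hence cc_j to the product of the last j factors of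
    dd_p. *)
Lemma cc_refl j : (j <= p)%N -> dd (p - j) * refl (s - p%:R) (cc j) = dd p.
Proof.
elim: j => [|j IH] hj.
  by rewrite subn0 /cc big_ord0 -polyC1 /refl comp_polyC polyC1 mulr1.
rewrite /cc big_ord_recr /= -/(cc j) reflM mulrCA mulrC -[RHS](IH (ltnW hj)).
have -> : (p - j = (p - j.+1).+1)%N by lia.
rewrite /dd [in RHS]big_ord_recr /= -/(dd _) [in RHS]mulrAC -!mulrA; congr (_ * _).
rewrite mulrC; congr (_ * _); apply: poly_eq => N.
rewrite refl_horner hornerN !sh_horner /qf /pf !hornerE /=.
by rewrite !intrB -!pmulrn (natrB _ hj) -natr1; ring.
Qed.

Lemma dd_refl j : (j <= p)%N -> cc (p - j) * refl (s - p%:R) (dd j) = cc p.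
Proof.
elim: j => [|j IH] hj.
  by rewrite subn0 /dd big_ord0 -polyC1 /refl comp_polyC polyC1 mulr1.
rewrite /dd big_ord_recr /= -/(dd j) reflM mulrCA mulrC -[RHS](IH (ltnW hj)).
have -> : (p - j = (p - j.+1).+1)%N by lia.
rewrite /cc [in RHS]big_ord_recr /= -/(cc _) [in RHS]mulrAC -!mulrA; congr (_ * _).
rewrite mulrC; congr (_ * _); apply: poly_eq => N.
rewrite refl_horner hornerN !sh_horner /qf /pf !hornerE /=.
by rewrite !intrB -!pmulrn (natrB _ hj) -natr1; ring.
Qed.

(* Reversing the rows and rescaling rows and columns turns the reflected
   determinant into the original one. *)
Lemma useries_refl : exists A B, [/\ A != 0, B != 0 &
  smul B (refls (s - p%:R) useries) = smul A useries].
Proof.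
pose R := refl (s - p%:R).
(* Row j is multiplied by cc_j dd_j. By [cc_refl] and [dd_refl] one of these two factors combines
   with the reflected entry into dd_p or cc_p, which depends on the column only. *)
pose colf := row_mx (\row_(i < p) if pl i then dd p else cc p) (const_mx (dd p) : 'rV_1).
pose rowf := \row_(j < p + 1) (cc j * dd j).
pose sg := perm (@rev_ord_inj (p + 1)).
exists (\det (diag_mx colf)), (\det (diag_mx rowf) * \det (perm_mx sg)); split.
- rewrite det_diag; apply/prodf_neq0 => j _; rewrite mxE.
  by case: splitP => i _; rewrite mxE; [case: ifP|]; rewrite ?cc_neq0 ?dd_neq0.
- rewrite det_diag det_perm mulf_neq0 ?signr_eq0 //.
  by apply/prodf_neq0 => j _; rewrite mxE mulf_neq0 ?cc_neq0 ?dd_neq0.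
apply/funext => i; rewrite /smul /refls /useries /pol_det.
set M := row_mx _ _.
have -> : refl (s - p%:R) (\det M) = \det (map_mx R M).
  exact: (esym (det_map_mx (comp_poly (- 'X - (s - p%:R)%:P)) M)).
rewrite [RHS]mulrC -!det_mulmx; congr (\det _).
rewrite -mulmxA -row_permE mul_diag_mx mul_mx_diag; apply/matrixP => j c.
have hj : (p - j <= p)%N by exact: leq_subr.
have hj' : (j <= p)%N by have := ltn_ord j; lia.
rewrite !mxE permE /=.
have revj : (p + 1 - j.+1 = p - j)%N by lia.
have rkF : refl s (kap * F i) = kap * F i.
  by rewrite reflM rkap; congr (_ * _); exact: (congr1 (fun g => g i) rF).
have Ecc := cc_refl hj; rewrite subKn // in Ecc.
have Edd := dd_refl hj; rewrite subKn // in Edd.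
case: (splitP c) => c' hc; rewrite !mxE /= revj /R reflM refl_sh_inv //.
  have -> : - (p - j)%N%:Z = j%:Z - p%:Z by lia.
  case: (pl c').
    rewrite -Ecc; ring.
  rewrite -Edd; ring.
have -> : - (p - j)%N%:Z = j%:Z - p%:Z by lia.
by rewrite -Ecc; ring.
Qed.

Lemma t_cc (n : int) (j : nat) :
  t (n - p%:Z + j%:Z) * (cc j).[n%:~R + e] = t (n - p%:Z) * (dd j).[n%:~R + e].
Proof.
elim: j => [|j IH]; first by rewrite addr0 /cc /dd !big_ord0.
rewrite /cc /dd !big_ord_recr /= -/(cc j) -/(dd j) !hornerM mulrCA [RHS]mulrA -IH.
have -> : n - p%:Z + j.+1%:Z = n - p%:Z + j%:Z + 1 by lia.
have := tS (n - p%:Z + j%:Z).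
rewrite hornerN !sh_horner /qf /pf !hornerE /= !intrD !intrN -!pmulrn => H.
rewrite -[RHS]mulrA mulrC; transitivity ((cc j).[n%:~R + e] *
   (t (n - p%:Z + j%:Z + 1) * (n%:~R - p%:R + j%:R + e + s + 1 - bt))); first by ring.
by rewrite H; ring.
Qed.

Lemma cc_horner_neq0 n j : (cc j).[n%:~R + e] != 0.
Proof.
rewrite /cc horner_prod; apply/prodf_neq0 => i _.
rewrite sh_horner /qf !hornerE /=; have := qn0 (n + (i%:Z - p%:Z)).
rewrite intrD => H; apply: contraNneq H => E; rewrite -E; apply/eqP; ring.
Qed.

(** Row j is scaled by cc_j / Gam, and t(n - p) is taken out of the columns of the second kind;
    [eta] is the quotient of the two scalings. *)
Lemma wronsk_pol : exists eta : int -> K, (forall n, eta n != 0) /\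
  forall g n, wronsk f (fun x => Gam x * g x) n =
    eta n * opsum (- p%:Z) p.+1 (fun j n => (pol_coef j).[n%:~R + e]) g n.
Proof.
pose x n : K := n%:~R + e.
pose rowf n := \row_(j < p + 1) ((cc j).[x n] / Gam (n - p%:Z + (j : nat)%:Z)).
pose colf n := row_mx (\row_(i < p) if pl i then 1 else t (n - p%:Z)) (const_mx 1 : 'rV_1).
have d1 n : \det (diag_mx (rowf n)) != 0.
  rewrite det_diag; apply/prodf_neq0 => j _; rewrite mxE.
  by rewrite mulf_neq0 ?invr_eq0 ?cc_horner_neq0.
have d2 n : \det (diag_mx (colf n)) != 0.
  rewrite det_diag; apply/prodf_neq0 => j _; rewrite mxE.
  by case: splitP => i _; rewrite mxE ?oner_eq0 //; case: ifP; rewrite ?oner_eq0 ?t0.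
exists (fun n => (\det (diag_mx (rowf n)))^-1 * \det (diag_mx (colf n))).
split=> [n|g n]; first by rewrite mulf_neq0 ?invr_eq0.
apply: (mulfI (d1 n)); rewrite !mulrA mulfV // mul1r.
have -> : opsum (- p%:Z) p.+1 (fun j n => (pol_coef j).[n%:~R + e]) g n =
    \det (row_mx (map_mx (horner_eval (x n)) pol_mx)
                 (\col_(j < p + 1) ((cc j).[x n] * g (n - p%:Z + (j : nat)%:Z)))).
  rewrite det_last_column /opsum -/(x n).
  transitivity (\sum_(j < p + 1) (pol_coef j).[x n] * g (n + - p%:Z + j%:Z)).
    by rewrite addn1.
  apply: eq_bigr => j _; rewrite mxE /pol_coef hornerM mulrAC; congr (_ * _).
  rewrite -[(\det _).[_]]/(horner_eval (x n) (\det _)) -det_map_mx.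
  congr (\det _); rewrite map_row_mx; congr (row_mx _ _).
  by apply/matrixP => a b; rewrite !mxE rmorph_nat.
rewrite /wronsk [RHS]mulrC -!det_mulmx; congr (\det _).
rewrite mul_diag_mx mul_mx_diag; apply/matrixP => j c; rewrite !mxE.
have Gj := Gam0 (n - p%:Z + j%:Z).
case: splitP => i hi; rewrite !mxE; last by rewrite mulr1; field.
rewrite /= /horner_eval hornerM sh_horner.
have xj : x n + (j%:Z - p%:Z)%:~R = (n - p%:Z + j%:Z)%:~R + e.
  by rewrite /x !intrD; ring.
rewrite fE xj; case: ifP => _; first by field.
transitivity (t (n - p%:Z + j%:Z) * (cc j).[x n] * (pi i).[(n - p%:Z + j%:Z)%:~R + e]).
  by field.
by rewrite t_cc /x; ring.
Qed.

End DeterminantFamily.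

(** * Membership in a span by right division *)

Section Division.
Variables (K : numFieldType) (e : K).

(** X kills the kernel of the operator V with coefficients v, so X = Q V without remainder. Applied
    to kap F and freed of denominators, this holds at all points n + e and is therefore an identity
    of polynomials in N. *)
Lemma span_by_division p (v : nat -> {poly K}) (h : 'I_p -> int -> K)
    (X : (int -> K) -> int -> K) (kap ff : {poly K}) (F : int -> {poly K}) :
  (forall n : int, (v p).[n%:~R + e] != 0) ->
  isop (ratfun e) (- p%:Z) (p.+1 + p) X ->
  (forall i n, opsum (- p%:Z) p.+1 (fun j n => (v j).[n%:~R + e]) (h i) n = 0) ->
  (forall i n, X (h i) n = 0) ->
  (forall n (r : nat -> K),
     (forall i, \sum_(j < p) r j * h i (n - p%:Z + (j : nat)%:Z) = 0) ->
     forall j, (j < p)%N -> r j = 0) ->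
  (forall i n, X (fun n => (kap * F i).[n%:~R + e]) n =
     (kap * pmul ff F i).[n%:~R + e]) ->
  kap != 0 ->
  span (fun i => \sum_(j < p.+1) v j * sh (j%:Z - p%:Z) (kap * F i)) (pmul ff F).
Proof.
move=> top0 HX Vh Xh kill XF kap0.
have Cv j : ratfun e (fun n => (v j).[n%:~R + e]) := ratfun_poly e (v j).
have [q [r [Cq Hq]]] := op_div (ratfun_cst e 0) (@ratfunD _ e) (@ratfunN _ e) (@ratfunM _ e)
  (@ratfun_shift _ e) Cv top0 (ratfunV (Cv p) top0) HX.
have r0 n j : (j < p)%N -> r j n = 0.
  apply: (kill n (fun j => r j n)) => i.
  have := Hq (h i) n; rewrite Xh [X in X + _]big1 ?add0r => [H|x _].
    by rewrite [RHS]H.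
  by rewrite Vh mulr0.
have [D [P [D0 DP]]] := ratfun_common p.+1 Cq.
set u := fun i => _.
have E i : D * (kap * pmul ff F i) = \sum_(c < p.+1) P c * sh c%:Z (u i).
  apply: (@poly_eq_int _ e) => n.
  rewrite hornerM -XF Hq [X in _ * (_ + X)]big1 ?addr0 => [|j _]; last by rewrite r0 ?mul0r.
  rewrite mulr_sumr horner_sum; apply: eq_bigr => c _.
  rewrite mulrA DP // hornerM sh_horner; congr (_ * _).
  rewrite /opsum /u horner_sum; apply: eq_bigr => j _.
  rewrite !hornerM !sh_horner !hornerM.
  by congr (_.[_] * (_.[_] * _.[_])); rewrite !(intrD, intrN); ring.
have D0' : D * kap != 0.
  rewrite mulf_neq0 //; apply: contraNneq (D0 0) => ->; by rewrite horner0.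
apply: (span_div D0').
have -> : smul (D * kap) (pmul ff F) =
    fun i => \sum_(c < p.+1) smul (P c) (shs c%:Z u) i.
  by apply/funext => i; rewrite /smul -mulrA E.
apply: (@span_sum _ u p.+1 (fun c => smul (P c) (shs c%:Z u))) => // c _.
by apply/span_smul/span_shs/span_id.
Qed.

End Division.

(** * Conjugation of the difference operator by the gauge factor *)

Section Gauge.
Variables (K : numFieldType) (e : K) (L : tridiag K) (Gam : int -> K).
Hypothesis Gam0 : forall n, Gam n != 0.
Hypothesis Cu : ratfun e (fun n => coef_up L n * Gam (n + 1) / Gam n).
Hypothesis Cm : ratfun e (coef_mid L).
Hypothesis Cd : ratfun e (fun n => coef_down L n * Gam (n - 1) / Gam n).

Definition Lsub c (g : int -> K) : int -> K := fun n => tridiag_app L g n - c * g n.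
(** The conjugate of L - c by [Gam]. It has rational coefficients and acts on the polynomial parts
    of the series coefficients. *)
Let Lhat c : tridiag K := Tridiag (fun n => coef_up L n * Gam (n + 1) / Gam n)
  (fun n => coef_mid L n + - c) (fun n => coef_down L n * Gam (n - 1) / Gam n).

Lemma LhatE c g n : Gam n * tridiag_app (Lhat c) g n = Lsub c (fun n => Gam n * g n) n.
Proof. by rewrite /Lsub /tridiag_app /=; field. Qed.

Lemma Lsub_comm c c' g : Lsub c (Lsub c' g) = Lsub c' (Lsub c g).
Proof. apply/funext => n; rewrite /Lsub /tridiag_app; ring. Qed.

Let Xhat k l g := iter k (tridiag_app (Lhat 1)) (iter l (tridiag_app (Lhat (-1))) g).

Lemma isop_Xhat k l : isop (ratfun e) (- (k + l)%N%:Z) ((k + l).+1 + (k + l)) (Xhat k l).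
Proof.
have step c d X c' : isop (ratfun e) c d X ->
    isop (ratfun e) (c - 1) d.+2 (fun g => X (tridiag_app (Lhat c') g)).
  apply: (isop_tridiag (ratfun_cst e 0) (@ratfunD _ e) (@ratfunM _ e) (@ratfun_shift _ e)) => //=.
  exact: ratfunD Cm (ratfun_cst _ _).
have H0 : isop (ratfun e) 0 1 (fun g : int -> K => g) by apply: isop_id; apply: ratfun_cst.
have Hk : isop (ratfun e) (- k%:Z) (k.+1 + k) (iter k (tridiag_app (Lhat 1))).
  elim: k => [|k IH]; first exact: H0.
  have -> : - k.+1%:Z = - k%:Z - 1 by lia.
  have -> : (k.+2 + k.+1 = (k.+1 + k).+2)%N by lia.
  apply: isop_ext (step _ _ _ 1 IH) => g n; by rewrite -iterSr.
elim: l => [|l IH]; first by rewrite addn0.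
have -> : - (k + l.+1)%N%:Z = - (k + l)%N%:Z - 1 by lia.
have -> : ((k + l.+1).+1 + (k + l.+1) = ((k + l).+1 + (k + l)).+2)%N by lia.
apply: isop_ext (step _ _ _ (-1) IH) => g n; by rewrite /Xhat -iterSr.
Qed.

Lemma Gam_Xhat k l g n :
  Gam n * Xhat k l g n = iter k (Lsub 1) (iter l (Lsub (-1)) (fun n => Gam n * g n)) n.
Proof.
have H c m g' : (fun n => Gam n * iter m (tridiag_app (Lhat c)) g' n) =
    iter m (Lsub c) (fun n => Gam n * g' n).
  elim: m => //= m <-; apply/funext => x; exact: LhatE.
by rewrite -H -H.
Qed.

Lemma iter_Lsub0 c m : iter m (Lsub c) (fun=> 0) = (fun=> 0).
Proof.
elim: m => //= m ->; apply/funext => n.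
by rewrite /Lsub /tridiag_app !mulr0 !addr0 subr0.
Qed.

Lemma iter_Lsub_chain c (g : nat -> int -> K) i m : (i < m)%N ->
  (forall j, (j < i)%N -> Lsub c (g j.+1) = g j) -> Lsub c (g 0%N) = (fun=> 0) ->
  iter m (Lsub c) (g i) = (fun=> 0).
Proof.
move=> im Hs H0; elim: i m im Hs => [|i IH] [//|m] im Hs.
  by rewrite iterSr H0 iter_Lsub0.
rewrite iterSr Hs // IH // => j hj; apply: Hs; exact: ltnW.
Qed.

Lemma iter_Lsub_comm c c' m m' g :
  iter m (Lsub c) (iter m' (Lsub c') g) = iter m' (Lsub c') (iter m (Lsub c) g).
Proof.
have H g' : Lsub c (iter m' (Lsub c') g') = iter m' (Lsub c') (Lsub c g').
  by elim: m' => //= m' IH; rewrite Lsub_comm IH.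
by elim: m => //= m ->; rewrite H.
Qed.

(** This is (z - 1)^k (z + 1)^l in terms of x = (1 - z) / 2. *)
Definition xfac k l : {poly K} := (- 2 *: 'X) ^+ k * (2%:P - 2 *: 'X) ^+ l.

Lemma Xhat_series (v : int -> {poly K}) k l :
  (forall i n, tridiag_app L (fun n => Gam n * (v i).[n%:~R + e]) n =
     Gam n * (v i - 2 *: v (i - 1)).[n%:~R + e]) ->
  forall i n, Xhat k l (fun n => (v i).[n%:~R + e]) n = (pmul (xfac k l) v i).[n%:~R + e].
Proof.
move=> Hv.
have step c P i : tridiag_app (Lhat c) (fun n => (pmul P v i).[n%:~R + e]) =
    fun n => (pmul ((1 - c)%:P - 2 *: 'X) (pmul P v) i).[n%:~R + e].
  have base i' n : tridiag_app (Lhat c) (fun n => (v i').[n%:~R + e]) n =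
      ((1 - c) *: v i' - 2 *: v (i' - 1)).[n%:~R + e].
    apply: (mulfI (Gam0 n)); rewrite LhatE /Lsub Hv !hornerE /=; ring.
  apply/funext => n; rewrite pmulDl /sadd pmulC -scaleNr pmulZ pmulX.
  rewrite /pmul !hornerE !horner_sum.
  transitivity (\sum_(a < size P) P`_a * tridiag_app (Lhat c) (fun n => (v (i - a%:Z)).[n%:~R + e]) n).
    rewrite /tridiag_app !horner_sum !mulr_sumr -!big_split; apply: eq_bigr => a _ /=.
    rewrite !hornerZ; ring.
  rewrite !mulr_sumr -big_split; apply: eq_bigr => a _.
  rewrite base !hornerE /= (_ : i - 1 - a%:Z = i - a%:Z - 1); last by lia.
  ring.
have Hl : forall i, iter l (tridiag_app (Lhat (-1))) (fun n => (v i).[n%:~R + e]) =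
     fun n => (pmul ((2%:P - 2 *: 'X) ^+ l) v i).[n%:~R + e].
  elim: l => [|l IH] i /=; first by rewrite expr0 pmul1.
  rewrite IH step exprS pmulM opprK.
  by rewrite (_ : (1 + 1 : K) = 2).
move=> i n; rewrite /Xhat Hl.
have -> : iter k (tridiag_app (Lhat 1))
    (fun n => (pmul ((2%:P - 2 *: 'X) ^+ l) v i).[n%:~R + e]) =
    fun n => (pmul (xfac k l) v i).[n%:~R + e].
  elim: k => [|k IH] /=; first by rewrite /xfac expr0 mul1r.
  rewrite IH step /xfac exprS -mulrA -!pmulM subrr polyC0 sub0r.
  by rewrite scaleNr.
by [].
Qed.

End Gauge.

(** * The bispectral theorem for formal series with a common gauge *)

Section FormalTheorem.
Variable K : numFieldType.

Lemma span0 (u v : int -> {poly K}) : u = (fun=> 0) -> span u v -> v = (fun=> 0).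
Proof.
move=> u0; elim=> //.
- by move=> v1 v2 _ -> _ ->; apply/funext => i; rewrite /sadd addr0.
- by move=> q v1 _ ->; apply/funext => i; rewrite /smul mulr0.
- by move=> m v1 _ ->; apply/funext => i; rewrite /shs /sh comp_poly0.
- move=> d v1 d0 _ H; apply/funext => i; apply/eqP.
  by have /eqP := congr1 (fun g => g i) H; rewrite /smul mulf_eq0 (negbTE d0).
Qed.

Lemma xfac_neq0 k l : xfac K k l != 0.
Proof.
rewrite mulf_neq0 ?expf_neq0 //.
  by rewrite scaler_eq0 oppr_eq0 pnatr_eq0 polyX_eq0.
have -> : 2%:P - 2 *: 'X = - 2 *: ('X + (- 1)%:P) :> {poly K}.
  by apply: poly_eq => x; rewrite !hornerE /=; ring.
by rewrite scaler_eq0 oppr_eq0 pnatr_eq0 Xpc_neq0.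
Qed.

Variables (a b s bt e : K) (k l m0 : nat).
Variables (pl : 'I_(k + l) -> bool) (pi : 'I_(k + l) -> {poly K}) (kap : {poly K}).
Variables (t Gam : int -> K) (f : 'I_(k + l) -> int -> K) (L : tridiag K).
Local Notation p := (k + l)%N.
Local Notation F := (fser a s).
Hypothesis a_generic : forall t : nat, a + 1 + t%:R != 0.
Hypothesis sE : s = a + b + 1.
Hypothesis rpi : forall i, refl s (pi i) = pi i.
Hypothesis rkap : refl s kap = kap.
Hypothesis kap0 : kap != 0.
Hypothesis qn0 : forall n : int, n%:~R + e + s + 1 - bt != 0.
Hypothesis t0 : forall n, t n != 0.
Hypothesis tS : forall n, t (n + 1) * (n%:~R + e + s + 1 - bt) = - (t n * (n%:~R + e + bt)).
Hypothesis Gam0 : forall n, Gam n != 0.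
Hypothesis fE : forall i n,
  f i n = Gam n * ((if pl i then 1 else t n) * (pi i).[n%:~R + e]).
Hypothesis Cu : ratfun e (fun n => coef_up L n * Gam (n + 1) / Gam n).
Hypothesis Cm : ratfun e (coef_mid L).
Hypothesis Cd : ratfun e (fun n => coef_down L n * Gam (n - 1) / Gam n).
Hypothesis LF : forall i n,
  tridiag_app L (fun n => Gam n * (kap * F i).[n%:~R + e]) n =
  Gam n * (kap * F i - 2 *: (kap * F (i - 1))).[n%:~R + e].
Hypothesis Lf : forall i,
  iter k (Lsub L 1) (iter l (Lsub L (-1)) (f i)) = (fun=> 0).
Hypothesis caso0 : forall n, caso f n != 0.

(** [u] is x^m0 times the polynomial determinant; m0 stands for the power of (1 - z) / 2 in front of
    the Jacobi function when alpha is a negative integer. The operator found for the determinant is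
    conjugated by this power. *)
Theorem bispectral_formal : exists (u : int -> {poly K}) (eta : int -> K),
  [/\ forall i, i < 0 -> u i = 0, u <> (fun=> 0), forall n, eta n != 0,
    forall i n, wronsk f (fun n => Gam n * (kap * F (i - m0%:Z)).[n%:~R + e]) n =
      eta n * (u i).[n%:~R + e] &
    exists w c d (theta : {poly K}), (1 < size theta)%N /\
      act w u = smul theta (pmul ('X^c * xfac K k l ^+ d) u)].
Proof.
pose u := useries s bt pl pi kap F.
have rF : refls s F = F := refls_fser a s.
have [eta [eta0 Heta]] := wronsk_pol qn0 t0 tS Gam0 fE.
pose vc := pol_coef s bt pl pi.
(* Tested on the indicator of n divided by [Gam], the operator shows only its top coefficient, and
   the left side becomes the Casorati determinant at n. *)
have top0 (n : int) : (vc p).[n%:~R + e] != 0.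
  have := Heta (fun x => (x == n)%:R / Gam x) n.
  rewrite wronskE /opsum !big_ord_recr /= big1 => [|j _]; last first.
    rewrite [_ == n](_ : _ = false) ?mul0r ?mulr0 //; have := ltn_ord j; lia.
  rewrite [X in eta n * (X + _)]big1 => [|j _]; last first.
    rewrite [_ == n](_ : _ = false) ?mul0r ?mulr0 //; have := ltn_ord j; lia.
  rewrite !add0r subrK eqxx wcoef_top mul1r mulfV // mulr1 => E.
  by apply: contraNneq (caso0 n) => H; rewrite E H mul0r mulr0.
have f0 := xfac_neq0 k l.
have uF : span u (pmul (xfac K k l) F).
  have Eu : u = fun i => \sum_(j < p.+1) vc j * sh (j%:Z - p%:Z) (kap * F i).
    by apply/funext => i; rewrite /u /useries pol_detE.
  rewrite Eu; pose h i n := (if pl i then 1 else t n) * (pi i).[n%:~R + e].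
  have fh i : f i = fun n => Gam n * h i n by apply/funext => n; rewrite fE.
  apply: (span_by_division top0 (isop_Xhat Cu Cm Cd k l) (h := h)) => //.
  - move=> i n; have := Heta (h i) n; rewrite -fh wronsk_kernel => /esym/eqP.
    by rewrite mulf_eq0 (negbTE (eta0 n)) => /eqP.
  - move=> i n; apply: (mulfI (Gam0 n)); rewrite (Gam_Xhat L Gam0) mulr0.
    by rewrite -fh Lf.
  - move=> n r Hr j jp.
    have /eqP : r j / Gam (n - p%:Z + j%:Z) = 0.
      apply: (@caso_kill _ _ f (fun j => r j / Gam (n - p%:Z + j%:Z)) n (caso0 n)) => // i.
      rewrite -[RHS](Hr i); apply: eq_bigr => x _; rewrite fh.
      by rewrite mulrA mulfVK.
    by rewrite mulf_eq0 invr_eq0 (negbTE (Gam0 _)) orbF => /eqP.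
  - move=> i n; rewrite (Xhat_series Gam0 (v := smul kap F) k l).
      by rewrite pmul_smul.
    exact: LF.
have Fu : span F u := span_useries s bt pl pi kap F.
have [A [B [A0 B0 HAB]]] := useries_refl bt pl rpi rkap rF.
have [w [c [d [theta [th E]]]]] :=
  bispectral_twisted a_generic sE f0 A0 B0 HAB Fu uF.
have [M [w' Hw']] := act_conj_pmul ('X^m0) w.
have XuE i : pmul 'X^m0 u i = u (i - m0%:Z).
  elim: m0 i {Hw'} => [|m IH] i; first by rewrite expr0 pmul1 subr0.
  by rewrite exprSr pmulMX IH; congr u; lia.
have uneg i : i < 0 -> u i = 0.
  move=> i0; rewrite /u /useries pol_detE big1 // => j _.
  by rewrite fser_neg // mulr0 /sh comp_poly0 mulr0.
exists (pmul 'X^m0 u), eta; split=> //.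
- by move=> i i0; rewrite XuE uneg //; lia.
- move=> H; have u0 : u = (fun=> 0).
    apply/funext => i; have := congr1 (fun g => g (i + m0%:Z)) H.
    by rewrite XuE addrK.
  have [a0 fa0 fmin] := lowest_coef f0.
  have /(congr1 (fun f => f (0 + a0%:Z))) := span0 u0 uF.
  rewrite (pmul_lowest (i0 := 0) _ fmin) ?fser0 => [/eqP|i]; last exact: fser_neg.
  by rewrite scaler_eq0 (negbTE fa0) oner_eq0.
- move=> i n; rewrite Heta XuE /u /useries pol_detE /opsum horner_sum.
  congr (_ * _); apply: eq_bigr => j _; rewrite [in RHS]hornerM sh_horner.
  by congr (_ * _.[_]); rewrite !(intrD, intrN); ring.
exists w', (m0 * M + c)%N, d, theta; split=> //.
rewrite Hw' E pmul_smul -!pmulM; congr (smul _ (pmul _ _)).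
by rewrite exprSr exprD exprM; ring.
Qed.

End FormalTheorem.

(** * Jacobi operators *)

Section Pochhammer.
Variable K : numFieldType.
Implicit Types (x a b s e N : K) (n : int).

Lemma nonintD x n : ~ isint x -> x + n%:~R != 0.
Proof.
move=> Hx; apply/eqP => h; apply: Hx; exists (- n).
by rewrite intrN; apply/eqP; rewrite -addr_eq0 h.
Qed.

Lemma isintD x y : isint x -> isint y -> isint (x + y).
Proof. by move=> [m ->] [n ->]; exists (m + n); rewrite intrD. Qed.

Lemma isintN x : isint x -> isint (- x).
Proof. by move=> [m ->]; exists (- m); rewrite intrN. Qed.

Lemma nonintDr x y : ~ isint x -> isint y -> ~ isint (x + y).
Proof.
by move=> Hx Hy H; apply: Hx; rewrite -[x](addrK y); apply: isintD H (isintN Hy).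
Qed.

Lemma int_ind_iff (P : int -> Prop) : P 0 -> (forall n, P n <-> P (n + 1)) ->
  forall n, P n.
Proof.
move=> P0 H; case=> n.
  elim: n => // n IH; have -> : n.+1%:Z = n%:Z + 1 by lia.
  exact: (proj1 (H _) IH).
elim: n => [|n IH]; apply: (proj2 (H _)).
  by have -> : Negz 0 + 1 = 0 by lia.
by have -> : Negz n.+1 + 1 = Negz n by lia.
Qed.

Lemma poch0 x : poch x 0 = 1. Proof. exact: big_ord0. Qed.

Lemma pochS x n : ~ isint x -> poch x (n + 1) = poch x n * (x + n%:~R).
Proof.
move=> Hx; case: n => [m|m].
  have -> : m%:Z + 1 = m.+1%:Z by lia.
  by rewrite /poch big_ord_recr /= -pmulrn.
have Hm : x - m.+1%:R != 0 by have := nonintD (- m.+1%:Z) Hx; rewrite intrN -pmulrn.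
have -> : x + (Negz m)%:~R = x - m.+1%:R by rewrite NegzE intrN -pmulrn.
have -> : poch x (Negz m) = (\prod_(i < m) (x - i.+1%:R))^-1 * (x - m.+1%:R)^-1.
  by rewrite /poch big_ord_recr /= invfM mulrC.
rewrite mulfVK //; case: m {Hm} => [|m].
  by rewrite (_ : Negz 0 + 1 = 0) // poch0 big_ord0 invr1.
by have -> : Negz m.+1 + 1 = Negz m by lia.
Qed.

Lemma poch_neq0 x n : ~ isint x -> poch x n != 0.
Proof.
move=> Hx; case: n => m; rewrite /poch ?invr_eq0; apply/prodf_neq0 => i _.
  by have := nonintD i%:Z Hx; rewrite -pmulrn.
by have := nonintD (- i.+1%:Z) Hx; rewrite intrN -pmulrn.
Qed.

Lemma rise_shift x (a : nat) : poch (x + 1) a * x = poch x a * (x + a%:R).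
Proof.
elim: a => [|a IH]; first by rewrite /poch !big_ord0 addr0.
rewrite /poch !big_ord_recr /= -/(poch (x + 1) a) -/(poch x a) mulrAC IH -natr1.
ring.
Qed.

(** Both sides are Gamma(x + a + n) / Gamma(x). *)
Lemma poch_rise x (a : nat) n : ~ isint x ->
  poch (x + a%:R) n * poch x a = poch x n * poch (x + n%:~R) a.
Proof.
move=> Hx; have Ha : ~ isint (x + a%:R) by apply: nonintDr => //; exists a%:Z; rewrite -pmulrn.
elim/int_ind_iff: n => [|n]; first by rewrite !poch0 addr0 !mul1r.
rewrite !pochS // intrD addrA.
have h1 : x + n%:~R != 0 := nonintD n Hx.
have h2 : x + a%:R + n%:~R != 0 := nonintD n Ha.
have R := rise_shift (x + n%:~R) a.
split=> H; [apply: (mulfI h1)|apply: (mulfI h2)].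
  transitivity ((x + n%:~R) * (x + a%:R + n%:~R) * (poch (x + a%:R) n * poch x a)); first by ring.
  rewrite H; transitivity (poch x n * (x + n%:~R) * (poch (x + n%:~R + 1) a * (x + n%:~R))); last by ring.
  by rewrite R; ring.
apply: (mulfI h1).
transitivity ((x + n%:~R) * (poch (x + a%:R) n * (x + a%:R + n%:~R) * poch x a)); first by ring.
rewrite H; transitivity ((poch x n * (x + n%:~R)) * (poch (x + n%:~R + 1) a * (x + n%:~R))); first by ring.
by rewrite R; ring.
Qed.

Lemma hcoef_poch a s N (i : nat) :
  poch (- N) i * poch (N + s) i / (poch (a + 1) i * i`!%:R) = hcoef a s N i.
Proof.
rewrite fact_prod natr_prod big_add1 big_mkord /poch /hcoef -!big_split -prodfV -big_split.
by apply: eq_bigr => t _ /=; congr (_ / _); ring.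
Qed.

(** The factor in front of the functions φ at z = 1. With a = -alpha and e = eps + alpha + beta it
    is the factor in front of ψ. *)
Definition gauge a e n : K := poch (e + a + 1) n / poch (e + 1) n.

Lemma nonint1 x : ~ isint x -> ~ isint (x + 1).
Proof. by move=> Hx; apply: nonintDr => //; exists 1. Qed.

Lemma gauge_neq0 a e n : ~ isint e -> ~ isint (e + a) -> gauge a e n != 0.
Proof. by move=> H1 H2; rewrite mulf_neq0 ?invr_eq0 ?poch_neq0 //; exact: nonint1. Qed.

Lemma gaugeS a e n : ~ isint e -> ~ isint (e + a) ->
  gauge a e (n + 1) = gauge a e n * ((n%:~R + e + a + 1) / (n%:~R + e + 1)).
Proof.
move=> H1 H2; have H1' := nonint1 H1; have H2' := nonint1 H2.
rewrite /gauge !pochS //.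
have h1 := nonintD n H1'; have h2 := poch_neq0 n H1'.
have h3 : n%:~R + e + 1 != 0 by apply: contraNneq h1 => E; rewrite -E; apply/eqP; ring.
have -> : e + a + 1 + n%:~R = n%:~R + e + a + 1 by ring.
have -> : e + 1 + n%:~R = n%:~R + e + 1 by ring.
by field; rewrite h2 h3.
Qed.

Lemma gaugeB a e n : ~ isint e -> ~ isint (e + a) ->
  gauge a e (n - 1) = gauge a e n * ((n%:~R + e) / (n%:~R + e + a)).
Proof.
move=> H1 H2; rewrite -{2}[n](subrK 1) gaugeS // intrB.
have h1 : n%:~R + e != 0 by rewrite addrC nonintD.
have h2 : n%:~R + e + a != 0 by rewrite -addrA addrC nonintD.
have -> : n%:~R - 1%:~R + e + a + 1 = n%:~R + e + a by ring.
have -> : n%:~R - 1%:~R + e + 1 = n%:~R + e by ring.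
by field; rewrite h1 h2.
Qed.

Definition chcoef a b e (i : int) n := hcoef a (a + b + 1) (n%:~R + e) i.

(** Only the ratios g(n + 1) / g(n) and g(n - 1) / g(n) enter, so one computation serves both forms
    of the Jacobi function. The condition on a stops at i because for a negative integer alpha only
    finitely many coefficients are defined. *)
Lemma tridiag_hcoef (L : tridiag K) (g : int -> K) a b e n (i : nat)
    (N := n%:~R + e) (y := 2 * N + a + b + 1) :
  (forall t, (t < i)%N -> a + 1 + t%:R != 0) ->
  y != 0 -> y + 1 != 0 -> y - 1 != 0 ->
  coef_up L n * g (n + 1) = 2 * (N + a + 1) * (N + a + b + 1) / (y * (y + 1)) * g n ->
  coef_mid L n = (b ^+ 2 - a ^+ 2) / ((y - 1) * (y + 1)) ->
  coef_down L n * g (n - 1) = 2 * N * (N + b) / ((y - 1) * y) * g n ->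
  tridiag_app L (fun n => g n * chcoef a b e i n) n =
  g n * (chcoef a b e i n - 2 * chcoef a b e (i%:Z - 1) n).
Proof.
move=> Ha y0 yp ym Hu Hm Hd.
rewrite /tridiag_app Hm !mulrA Hu Hd /chcoef intrD intrB.
have -> : n%:~R + 1%:~R + e = N + 1 by rewrite /N; ring.
have -> : n%:~R - 1%:~R + e = N - 1 by rewrite /N; ring.
have [H _] := hcoef_shift b N Ha.
set F := hcoef _ _ N i in H *; set F1 := hcoef _ _ (N + 1) i in H *.
set F2 := hcoef _ _ (N - 1) i in H *; set F3 := hcoef _ _ N (_ - 1) in H *.
have yE : 2 * N + (a + b + 1) = y by rewrite /y; ring.
have c0 : y * (y - 1) * (y + 1) != 0 by rewrite !mulf_neq0.
apply: (mulfI c0).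
rewrite !yE in H.
transitivity (g n * ((y - 1) * (2 * (N + a + 1) * (N + (a + b + 1))) * F1 +
   (y + 1) * (2 * N * (N + b)) * F2 + y * (b ^+ 2 - a ^+ 2) * F)).
  by rewrite /N; field; rewrite y0 yp ym.
by rewrite H; ring.
Qed.

Section Jacobi.
Variables (alpha beta eps : K).
Hypothesis e_nonint : ~ isint eps.
Hypothesis ea_nonint : ~ isint (eps + alpha).
Hypothesis eab_nonint : ~ isint (2 * eps + alpha + beta).
Let L := jacobi_op alpha beta eps.
Let y n := 2 * (n%:~R + eps) + alpha + beta + 1.

Lemma y_neq0 n : [/\ y n != 0, y n + 1 != 0 & y n - 1 != 0].
Proof.
have H (c : int) : 2 * (n%:~R + eps) + alpha + beta + c%:~R != 0.
  have := nonintD (2 * n + c) eab_nonint; rewrite intrD intrM => h.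
  by apply: contraNneq h => E; rewrite -E; apply/eqP; ring.
split; [have := H 1|have := H 2|have := H 0] => h;
  by apply: contraNneq h => E; rewrite -E /y; apply/eqP; ring.
Qed.

Lemma N_neq0 n : n%:~R + eps != 0.
Proof. by rewrite addrC nonintD. Qed.

Lemma N1_neq0 n : n%:~R + eps + 1 != 0.
Proof. by have := N_neq0 (n + 1); rewrite intrD addrAC. Qed.

Lemma Na_neq0 n : n%:~R + eps + alpha != 0.
Proof. by rewrite -addrA addrC nonintD. Qed.

Lemma Na1_neq0 n : n%:~R + eps + alpha + 1 != 0.
Proof. by have := Na_neq0 (n + 1); rewrite intrD -!addrA [1%:~R + _]addrC !addrA. Qed.

Lemma jacobi_gauge n (i : nat) : (forall t, (t < i)%N -> alpha + 1 + t%:R != 0) ->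
  tridiag_app L (fun n => gauge alpha eps n * chcoef alpha beta eps i n) n =
  gauge alpha eps n * (chcoef alpha beta eps i n - 2 * chcoef alpha beta eps (i%:Z - 1) n).
Proof.
have [y0 y1 y2] := y_neq0 n; have h1 := N1_neq0 n; have h2 := Na_neq0 n.
move=> Ha; apply: tridiag_hcoef => //.
- rewrite /L /= gaugeS // (_ : _ + beta + 2 = y n + 1); last by rewrite /y; ring.
  by rewrite -/(y n); field; rewrite h1 y0 y1.
- rewrite /L /= (_ : _ + beta + 2 = y n + 1); last by rewrite /y; ring.
  by rewrite -/(y n) [_ + beta](_ : _ = y n - 1) //; rewrite /y; ring.
- rewrite /L /= gaugeB // -/(y n) [X in _ / (X * _)](_ : _ = y n - 1); last by rewrite /y; ring.
  by field; rewrite h2 y0 y2.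
Qed.

End Jacobi.
End Pochhammer.
Arguments hcoef : simpl never.
Arguments chcoef : simpl never.

(** * Functions of n that are invariant under the reflection *)

Section Invariants.
Variable K : numFieldType.
Implicit Types (s e c : K) (g : int -> K).

Definition invfun s e g := exists P : {poly K}, refl s P = P /\
  forall n : int, g n = P.[n%:~R + e].

Lemma invfun_cst s e c : invfun s e (fun=> c).
Proof. by exists c%:P; split=> [|n]; rewrite ?hornerC // /refl comp_polyC. Qed.

Lemma invfunD s e g h : invfun s e g -> invfun s e h -> invfun s e (fun n => g n + h n).
Proof.
move=> [P [rP HP]] [Q [rQ HQ]]; exists (P + Q); split=> [|n]; first by rewrite reflD rP rQ.
by rewrite HP HQ hornerD.
Qed.

Lemma invfunM s e g h : invfun s e g -> invfun s e h -> invfun s e (fun n => g n * h n).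
Proof.
move=> [P [rP HP]] [Q [rQ HQ]]; exists (P * Q); split=> [|n]; first by rewrite reflM rP rQ.
by rewrite HP HQ hornerM.
Qed.

Lemma invfun_ext s e g h : g =1 h -> invfun s e g -> invfun s e h.
Proof. by move=> /funext ->. Qed.

Lemma invfun_sum s e (m : nat) (pr : pred 'I_m) (g : 'I_m -> int -> K) :
  (forall r, pr r -> invfun s e (g r)) -> invfun s e (fun n => \sum_(r < m | pr r) g r n).
Proof.
move=> H; pose P r := if pselect (pr r) is left h then sval (cid (H r h)) else 0.
have HP r : pr r -> refl s (P r) = P r /\ forall n : int, g r n = (P r).[n%:~R + e].
  move=> h; rewrite /P; case: pselect => [h'|//].
  exact: (svalP (cid (H r h'))).
exists (\sum_(r < m) if pr r then P r else 0); split=> [|n].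
  rewrite refl_sum; apply: eq_bigr => r _; case: ifP => [/HP[]//|_].
  by rewrite /refl comp_poly0.
rewrite horner_sum [LHS]big_mkcond; apply: eq_bigr => r _.
by case: ifP => [/HP[_ ->]//|_]; rewrite horner0.
Qed.

Lemma invfun_prod s e (m : nat) (g : nat -> int -> K) :
  (forall r, (r < m)%N -> invfun s e (g r)) -> invfun s e (fun n => \prod_(r < m) g r n).
Proof.
elim: m => [|m IH] H; first by apply: invfun_ext (invfun_cst s e 1) => n; rewrite big_ord0.
apply: (@invfun_ext _ _ (fun n => (\prod_(r < m) g r n) * g m n)).
  by move=> n; rewrite big_ord_recr.
by apply: invfunM (H _ (ltnSn m)); apply: IH => r hr; apply: H; apply: ltnW.
Qed.

Lemma invfun_quad s e c : invfun s e (fun n => (n%:~R + e + c) * (n%:~R + e + s - c)).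
Proof.
exists (('X + c%:P) * ('X + (s - c)%:P)); split=> [|n]; last by rewrite !hornerE /=; ring.
by apply: poly_eq => x; rewrite refl_horner !hornerE /=; ring.
Qed.

(** The reflection of n is the same; only the variable n + e is replaced by n + e + c. *)
Lemma invfun_recenter s e c g s' e' : s' = s - 2 * c -> e' = e + c ->
  invfun s e g -> invfun s' e' g.
Proof.
move=> -> -> [P [rP HP]]; exists (P \Po ('X - c%:P)); split=> [|n].
  apply: poly_eq => x; rewrite refl_horner !horner_comp !hornerE /=.
  by rewrite -[in RHS]rP refl_horner; congr (_.[_]); ring.
by rewrite HP horner_comp !hornerE /=; congr (_.[_]); ring.
Qed.

Lemma invfun_chcoef s e c a b e' (i : int) : a + b + 1 = s - 2 * c -> e' = e + c ->
  invfun s e (chcoef a b e' i).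
Proof.
rewrite /chcoef => -> ->; case: i => [m|m]; last exact: invfun_cst.
apply: (@invfun_prod s e m (fun t n => (t%:R * (t%:R + (s - 2 * c)) -
   (n%:~R + (e + c)) * (n%:~R + (e + c) + (s - 2 * c))) / ((a + 1 + t%:R) * t.+1%:R))) => t _.
apply: invfunM; last exact: invfun_cst.
apply: invfunD; first exact: invfun_cst.
apply: invfun_ext (invfunM (invfun_cst s e (-1)) (invfun_quad s e c)) => n; ring.
Qed.

(** Up to sign, the reflection exchanges factor r of the first product with factor a - 1 - r of the
    second; the signs cancel in pairs. *)
Lemma invfun_rise s e x y (a : nat) : x - e + (y - e) + a%:R - 1 = s ->
  invfun s e (fun n => poch (x + n%:~R) a * poch (y + n%:~R) a).
Proof.
move=> H; pose g r (n : int) : K := (n%:~R + e + (x - e + r%:R)) * (n%:~R + e + s - (x - e + r%:R)).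
apply: (@invfun_ext _ _ (fun n => \prod_(r < a) g r n)); last first.
  by apply: (@invfun_prod _ _ a g) => r _; apply: invfun_quad.
move=> n; rewrite /g big_split; congr (_ * _); rewrite /poch.
  by apply: eq_bigr => r _; ring.
rewrite (reindex_inj rev_ord_inj) /=; apply: eq_bigr => r _.
by rewrite -H natrB ?ltn_ord // -natr1; ring.
Qed.

Lemma ratfun_recenter e c e' g : e' = e + c -> ratfun e g -> ratfun e' g.
Proof.
move=> -> [P [Q [Q0 H]]]; exists (P \Po ('X - c%:P)), (Q \Po ('X - c%:P)).
have E (n : int) : ('X - c%:P).[n%:~R + (e + c)] = n%:~R + e by rewrite !hornerE /=; ring.
by split=> n; rewrite !horner_comp E.
Qed.

Lemma invfun_ratfun s e g : invfun s e g -> ratfun e g.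
Proof.
move=> [P [_ HP]]; have [Q [Q' [H1 H2]]] := ratfun_poly e P.
by exists Q, Q'; split=> // n; rewrite HP.
Qed.

(* The only place where integrality of alpha enters: both families of kernel
   functions at z = 1 then have the same gauge up to rational functions. *)
Lemma gauge_ratio (alpha beta eps : K) : isint alpha ->
  ~ isint eps -> ~ isint (eps + beta) ->
  exists k1 k2 : int -> K, let s := alpha + beta + 1 in
  [/\ invfun s eps k1, invfun s eps k2, forall n, k1 n != 0, forall n, k2 n != 0 &
   forall n, gauge (- alpha) (eps + alpha + beta) n * k1 n = gauge alpha eps n * k2 n].
Proof.
move=> [m mE] He Heb; have Hb1 := nonint1 Heb; have He1 := nonint1 He.
have Hm (x : K) : ~ isint x -> ~ isint (x + m%:~R).
  by move=> ?; apply: nonintDr => //; exists m.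
have rise0 (x : K) (a : nat) (n : int) : ~ isint x -> poch (x + n%:~R) a != 0.
  by move=> Hx; apply/poch_neq0/(nonintDr Hx); exists n.
case: m mE Hm => [a|a] mE Hm.
  (* For alpha = a >= 0 the two gauges are constant multiples of (eps + 1 + n)_a and of the inverse
     of (eps + beta + 1 + n)_a. Their quotient is r(n) / r(0), invariant by [invfun_rise]; for
     negative alpha the quotient is inverted. *)
  pose r (n : int) := poch (eps + 1 + n%:~R) a * poch (eps + beta + 1 + n%:~R) a.
  exists r, (fun=> r 0); rewrite mE -pmulrn; split.
  - by apply: invfun_rise; ring.
  - exact: invfun_cst.
  - by move=> n; rewrite mulf_neq0 ?rise0.
  - by move=> n; rewrite mulf_neq0 ?rise0.
  move=> n; have E1 := poch_rise a n He1; have E2 := poch_rise a n Hb1.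
  have p1 := poch_neq0 n He1; have p2 := poch_neq0 n (Hm _ Hb1).
  rewrite -pmulrn in p2; rewrite /gauge /r !addr0.
  have -> : eps + a%:R + beta + - a%:R + 1 = eps + beta + 1 by ring.
  have -> : eps + a%:R + beta + 1 = eps + beta + 1 + a%:R by ring.
  have -> : eps + a%:R + 1 = eps + 1 + a%:R by ring.
  apply: (mulfI p1); apply: (mulfI p2).
  transitivity ((poch (eps + 1) n * poch (eps + 1 + n%:~R) a) *
    (poch (eps + beta + 1) n * poch (eps + beta + 1 + n%:~R) a)); first by field.
  by rewrite -E1 -E2; field.
have aE : alpha = - a.+1%:R by rewrite mE NegzE intrN -pmulrn.
pose x := eps + 1 - a.+1%:R; pose y := eps + beta + 1 - a.+1%:R.
have Hx : ~ isint x.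
  have := Hm _ He1; congr (~ isint _); by rewrite /x -mE aE.
have Hy : ~ isint y.
  have := Hm _ Hb1; congr (~ isint _); by rewrite /y -mE aE.
pose r (n : int) := poch (x + n%:~R) a.+1 * poch (y + n%:~R) a.+1.
exists (fun=> r 0), r; split.
- exact: invfun_cst.
- by apply: invfun_rise; rewrite aE /x /y; ring.
- by move=> n; rewrite mulf_neq0 ?rise0.
- by move=> n; rewrite mulf_neq0 ?rise0.
move=> n; have E1 := poch_rise a.+1 n Hx; have E2 := poch_rise a.+1 n Hy.
have p1 := poch_neq0 n He1; have p2 := poch_neq0 n Hy.
rewrite /gauge /r !addr0 aE.
have -> : eps + - a.+1%:R + beta + - - a.+1%:R + 1 = y + a.+1%:R by rewrite /y; ring.
have -> : eps + - a.+1%:R + beta + 1 = y by rewrite /y; ring.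
have -> : eps + - a.+1%:R + 1 = x by rewrite /x; ring.
have ex : eps + 1 = x + a.+1%:R by rewrite /x; ring.
rewrite ex in p1 *.
apply: (mulfI p1); apply: (mulfI p2).
transitivity ((poch (x + a.+1%:R) n * poch x a.+1) * (poch (y + a.+1%:R) n * poch y a.+1)); first by field.
by rewrite E1 E2; field.
Qed.

End Invariants.

(** * Recurrences of the kernel functions *)

Section JacobiKernel.
Variable K : numFieldType.
Implicit Types (alpha beta eps : K).

Lemma phi_plusE alpha beta eps i n : phi_plus alpha beta eps i n =
  gauge alpha eps n * ((- 2)^-1 ^+ i * chcoef alpha beta eps i n).
Proof.
rewrite /phi_plus /chcoef -hcoef_poch /gauge; congr (_ * _).
rewrite exprVn !invfM (_ : n%:~R + eps + (alpha + beta + 1) = n%:~R + eps + alpha + beta + 1); last by ring.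
set u := poch _ i; set v := poch _ i; set w := _^-1; set x := _^-1; set z := _^-1; ring.
Qed.

Lemma psi_plusE alpha beta eps :
  psi_plus alpha beta eps = phi_plus (- alpha) (- beta) (eps + alpha + beta).
Proof.
apply/funext => i; apply/funext => n; rewrite /psi_plus /phi_plus.
by congr (poch _ _ / poch _ _ * (poch _ _ * poch _ _ / _)); ring.
Qed.

Lemma phi_minusE alpha beta eps i n :
  phi_minus alpha beta eps i n = (-1) ^ n * ((-1) ^+ i * phi_plus beta alpha eps i n).
Proof.
rewrite /phi_minus /phi_plus.
have -> : n%:~R + eps + beta + alpha + 1 = n%:~R + eps + alpha + beta + 1 by ring.
have -> : (- 2 : K) ^+ i = (-1) ^+ i * 2 ^+ i by rewrite -exprMn mulN1r.
have sq : (-1) ^+ i * ((-1) ^+ i)^-1 = 1 :> K by rewrite mulfV // signr_eq0.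
rewrite !invfM.
set u := poch _ i; set v := poch _ i; set w := poch _ n; set x := (poch _ n)^-1.
set p2 := (2 ^+ i)^-1; set q := (i`!%:R)^-1; set r := (poch _ i)^-1.
transitivity ((-1) ^ n * w * x * (u * v * (p2 * q * r)) * ((-1) ^+ i * ((-1) ^+ i)^-1)).
  by rewrite sq mulr1.
by move: ((-1) ^ n) ((-1) ^+ i) (((-1) ^+ i)^-1) => c1 c2 c3; ring.
Qed.

Lemma psi_minusE alpha beta eps :
  psi_minus alpha beta eps = phi_minus (- alpha) (- beta) (eps + alpha + beta).
Proof.
apply/funext => i; apply/funext => n; rewrite /psi_minus /phi_minus.
by congr (_ * poch _ _ / poch _ _ * (poch _ _ * poch _ _ / _)); ring.
Qed.

(** This symmetry exchanges φ and ψ, so every fact about φ yields the one about ψ. *)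
Lemma jacobi_op_dual alpha beta eps :
  jacobi_op (- alpha) (- beta) (eps + alpha + beta) = jacobi_op alpha beta eps.
Proof.
congr Tridiag; apply/funext => n /=.
- by congr (_ / (_ * _)); ring.
- by congr (_ / (_ * _)); ring.
- by congr (_ / (_ * _)); ring.
Qed.

(** Conjugation by (-1)^n corresponds to z -> -z and exchanges the end points 1 and -1. *)
Lemma jacobi_op_swap alpha beta eps (g : int -> K) n :
  tridiag_app (jacobi_op alpha beta eps) (fun n => (-1) ^ n * g n) n =
  - ((-1) ^ n * tridiag_app (jacobi_op beta alpha eps) g n).
Proof.
have u1 : (-1 : K) \is a GRing.unit by rewrite unitrN unitr1.
rewrite /tridiag_app !exprzDr // expr1z (_ : (-1 : K) ^ (-1) = -1); last exact: invrN1.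
rewrite /= (addrAC _ alpha beta) (_ : alpha ^+ 2 - beta ^+ 2 = - (beta ^+ 2 - alpha ^+ 2)); last by ring.
by rewrite (mulrAC 2 _ _) !(addrAC _ alpha beta); ring.
Qed.

Definition prev (h : nat -> int -> K) i n : K := if i is j.+1 then h j n else 0.

(** Formally, φ^(i) is the coefficient of (z - 1)^i in an eigenfunction with eigenvalue z = 1 + (z -
    1). *)
Lemma phi_plus_rec alpha beta eps i n :
  ~ isint eps -> ~ isint (eps + alpha) -> ~ isint (2 * eps + alpha + beta) ->
  (forall t, (t < i)%N -> alpha + 1 + t%:R != 0) ->
  tridiag_app (jacobi_op alpha beta eps) (phi_plus alpha beta eps i) n =
  phi_plus alpha beta eps i n + prev (phi_plus alpha beta eps) i n.
Proof.
move=> He Hea Heab Ha; have := jacobi_gauge He Hea Heab n Ha => H.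
transitivity ((- 2)^-1 ^+ i * tridiag_app (jacobi_op alpha beta eps)
    (fun n => gauge alpha eps n * chcoef alpha beta eps i n) n).
  by rewrite /tridiag_app !phi_plusE; ring.
rewrite H phi_plusE; case: i {Ha H} => [|i] /=.
  by rewrite (_ : chcoef _ _ _ (0%N%:Z - 1) n = 0) //; ring.
rewrite phi_plusE (_ : i.+1%:Z - 1 = i); last by lia.
rewrite exprS; move: ((- 2)^-1 ^+ i) => c.
have n2 : (2 : K) != 0 by rewrite pnatr_eq0.
by field.
Qed.

Lemma phi_minus_rec alpha beta eps i n :
  ~ isint eps -> ~ isint (eps + beta) -> ~ isint (2 * eps + alpha + beta) ->
  (forall t, (t < i)%N -> beta + 1 + t%:R != 0) ->
  tridiag_app (jacobi_op alpha beta eps) (phi_minus alpha beta eps i) n =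
  - phi_minus alpha beta eps i n + prev (phi_minus alpha beta eps) i n.
Proof.
move=> He Heb Heab Hb.
have -> : phi_minus alpha beta eps i = fun n => (-1) ^ n * ((-1) ^+ i * phi_plus beta alpha eps i n).
  by apply/funext => x; rewrite phi_minusE.
rewrite jacobi_op_swap.
have -> : tridiag_app (jacobi_op beta alpha eps) (fun n => (-1) ^+ i * phi_plus beta alpha eps i n) n =
   (-1) ^+ i * tridiag_app (jacobi_op beta alpha eps) (phi_plus beta alpha eps i) n.
  by rewrite /tridiag_app; ring.
rewrite phi_plus_rec //; last by rewrite addrAC.
rewrite mulrDr mulrDr opprD; congr (_ + _).
case: i {Hb} => [|i] /=; first by rewrite !mulr0 oppr0.
by rewrite phi_minusE exprS; move: ((-1) ^+ i) ((-1) ^ n) => c1 c2; ring.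
Qed.

Definition kcomb k (A B : 'I_k -> K) (h h' : nat -> int -> K) (i : nat) (n : int) : K :=
  \sum_(r < k | (r <= i)%N) (A r * h (i - r)%N n + B r * h' (i - r)%N n).

Lemma kcomb_rec k (A B : 'I_k -> K) h h' (L : tridiag K) (c : K) i n :
  (forall j n, (j <= i)%N -> tridiag_app L (h j) n = c * h j n + prev h j n) ->
  (forall j n, (j <= i)%N -> tridiag_app L (h' j) n = c * h' j n + prev h' j n) ->
  tridiag_app L (kcomb A B h h' i) n =
  c * kcomb A B h h' i n + prev (kcomb A B h h') i n.
Proof.
move=> H H'.
transitivity (\sum_(r < k | (r <= i)%N)
   (A r * tridiag_app L (h (i - r)%N) n + B r * tridiag_app L (h' (i - r)%N) n)).
  rewrite /tridiag_app /kcomb !mulr_sumr -!big_split; apply: eq_bigr => r _ /=; ring.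
transitivity (\sum_(r < k | (r <= i)%N) (c * (A r * h (i - r)%N n + B r * h' (i - r)%N n) +
   (A r * prev h (i - r) n + B r * prev h' (i - r) n))).
  by apply: eq_bigr => r _; rewrite H ?H' ?leq_subr //; ring.
rewrite big_split -mulr_sumr; congr (_ + _).
case: i {H H'} => [|i] /=.
  by rewrite big1 // => r _; rewrite /= !mulr0 addr0.
rewrite /kcomb [LHS]big_mkcond [RHS]big_mkcond; apply: eq_bigr => r _.
have [le|gt] := leqP r i; first by rewrite leqW // subSn.
case: ifP => // le; have -> : (i.+1 - r = 0)%N by lia.
by rewrite /= !mulr0 addr0.
Qed.

Lemma kernel_funE alpha beta eps k l (A B : 'I_k -> K) (C D : 'I_l -> K) i n :
  kernel_fun alpha beta eps A B C D i n =
  match fintype.split i with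
  | inl i' => kcomb A B (phi_plus alpha beta eps) (psi_plus alpha beta eps) i' n
  | inr i' => kcomb C D (phi_minus alpha beta eps) (psi_minus alpha beta eps) i' n
  end.
Proof. by []. Qed.

End JacobiKernel.

(** * The kernel is stable under L and annihilated by (L - 1)^k (L + 1)^l *)

Section JacobiData.
Variables (K : numFieldType) (alpha beta eps : K) (k l : nat).
Variables (A B : 'I_k -> K) (C D : 'I_l -> K).
Hypothesis e0 : ~ isint eps.
Hypothesis ea0 : ~ isint (eps + alpha).
Hypothesis eb0 : ~ isint (eps + beta).
Hypothesis eab0 : ~ isint (eps + alpha + beta).
Hypothesis eeab0 : ~ isint (2 * eps + alpha + beta).
Hypothesis k_alpha : forall t, (t.+1 < k)%N ->
  alpha + 1 + t%:R != 0 /\ - alpha + 1 + t%:R != 0.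
Hypothesis l_beta : forall t, (t.+1 < l)%N ->
  beta + 1 + t%:R != 0 /\ - beta + 1 + t%:R != 0.

Let L := jacobi_op alpha beta eps.
Let f := kernel_fun alpha beta eps A B C D.
Let gp := kcomb A B (phi_plus alpha beta eps) (psi_plus alpha beta eps).
Let gm := kcomb C D (phi_minus alpha beta eps) (psi_minus alpha beta eps).

Lemma dual_double : 2 * (eps + alpha + beta) + - alpha + - beta = 2 * eps + alpha + beta.
Proof. ring. Qed.

Lemma dual_alpha : eps + alpha + beta + - alpha = eps + beta.
Proof. ring. Qed.

Lemma dual_beta : eps + alpha + beta + - beta = eps + alpha.
Proof. ring. Qed.

Lemma gp_rec i n : (i < k)%N -> tridiag_app L (gp i) n = 1 * gp i n + prev gp i n.
Proof.
move=> ik; apply: kcomb_rec => j {}n ji; rewrite mul1r.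
  apply: phi_plus_rec => // t tj; exact: (proj1 (k_alpha (leq_ltn_trans (leq_trans tj ji) ik))).
rewrite psi_plusE /L -jacobi_op_dual; apply: phi_plus_rec => //.
- by rewrite dual_alpha.
- by rewrite dual_double.
- by move=> t tj; exact: (proj2 (k_alpha (leq_ltn_trans (leq_trans tj ji) ik))).
Qed.

Lemma gm_rec i n : (i < l)%N -> tridiag_app L (gm i) n = -1 * gm i n + prev gm i n.
Proof.
move=> il; apply: kcomb_rec => j {}n ji; rewrite mulN1r.
  apply: phi_minus_rec => // t tj; exact: (proj1 (l_beta (leq_ltn_trans (leq_trans tj ji) il))).
rewrite psi_minusE /L -jacobi_op_dual; apply: phi_minus_rec => //.
- by rewrite dual_beta.
- by rewrite dual_double.
- by move=> t tj; exact: (proj2 (l_beta (leq_ltn_trans (leq_trans tj ji) il))).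
Qed.

Lemma f_lshift (i : 'I_k) : f (lshift l i) = gp i.
Proof. by apply/funext => n; rewrite /f kernel_funE (unsplitK (inl i)). Qed.

Lemma f_rshift (i : 'I_l) : f (rshift k i) = gm i.
Proof. by apply/funext => n; rewrite /f kernel_funE (unsplitK (inr i)). Qed.

Lemma iter_Lsub_kernel i : iter k (Lsub L 1) (iter l (Lsub L (-1)) (f i)) = (fun=> 0).
Proof.
case: (split_ordP i) => j ->.
  rewrite f_lshift iter_Lsub_comm (iter_Lsub_chain (g := gp) (ltn_ord j)) ?iter_Lsub0 //.
    move=> i' hi'; apply/funext => n.
    by rewrite /Lsub gp_rec ?(leq_ltn_trans hi') // addrAC subrr add0r.
  apply/funext => n; rewrite /Lsub gp_rec; last by case: (k) j => // -[].
  by rewrite addrAC subrr add0r.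
rewrite f_rshift (iter_Lsub_chain (g := gm) (ltn_ord j)) ?iter_Lsub0 //.
  move=> i' hi'; apply/funext => n.
  by rewrite /Lsub gm_rec ?(leq_ltn_trans hi') // addrAC subrr add0r.
apply/funext => n; rewrite /Lsub gm_rec; last by case: (l) j => // -[].
by rewrite addrAC subrr add0r.
Qed.

Lemma wronsk0 n : wronsk f (fun=> 0) n = 0.
Proof. by rewrite wronskE; apply: big1 => j _; rewrite mulr0. Qed.

Lemma wronsk_L_kernel i n : wronsk f (tridiag_app L (f i)) n = 0.
Proof.
case: (split_ordP i) => j ->.
  have -> : tridiag_app L (f (lshift l j)) = fun n => 1 * f (lshift l j) n + prev gp j n.
    by apply/funext => x; rewrite f_lshift gp_rec.
  rewrite wronsk_lin wronsk_kernel mulr0 add0r.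
  case: j => -[|j] hj; first exact: wronsk0.
  by rewrite -[X in wronsk f X _]/(gp (Ordinal (ltnW hj))) -f_lshift wronsk_kernel.
have -> : tridiag_app L (f (rshift k j)) = fun n => -1 * f (rshift k j) n + prev gm j n.
  by apply/funext => x; rewrite f_rshift gm_rec.
rewrite wronsk_lin wronsk_kernel mulr0 add0r.
case: j => -[|j] hj; first exact: wronsk0.
by rewrite -[X in wronsk f X _]/(gm (Ordinal (ltnW hj))) -f_rshift wronsk_kernel.
Qed.

End JacobiData.

(** * Common gauge of the kernel functions and the Jacobi functions *)

Section JacobiFormal.
Variables (K : numFieldType) (alpha beta eps : K) (k l m : nat).
Variables (A B : 'I_k -> K) (C D : 'I_l -> K).
Hypothesis e0 : ~ isint eps.
Hypothesis ea0 : ~ isint (eps + alpha).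
Hypothesis eb0 : ~ isint (eps + beta).
Hypothesis eab0 : ~ isint (eps + alpha + beta).
Hypothesis eeab0 : ~ isint (2 * eps + alpha + beta).
Hypothesis k_alpha : forall t, (t.+1 < k)%N ->
  alpha + 1 + t%:R != 0 /\ - alpha + 1 + t%:R != 0.
Hypothesis l_beta : forall t, (t.+1 < l)%N ->
  beta + 1 + t%:R != 0 /\ - beta + 1 + t%:R != 0.
Hypothesis int_alpha : (0 < k)%N -> isint alpha.
Hypothesis int_beta : (0 < l)%N -> isint beta.
Hypothesis m_pos : (0 < m)%N -> alpha = - m%:R.
Hypothesis m_zero : m = 0%N -> forall t : nat, alpha + 1 + t%:R != 0.
Hypothesis adm : admissible alpha beta eps A B C D.

Let L := jacobi_op alpha beta eps.
Let f := kernel_fun alpha beta eps A B C D.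
Let s := alpha + beta + 1.
Let g1 := gauge alpha eps.
Let g2 := gauge (- alpha) (eps + alpha + beta).
Let g3 := gauge beta eps.
Let g4 := gauge (- beta) (eps + alpha + beta).

Definition pcst : K :=
  (-1) ^+ m / (m.-1)`!%:R * (poch (- eps) m * poch (eps + alpha + beta + 1) m / m`!%:R).

(* The coefficient of ((1 - z) / 2)^i in the Jacobi function. *)
Definition pser (n i : int) : K :=
  if m == 0%N then g1 n * chcoef alpha beta eps i n
  else pcst * g2 n * chcoef (- alpha) beta (eps + alpha) (i - m%:Z) n.

Lemma pcst_neq0 : pcst != 0.
Proof.
rewrite /pcst !mulf_neq0 ?invr_eq0 ?pnatr_eq0 ?signr_eq0 -?lt0n ?fact_gt0 //; apply: poch_neq0.
  by move/isintN; rewrite opprK.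
exact: nonint1.
Qed.

(** For non-integral a the factors are 1, which allows the three cases of the theorem to be treated
    uniformly. *)
Lemma gauge_ratio_opt a b (P : Prop) : isint a \/ ~ isint a -> (P -> isint a) ->
  ~ isint (eps + b) -> exists k1 k2 : int -> K,
  [/\ invfun (a + b + 1) eps k1, invfun (a + b + 1) eps k2, forall n, k1 n != 0,
    forall n, k2 n != 0 &
    P -> forall n, gauge (- a) (eps + a + b) n * k1 n = gauge a eps n * k2 n].
Proof.
move=> [Ia|nIa] Pa Hb.
  by have [k1 [k2 [H1 H2 H3 H4 H5]]] := gauge_ratio Ia e0 Hb; exists k1, k2; split.
exists (fun=> 1), (fun=> 1); split; try exact: invfun_cst.
- by move=> n; rewrite oner_eq0.
- by move=> n; rewrite oner_eq0.
- by move=> /Pa.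
Qed.

Lemma dual_down n : g2 (n - 1) = g2 n * ((n%:~R + eps + alpha + beta) / (n%:~R + eps + beta)).
Proof.
rewrite /g2 gaugeB //; last by rewrite dual_alpha.
by congr (_ * (_ / _)); ring.
Qed.

Lemma dual_up n : g2 (n + 1) = g2 n * ((n%:~R + eps + beta + 1) / (n%:~R + eps + alpha + beta + 1)).
Proof.
rewrite /g2 gaugeS //; last by rewrite dual_alpha.
by congr (_ * (_ / _)); ring.
Qed.

(** Both forms of the Jacobi function are g(n) times x^m times a hypergeometric series with
    parameter a, in the variable n + eps + c: either a = alpha and c = 0, or a = -alpha and c =
    alpha. The relation between a, c and s says that the reflection of n is the same in both
    forms. *)
Lemma pser_base : exists (a c : K) (g : int -> K), forall k1 k2 k3 : int -> K,
  invfun s eps k1 -> invfun s eps k2 -> invfun s eps k3 ->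
  (forall n, k1 n != 0) -> (forall n, k2 n != 0) -> (forall n, k3 n != 0) ->
  ((0 < m)%N -> forall n, g2 n * k1 n = g1 n * k2 n) ->
  (forall t : nat, a + 1 + t%:R != 0) /\ a + beta + 1 = s - 2 * c /\
  (forall i n, tridiag_app L (fun n => g n * chcoef a beta (eps + c) i n) n =
     g n * (chcoef a beta (eps + c) i n - 2 * chcoef a beta (eps + c) (i - 1) n)) /\
  (forall n i, pser n i = g n * chcoef a beta (eps + c) (i - m%:Z) n) /\
  exists kp, [/\ invfun s eps kp, forall n, kp n != 0 &
     forall n, g n = g1 n / (k1 n * k3 n) * kp n].
Proof.
have [mz|mp] := posnP m.
  exists alpha, 0, g1 => k1 k2 k3 I1 I2 I3 N1 N2 N3 _; rewrite addr0; split; last split.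
  - exact: m_zero.
  - by rewrite mulr0 subr0.
  split=> [i n|]; last split=> [n i|].
  - case: i => i; first by apply: jacobi_gauge => // t _; exact: m_zero.
    have h (j : nat) x : chcoef alpha beta eps (Negz j) x = 0 by [].
    by rewrite /tridiag_app (_ : Negz i - 1 = Negz i.+1) ?h; [ring|lia].
  - by rewrite /pser mz eqxx subr0.
  exists (fun n => k1 n * k3 n); split; first exact: invfunM.
    by move=> n; rewrite mulf_neq0.
  by move=> n; rewrite mulfVK // mulf_neq0.
have aE := m_pos mp.
have Ha (t : nat) : - alpha + 1 + t%:R != 0.
  by rewrite aE opprK -addrA nat1r -natrD pnatr_eq0 addnS.
exists (- alpha), alpha, (fun n => pcst * g2 n).
move=> k1 k2 k3 I1 I2 I3 N1 N2 N3 R12; split; last split.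
- exact: Ha.
- by rewrite /s; ring.
split=> [i n|]; last split=> [n i|].
- case: i => i; last first.
    have h (j : nat) x : chcoef (- alpha) beta (eps + alpha) (Negz j) x = 0 by [].
    by rewrite /tridiag_app (_ : Negz i - 1 = Negz i.+1) ?h; [ring|lia].
  have [y0 y1 y2] := y_neq0 eeab0 n; have yE : 2 * (n%:~R + (eps + alpha)) + - alpha + beta + 1 =
    2 * (n%:~R + eps) + alpha + beta + 1 by ring.
  have h1 : n%:~R + eps + beta != 0 by rewrite -addrA addrC nonintD.
  have h2 : n%:~R + eps + alpha + beta + 1 != 0.
    have := nonintD (n + 1) eab0; rewrite intrD => h; apply: contraNneq h => E.
    by rewrite -E; apply/eqP; ring.
  apply: tridiag_hcoef; rewrite ?yE //.
  + rewrite /L /= dual_up (_ : _ + beta + 2 = 2 * (n%:~R + eps) + alpha + beta + 1 + 1); last by ring.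
    by field; rewrite h2 y0 y1.
  + rewrite /L /= sqrrN.
    by congr (_ / (_ * _)); ring.
  + rewrite /L /= dual_down [X in _ / (X * _)](_ : _ = 2 * (n%:~R + eps) + alpha + beta + 1 - 1); last by ring.
    by field; rewrite h1 y0 y2.
- by rewrite /pser -[m == 0%N]negbK -lt0n mp.
exists (fun n => pcst * (k2 n * k3 n)); split.
- by apply: invfunM (invfun_cst _ _ _) _; apply: invfunM.
- move=> n; apply: mulf_neq0; first exact: pcst_neq0.
  exact: mulf_neq0.
move=> n; have H := R12 isT n.
have n1 := N1 n; have n3 := N3 n.
apply: (mulIf n1); transitivity (pcst * (g2 n * k1 n)); first by ring.
by rewrite H; field; rewrite n1 n3.
Qed.

Let gp := kcomb A B (phi_plus alpha beta eps) (psi_plus alpha beta eps).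
Let gm := kcomb C D (phi_minus alpha beta eps) (psi_minus alpha beta eps).
(** The gauge at z = -1 divided by the gauge at z = 1. *)
Let tt n := (-1) ^ n * g3 n / g1 n.

Lemma tt_neq0 n : tt n != 0.
Proof.
apply: mulf_neq0; last by rewrite invr_eq0; apply: gauge_neq0.
by apply: mulf_neq0; [rewrite expfz_neq0 // oppr_eq0 oner_eq0|apply: gauge_neq0].
Qed.

Lemma tt_rec n : tt (n + 1) * (n%:~R + eps + alpha + 1) = - (tt n * (n%:~R + eps + beta + 1)).
Proof.
have u1 : (-1 : K) \is a GRing.unit by rewrite unitrN unitr1.
rewrite /tt exprzDr // expr1z /g3 /g1 !gaugeS //.
have h1 := N1_neq0 e0 n; have h2 := Na1_neq0 ea0 n.
have h3 := gauge_neq0 n e0 ea0; move: ((-1) ^ n) => x.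
by field; rewrite h1 h2 h3.
Qed.

Section Factors.
Variables k1 k2 k3 k4 : int -> K.
Hypothesis I1 : invfun s eps k1.
Hypothesis I2 : invfun s eps k2.
Hypothesis I3 : invfun s eps k3.
Hypothesis I4 : invfun s eps k4.
Hypothesis N1 : forall n, k1 n != 0.
Hypothesis N3 : forall n, k3 n != 0.
Hypothesis R12 : (0 < k)%N -> forall n, g2 n * k1 n = g1 n * k2 n.
Hypothesis R34 : (0 < l)%N -> forall n, g4 n * k3 n = g3 n * k4 n.
(** At z = 1 the gauges are g1 and g2 = g1 k2 / k1, at z = -1 they are, up to (-1)^n, g3 and g4 = g3
    k4 / k3. Dividing g1 by k1 k3 leaves invariant polynomial factors for all four families. *)
Let Gam n := g1 n / (k1 n * k3 n).

Lemma Gam_neq0 n : Gam n != 0.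
Proof. by rewrite mulf_neq0 ?invr_eq0 ?gauge_neq0 // mulf_neq0. Qed.

Lemma gp_factor i : (i < k)%N -> exists g, invfun s eps g /\ forall n, gp i n = Gam n * g n.
Proof.
move=> ik; have k0 : (0 < k)%N by case: (k) ik.
pose c j := (- 2 : K)^-1 ^+ j.
pose h (r : 'I_k) n := A r * (k1 n * k3 n * (c (i - r)%N * chcoef alpha beta eps (i - r)%N n)) +
   B r * (k2 n * k3 n * (c (i - r)%N * chcoef (- alpha) (- beta) (eps + alpha + beta) (i - r)%N n)).
exists (fun n => \sum_(r < k | (r <= i)%N) h r n); split.
  apply: invfun_sum => r _; apply: invfunD.
    apply: invfunM (invfun_cst _ _ _) _; apply: invfunM; first exact: invfunM.
    apply: invfunM (invfun_cst _ _ _) _; apply: (@invfun_chcoef _ _ _ 0).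
      by rewrite mulr0 subr0.
    by rewrite addr0.
  apply: invfunM (invfun_cst _ _ _) _; apply: invfunM; first exact: invfunM.
  apply: invfunM (invfun_cst _ _ _) _; apply: (@invfun_chcoef _ _ _ (alpha + beta)).
    by rewrite /s; ring.
  by rewrite addrA.
move=> n; rewrite /gp /kcomb mulr_sumr; apply: eq_bigr => r _.
rewrite psi_plusE !phi_plusE -/(c _) -/(g1 n) -/(g2 n) /h /Gam.
have n1 := N1 n; have n3 := N3 n; have E := R12 k0 n.
have -> : g2 n = g1 n * k2 n / k1 n by rewrite -E mulfK.
by field; rewrite n1 n3.
Qed.

Lemma gm_factor i : (i < l)%N ->
  exists g, invfun s eps g /\ forall n, gm i n = Gam n * (tt n * g n).
Proof.
move=> il; have l0 : (0 < l)%N by case: (l) il.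
pose c j := (-1) ^+ j * (- 2 : K)^-1 ^+ j.
pose h (r : 'I_l) n := C r * (k1 n * k3 n * (c (i - r)%N * chcoef beta alpha eps (i - r)%N n)) +
   D r * (k1 n * k4 n * (c (i - r)%N * chcoef (- beta) (- alpha) (eps + alpha + beta) (i - r)%N n)).
exists (fun n => \sum_(r < l | (r <= i)%N) h r n); split.
  apply: invfun_sum => r _; apply: invfunD.
    apply: invfunM (invfun_cst _ _ _) _; apply: invfunM; first exact: invfunM.
    apply: invfunM (invfun_cst _ _ _) _; apply: (@invfun_chcoef _ _ _ 0).
      by rewrite mulr0 subr0 /s; ring.
    by rewrite addr0.
  apply: invfunM (invfun_cst _ _ _) _; apply: invfunM; first exact: invfunM.
  apply: invfunM (invfun_cst _ _ _) _; apply: (@invfun_chcoef _ _ _ (alpha + beta)).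
    by rewrite /s; ring.
  by rewrite addrA.
move=> n; rewrite /gm /kcomb !mulr_sumr; apply: eq_bigr => r _.
rewrite psi_minusE !phi_minusE !phi_plusE -/(g3 n) -/(g4 n) /h /Gam /tt /c.
have n1 := N1 n; have n3 := N3 n; have E := R34 l0 n.
have g10 := gauge_neq0 n e0 ea0; rewrite -/g1 in g10.
have -> : g4 n = g3 n * k4 n / k3 n by rewrite -E mulfK.
move: ((-1) ^+ _) ((- 2)^-1 ^+ _) ((-1) ^ n) => x1 x2 x3.
by field; rewrite n1 n3 g10.
Qed.

Lemma ratfun_affine c d : ratfun eps (fun n => c * (n%:~R + eps) + d).
Proof.
have [P [Q [H1 H2]]] := ratfun_poly eps (c *: 'X + d%:P).
by exists P, Q; split=> // n; rewrite -H2 !hornerE.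
Qed.

Lemma ratfun_ext (e : K) (g h : int -> K) : g =1 h -> ratfun e g -> ratfun e h.
Proof. by move=> /funext ->. Qed.

Let yy n := 2 * (n%:~R + eps) + alpha + beta + 1.
Let kk n := k1 n * k3 n.

Lemma ratfun_yinv (c : K) : (forall n, yy n + c != 0) -> ratfun eps (fun n => (yy n + c)^-1).
Proof.
move=> H; apply: ratfunV => //.
by apply: ratfun_ext (ratfun_affine 2 (alpha + beta + 1 + c)) => n; rewrite /yy; ring.
Qed.

Lemma ratfun_kk : ratfun eps kk.
Proof. by apply: (@invfun_ratfun _ s); apply: invfunM. Qed.

Lemma kk_neq0 n : kk n != 0. Proof. exact: mulf_neq0. Qed.

Lemma ratfun_up : ratfun eps (fun n => coef_up L n * Gam (n + 1) / Gam n).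
Proof.
have Y n := y_neq0 eeab0 n.
have Rk1 : ratfun eps (fun n => (kk (n + 1))^-1).
  by apply: ratfunV; [apply: (ratfun_shift 1 ratfun_kk)|move=> n; apply: kk_neq0].
have R0 := ratfun_yinv (c := 0) (fun n => ltac:(rewrite addr0; by case: (Y n))).
have R1 := ratfun_yinv (c := 1) (fun n => ltac:(by case: (Y n))).
apply: ratfun_ext (ratfunM (ratfunM (ratfunM (ratfun_affine 2 (2 * s)) (ratfun_affine 1 (alpha + 1)))
   (ratfunM R0 R1)) (ratfunM ratfun_kk Rk1)) => n.
have [y0 y1 _] := Y n; have h1 := N1_neq0 e0 n.
have g10 := gauge_neq0 n e0 ea0.
have q1 := kk_neq0 n; have q2 := kk_neq0 (n + 1).
rewrite /Gam -/(kk n) -/(kk (n + 1)) /g1 gaugeS // /L /=.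
rewrite (_ : _ + beta + 2 = yy n + 1); last by rewrite /yy; ring.
rewrite -/(yy n) addr0 /s.
by field; rewrite ?h1 ?y0 ?y1 ?g10 ?q1 ?q2.
Qed.

Lemma ratfun_mid : ratfun eps (coef_mid L).
Proof.
have Y n := y_neq0 eeab0 n.
have R0 := ratfun_yinv (c := -1) (fun n => ltac:(by case: (Y n))).
have R1 := ratfun_yinv (c := 1) (fun n => ltac:(by case: (Y n))).
apply: ratfun_ext (ratfunM (ratfun_cst eps (beta ^+ 2 - alpha ^+ 2)) (ratfunM R0 R1)) => n.
rewrite /L /= -invfM; congr (_ / (_ * _)); rewrite /yy; ring.
Qed.

Lemma ratfun_down : ratfun eps (fun n => coef_down L n * Gam (n - 1) / Gam n).
Proof.
have Y n := y_neq0 eeab0 n.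
have Rk1 : ratfun eps (fun n => (kk (n - 1))^-1).
  by apply: ratfunV; [apply: (ratfun_shift (-1) ratfun_kk)|move=> n; apply: kk_neq0].
have R0 := ratfun_yinv (c := 0) (fun n => ltac:(rewrite addr0; by case: (Y n))).
have R1 := ratfun_yinv (c := -1) (fun n => ltac:(by case: (Y n))).
apply: ratfun_ext (ratfunM (ratfunM (ratfunM (ratfun_affine 2 0) (ratfun_affine 1 beta))
   (ratfunM R0 R1)) (ratfunM ratfun_kk Rk1)) => n.
have [y0 _ y1] := Y n; have h1 := Na_neq0 ea0 n.
have g10 := gauge_neq0 n e0 ea0.
have q1 := kk_neq0 n; have q2 := kk_neq0 (n - 1).
rewrite /Gam -/(kk n) -/(kk (n - 1)) /g1 gaugeB // /L /=.
rewrite -/(yy n) [X in _ = _ / (X * _) * _ / _](_ : _ = yy n - 1); last by rewrite /yy; ring.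
rewrite addr0.
by field; rewrite ?h1 ?y0 ?y1 ?g10 ?q1 ?q2.
Qed.

End Factors.

Theorem jacobi_darboux_formal :
  (forall i n, tridiag_app L (fun n => pser n i) n = pser n i - 2 * pser n (i - 1)) /\
  exists (e : K) (u : int -> {poly K}) (eta : int -> K),
  [/\ forall i, i < 0 -> u i = 0, u <> (fun=> 0), forall n, eta n != 0,
    forall i n, wronsk f (fun n => pser n i) n = eta n * (u i).[n%:~R + e] &
    exists w c d (theta : {poly K}), (1 < size theta)%N /\
      act w u = smul theta (pmul ('X^c * xfac K k l ^+ d) u)].
Proof.
(* The relation is required whenever alpha is an integer, not only for k > 0: if alpha is a negative
   integer, the Jacobi function itself has the gauge g2. *)
have [k1 [k2 [I1 I2 N1 N2 R12]]] :=
  gauge_ratio_opt (EM (isint alpha)) (fun x : isint alpha => x) eb0.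
have [k3 [k4 [I3 I4 N3 N4 R34]]] :=
  gauge_ratio_opt (EM (isint beta)) (fun x : isint beta => x) ea0.
rewrite [beta + alpha]addrC -/s in I3 I4; rewrite [eps + beta + alpha]addrAC -/g4 -/g3 in R34.
rewrite -/s in I1 I2; rewrite -/g2 -/g1 in R12.
have mint : (0 < m)%N -> isint alpha.
  by move=> /m_pos ->; exists (- m%:Z); rewrite intrN -pmulrn.
have [a [c [g Hb]]] := pser_base.
have [Ha [sE [Hrec [Hp [kp [Ikp kp0 gE]]]]]] := Hb _ _ _ I1 I2 I3 N1 N2 N3 (fun h => R12 (mint h)).
split=> [i n|].
  transitivity (tridiag_app L (fun n => g n * chcoef a beta (eps + c) (i - m%:Z) n) n).
    by rewrite /tridiag_app !Hp.
  have -> : pser n (i - 1) = g n * chcoef a beta (eps + c) (i - m%:Z - 1) n.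
    by rewrite Hp; congr (_ * chcoef _ _ _ _ _); lia.
  by rewrite Hrec Hp; ring.
pose e := eps + c; pose s0 := a + beta + 1.
pose Gam n := g1 n / (k1 n * k3 n).
have Gam0 n : Gam n != 0 := Gam_neq0 N1 N3 n.
pose pl (i : 'I_(k + l)) := (i < k)%N.
have pex i : exists P : {poly K}, refl s0 P = P /\
    forall n, f i n = Gam n * ((if pl i then 1 else tt n) * P.[n%:~R + e]).
  rewrite /pl; case: (split_ordP i) => j ->.
    have [h [Ih Eh]] := gp_factor I1 I2 I3 N1 N3 (fun h => R12 (int_alpha h)) (ltn_ord j).
    have [P [rP HP]] := invfun_recenter sE (erefl e) Ih; exists P; split=> // n.
    by rewrite /f f_lshift -/gp Eh HP mul1r.
  have [h [Ih Eh]] := gm_factor I1 I3 I4 N1 N3 (fun h => R34 (int_beta h)) (ltn_ord j).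
  have [P [rP HP]] := invfun_recenter sE (erefl e) Ih; exists P; split=> // n.
  by rewrite /f f_rshift -/gm Eh HP.
pose pi i := sval (cid (pex i)).
have Hpi i : refl s0 (pi i) = pi i /\
    forall n, f i n = Gam n * ((if pl i then 1 else tt n) * (pi i).[n%:~R + e]) :=
  svalP (cid (pex i)).
have [kap [rkap Hkap]] := invfun_recenter sE (erefl e) Ikp.
have kap0 : kap != 0.
  by apply: contraNneq (kp0 0) => E; rewrite Hkap E horner0.
(* With N = n + e, this choice turns N + bt and N + s0 + 1 - bt into the factors n + eps + beta + 1
   and n + eps + alpha + 1 of [tt_rec]. *)
pose bt := beta + 1 - c.
have qE (n : int) : n%:~R + e + s0 + 1 - bt = n%:~R + eps + alpha + 1.
  by rewrite /e /s0 sE /bt /s; ring.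
have serE i n : Gam n * (kap * fser a s0 i).[n%:~R + e] = g n * chcoef a beta e i n.
  by rewrite hornerM -Hkap fser_horner mulrA -gE.
have [] := @bispectral_formal K a beta s0 bt e k l m pl pi kap tt Gam f L Ha (erefl s0).
- by move=> i; case: (Hpi i).
- exact: rkap.
- exact: kap0.
- by move=> n; rewrite qE; exact: Na1_neq0.
- exact: tt_neq0.
- move=> n; rewrite qE tt_rec; congr (- (_ * _)); rewrite /e /bt; ring.
- exact: Gam0.
- by move=> i n; case: (Hpi i).
- by apply: ratfun_recenter (erefl e) _; exact: ratfun_up.
- by apply: ratfun_recenter (erefl e) _; exact: ratfun_mid.
- by apply: ratfun_recenter (erefl e) _; exact: ratfun_down.
- move=> i n.
  have -> : (fun n : int => Gam n * (kap * fser a s0 i).[n%:~R + e]) =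
      fun n => g n * chcoef a beta e i n by apply/funext => x; exact: serE.
  transitivity (Gam n * (kap * fser a s0 i).[n%:~R + e] -
      2 * (Gam n * (kap * fser a s0 (i - 1)).[n%:~R + e])).
    by rewrite Hrec !serE; ring.
  by rewrite hornerD hornerN hornerZ; ring.
- exact: iter_Lsub_kernel.
- exact: adm.
move=> u [eta [H1 H2 H3 H4 H5]]; exists e, u, eta; split=> // i n.
rewrite -H4; congr (wronsk f _ n); apply/funext => x.
by rewrite Hp serE.
Qed.

End JacobiFormal.

(** * Analysis in the unit disc *)

Section PowerSeries.
Local Open Scope classical_set_scope.
Variable K : numFieldType.
Hypothesis K_complete : forall u : nat -> K,
  (exists B, forall n, \sum_(j < n) `|u j| <= B) -> cvgn (series u).
Implicit Types (c : int -> K) (x z rho : K).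

Definition val c x : K := limn (series (fun j : nat => c j%:Z * x ^+ j)).

Definition psum c x n : K := \sum_(j < n) c j%:Z * x ^+ j.

Lemma seriesE (u : nat -> K) n : series u n = \sum_(j < n) u j.
Proof. by rewrite /series /= big_mkord. Qed.

(** Absolute convergence in the unit disc, stated by bounds on finite sums, so that the estimates
    below involve no limits. *)
Definition conv c := forall rho, 0 <= rho -> rho < 1 ->
  exists B, forall n, \sum_(j < n) `|c j%:Z| * rho ^+ j <= B.

Lemma val_cvg c x : conv c -> `|x| < 1 -> psum c x @ \oo --> val c x.
Proof.
move=> Hc Hx; have [B HB] := Hc _ (normr_ge0 x) Hx.
have -> : psum c x = series (fun j : nat => c j%:Z * x ^+ j).
  by apply/funext => n; rewrite seriesE.
apply: K_complete; exists B => n.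
by under eq_bigr => j _ do rewrite normrM normrX.
Qed.

Lemma val_lim c x v : psum c x @ \oo --> v -> val c x = v.
Proof.
move=> H; rewrite /val.
have -> : series (fun j : nat => c j%:Z * x ^+ j) = psum c x.
  by apply/funext => n; rewrite seriesE.
by apply: cvg_lim => //; exact: norm_hausdorff.
Qed.

Lemma conv0 : conv (fun=> 0).
Proof. by move=> r _ _; exists 0 => n; rewrite big1 // => j _; rewrite normr0 mul0r. Qed.

Lemma val0 x : val (fun=> 0) x = 0.
Proof.
apply: val_lim; have -> : psum (fun=> 0) x = (fun=> 0).
  by apply/funext => n; rewrite /psum big1 // => j _; rewrite mul0r.
exact: cvg_cst.
Qed.

Lemma conv_add c c' : conv c -> conv c' -> conv (sadd c c').
Proof.
move=> H H' r r0 r1; have [B HB] := H r r0 r1; have [B' HB'] := H' r r0 r1.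
exists (B + B') => n; apply: le_trans (lerD (HB n) (HB' n)).
rewrite -big_split; apply: ler_sum => j _ /=; rewrite -mulrDl ler_wpM2r ?exprn_ge0 //.
exact: ler_normD.
Qed.

Lemma conv_scale (a : K) c : conv c -> conv (fun i => a * c i).
Proof.
move=> H r r0 r1; have [B HB] := H r r0 r1.
exists (`|a| * B) => n; rewrite (le_trans _ (ler_wpM2l (normr_ge0 a) (HB n))) //.
by rewrite mulr_sumr; apply: ler_sum => j _; rewrite normrM mulrA.
Qed.

Lemma conv_shift c : conv c -> conv (fun i => c (i - 1)).
Proof.
move=> H r r0 r1; have [B HB] := H r r0 r1.
have B0 : 0 <= B by have := HB 0%N; rewrite big_ord0.
exists (`|c (-1)| + B) => -[|n]; first by rewrite big_ord0 addr_ge0.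
rewrite big_ord_recl expr0 mulr1 (_ : 0%N%:Z - 1 = -1) //.
rewrite lerD2l; apply: le_trans (HB n).
apply: ler_sum => j _; rewrite (_ : (lift ord0 j : nat)%:Z - 1 = j); last by rewrite lift0; lia.
by rewrite ler_wpM2l ?normr_ge0 // lift0 exprSr ler_piMr ?exprn_ge0 // ltW.
Qed.

(** The mean value estimate for t^(j + 1): it bounds the differentiated series at r by the original
    one at a larger radius. *)
Lemma expr_mean_le (r r1 : K) j : 0 <= r -> r <= r1 ->
  j.+1%:R * r ^+ j * (r1 - r) <= r1 ^+ j.+1 - r ^+ j.+1.
Proof.
move=> r0 rr1; have d0 : 0 <= r1 - r by rewrite subr_ge0.
elim: j => [|j IH]; first by rewrite expr0 !expr1 !mul1r.
have -> : r1 ^+ j.+2 - r ^+ j.+2 = r1 * (r1 ^+ j.+1 - r ^+ j.+1) + r ^+ j.+1 * (r1 - r).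
  by rewrite !exprS; ring.
have -> : j.+2%:R * r ^+ j.+1 * (r1 - r) = r * (j.+1%:R * r ^+ j * (r1 - r)) + r ^+ j.+1 * (r1 - r).
  by rewrite -[j.+2%:R]natr1 exprS; ring.
rewrite lerD2r; apply: le_trans (ler_wpM2l r0 IH) _.
apply: ler_wpM2r rr1; apply: le_trans IH.
by rewrite mulr_ge0 // mulr_ge0 ?exprn_ge0 ?ler0n.
Qed.

Lemma conv_der c : conv c -> conv (@sder K K^o c).
Proof.
move=> H r r0 r1; pose q := (r + 1) / 2.
have q1 : q < 1 by rewrite /q ltr_pdivrMr ?ltr0n // mul1r (_ : 2 = 1 + 1) ?ltrD2r.
have rq : r < q by rewrite /q ltr_pdivlMr ?ltr0n // mulr_natr mulr2n ltrD2l.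
have q0 : 0 <= q by rewrite ltW // (le_lt_trans r0).
have d0 : 0 < q - r by rewrite subr_gt0.
have [B HB] := H q q0 q1.
exists (B / (q - r)) => n; rewrite ler_pdivlMr // mulr_suml.
have := HB n.+1; rewrite big_ord_recl => HB'.
apply: le_trans HB'; rewrite -[X in X <= _]add0r; apply: lerD.
  by rewrite mulr_ge0 ?normr_ge0 ?exprn_ge0.
apply: ler_sum => j _; rewrite lift0 /sder (_ : j%:Z + 1 = j.+1); last by lia.
rewrite -[_ *: _]/(_ * _) normrM -pmulrn normr_nat -!mulrA mulrCA.
rewrite ler_wpM2l ?normr_ge0 // mulrA.
apply: le_trans (expr_mean_le j r0 (ltW rq)) _.
by rewrite lerBlDr lerDl exprn_ge0.
Qed.

Lemma conv_pmul (P : {poly K}) c : conv c -> conv (@pmul K K^o P c).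
Proof.
move=> Hc; elim/poly_ind: P => [|P a IH]; first by rewrite pmul0; exact: conv0.
rewrite pmulDl; apply: conv_add; first by rewrite pmulMX; apply: conv_shift.
by rewrite pmulC; apply: conv_scale.
Qed.

Lemma val_add c c' x : conv c -> conv c' -> `|x| < 1 ->
  val (sadd c c') x = val c x + val c' x.
Proof.
move=> H H' x1; apply: val_lim.
have -> : psum (sadd c c') x = psum c x + psum c' x.
  by apply/funext => n; rewrite /psum -[RHS]big_split; apply: eq_bigr => j _; rewrite /sadd mulrDl.
by apply: cvgD; apply: val_cvg.
Qed.

Lemma val_scale (a : K) c x : conv c -> `|x| < 1 -> val (fun i => a * c i) x = a * val c x.
Proof.
move=> H x1; apply: val_lim.
have -> : psum (fun i => a * c i) x = (fun n => a * psum c x n).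
  by apply/funext => n; rewrite /psum mulr_sumr; apply: eq_bigr => j _; rewrite mulrA.
by apply: cvgM; [exact: cvg_cst|exact: val_cvg].
Qed.

Lemma val_shift c x : c (-1) = 0 -> conv c -> `|x| < 1 ->
  val (fun i => c (i - 1)) x = x * val c x.
Proof.
move=> c0 H x1; apply: val_lim.
rewrite -cvg_shiftS.
have -> : [sequence psum (fun i => c (i - 1)) x n.+1]_n = (fun n => x * psum c x n).
  apply/funext => n; rewrite /= /psum big_ord_recl (_ : 0%N%:Z - 1 = -1) // c0 mul0r add0r.
  rewrite mulr_sumr; apply: eq_bigr => j _; rewrite lift0 (_ : j.+1%:Z - 1 = j); last by lia.
  by rewrite exprS; ring.
by apply: cvgM; [exact: cvg_cst|exact: val_cvg].
Qed.

Lemma val_sum n (c : nat -> int -> K) x : (forall j, (j < n)%N -> conv (c j)) -> `|x| < 1 ->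
  conv (fun i => \sum_(j < n) c j i) /\
  val (fun i => \sum_(j < n) c j i) x = \sum_(j < n) val (c j) x.
Proof.
move=> H x1; elim: n H => [|n IH] H.
  have -> : (fun i => \sum_(j < 0) c j i) = (fun=> 0) by apply/funext => i; rewrite big_ord0.
  split; first exact: conv0.
  by rewrite val0 big_ord0.
have -> : (fun i => \sum_(j < n.+1) c j i) = sadd (fun i => \sum_(j < n) c j i) (c n).
  by apply/funext => i; rewrite big_ord_recr.
have [H1 H2] := IH (fun j h => H j (ltnW h)).
by split; [apply: conv_add; last exact: H|rewrite val_add ?H2 ?big_ord_recr //; exact: H].
Qed.

Lemma val_pmul (P : {poly K}) c x : (forall i, i < 0 -> c i = 0) -> conv c -> `|x| < 1 ->
  val (@pmul K K^o P c) x = P.[x] * val c x.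
Proof.
move=> Hneg Hc x1; elim/poly_ind: P => [|P a IH].
  by rewrite pmul0 horner0 mul0r val0.
rewrite pmulDl val_add //; first last.
- by apply: conv_pmul.
- by apply: conv_pmul.
rewrite pmulMX val_shift //; first last.
- by apply: conv_pmul.
- by rewrite /pmul big1 // => j _; rewrite Hneg ?scaler0 //; lia.
by rewrite pmulC val_scale // IH hornerMXaddC; ring.
Qed.

Lemma cvg_norm_le (u : nat -> K) l B : 0 <= B -> (forall n, `|u n| <= B) ->
  u @ \oo --> l -> `|l| <= B.
Proof.
move=> B0 H Hl; rewrite real_leNgt ?normr_real ?ger0_real //; apply/negP => lt.
have e0 : 0 < `|l| - B by rewrite subr_gt0.
move/cvgrPdist_lt/(_ _ e0): Hl => [N _ HN].
have := HN N (leqnn N) => /= h.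
have := ler_normD (l - u N) (u N); rewrite subrK => h2.
have := lt_le_trans (ltr_leD h (H N)) (le_refl _); rewrite subrK => h3.
by have := le_lt_trans h2 h3; rewrite ltxx.
Qed.

(** Induction by multiplication with x + h. The bound contains the coefficient of the second
    derivative, so that summation over j gives the series of c''. *)
Lemma expr_taylor (x h rho : K) j : 0 <= rho -> `|x| <= rho -> `|x + h| <= rho ->
  `|(x + h) ^+ j.+2 - x ^+ j.+2 - j.+2%:R * x ^+ j.+1 * h| <=
  `|h| ^+ 2 * ((j.+2 * j.+1)%:R * rho ^+ j).
Proof.
move=> r0 xr xhr; elim: j => [|j IH].
  have -> : (x + h) ^+ 2 - x ^+ 2 - 2%:R * x ^+ 1 * h = h ^+ 2 by ring.
  rewrite normrX expr0 mulr1 ler_peMr ?exprn_ge0 ?normr_ge0 // ler1n.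
  by [].
have -> : (x + h) ^+ j.+3 - x ^+ j.+3 - j.+3%:R * x ^+ j.+2 * h =
   (x + h) * ((x + h) ^+ j.+2 - x ^+ j.+2 - j.+2%:R * x ^+ j.+1 * h) +
   j.+2%:R * h ^+ 2 * x ^+ j.+1.
  rewrite -[j.+3%:R]natr1 !exprS; move: (x ^+ j) ((x + h) ^+ j) (j.+2%:R : K) => p q w.
  ring.
apply: le_trans (ler_normD _ _) _; rewrite !normrM !normrX normr_nat.
have h1 := ler_pM (normr_ge0 _) (normr_ge0 _) xhr IH.
have h2 : j.+2%:R * `|h| ^+ 2 * `|x| ^+ j.+1 <= j.+2%:R * `|h| ^+ 2 * rho ^+ j.+1.
  by rewrite ler_wpM2l ?mulr_ge0 ?exprn_ge0 ?ler0n // lerXn2r ?nnegrE.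
apply: le_trans (lerD h1 h2) _.
have -> : rho * (`|h| ^+ 2 * ((j.+2 * j.+1)%:R * rho ^+ j)) + j.+2%:R * `|h| ^+ 2 * rho ^+ j.+1 =
    `|h| ^+ 2 * ((j.+2 * j.+2)%:R * rho ^+ j.+1).
  rewrite !natrM [rho ^+ j.+1]exprS -[j.+2%:R]natr1; move: (rho ^+ j) (j.+1%:R : K) => p q; ring.
rewrite ler_wpM2l ?exprn_ge0 // ler_wpM2r ?exprn_ge0 // ler_nat.
by rewrite leq_mul.
Qed.

Lemma val_taylor c x rho : conv c -> `|x| <= rho -> rho < 1 -> exists2 B, 0 <= B &
  forall h, `|x + h| <= rho ->
  `|val c (x + h) - val c x - h * val (@sder K K^o c) x| <= `|h| ^+ 2 * B.
Proof.
move=> Hc xr r1; have r0 : 0 <= rho := le_trans (normr_ge0 x) xr.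
have Hc1 := conv_der Hc; have Hc2 := conv_der Hc1.
have [B HB] := Hc2 rho r0 r1.
have B0 : 0 <= B by have := HB 0%N; rewrite big_ord0.
exists B => // h xhr; have x1 := le_lt_trans xr r1; have xh1 := le_lt_trans xhr r1.
(* The derivative of a partial sum of length n + 2 has length n + 1. *)
pose u n := psum c (x + h) n.+2 - psum c x n.+2 - h * psum (@sder K K^o c) x n.+1.
apply: (@cvg_norm_le u); first by rewrite mulr_ge0 ?exprn_ge0.
  move=> n.
  have -> : u n = \sum_(j < n) c j.+2%:Z *
      ((x + h) ^+ j.+2 - x ^+ j.+2 - j.+2%:R * x ^+ j.+1 * h).
    have P2 y : psum c y n.+2 = c 0 + c 1 * y + \sum_(j < n) c j.+2%:Z * y ^+ j.+2.
      by rewrite /psum !big_ord_recl expr0 mulr1 addrA; congr (_ + _ + _).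
    have P1 : psum (@sder K K^o c) x n.+1 =
        c 1 + \sum_(j < n) j.+2%:R * c j.+2%:Z * x ^+ j.+1.
      rewrite /psum big_ord_recl expr0 mulr1 /sder; congr (_ + _).
        by rewrite -[_ *: _]/(_ * _) add0r mul1r.
      apply: eq_bigr => j _; rewrite !lift0 -[_ *: _]/(_ * _).
      by rewrite (_ : j.+1%:Z + 1 = j.+2); last by lia.
    rewrite /u !P2 P1.
    transitivity (\sum_(j < n) c j.+2%:Z * (x + h) ^+ j.+2 - \sum_(j < n) c j.+2%:Z * x ^+ j.+2 -
      h * \sum_(j < n) j.+2%:R * c j.+2%:Z * x ^+ j.+1); first by ring.
    rewrite mulr_sumr -!sumrB; apply: eq_bigr => j _.
    by move: ((x + h) ^+ j.+2) (x ^+ j.+2) (x ^+ j.+1) (j.+2%:R : K) => p q w y; ring.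
  apply: le_trans (ler_norm_sum _ _ _) _.
  apply: le_trans (ler_wpM2l (exprn_ge0 2 (normr_ge0 h)) (HB n)).
  rewrite mulr_sumr; apply: ler_sum => j _; rewrite normrM.
  apply: le_trans (ler_wpM2l (normr_ge0 _) (expr_taylor j r0 xr xhr)) _.
  rewrite /sder -![_ *: _]/(_ * _) (_ : j%:Z + 1 = j.+1); last by lia.
  rewrite (_ : j.+1%:Z + 1 = j.+2); last by lia.
  rewrite !normrM -!pmulrn !normr_nat natrM le_eqVlt; apply/orP; left; apply/eqP; ring.
apply: cvgB; first apply: cvgB.
- have := val_cvg Hc xh1; rewrite -cvg_shiftS -cvg_shiftS; exact.
- have := val_cvg Hc x1; rewrite -cvg_shiftS -cvg_shiftS; exact.
- apply: cvgM; first exact: cvg_cst.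
  by have := val_cvg Hc1 x1; rewrite -cvg_shiftS; exact.
Qed.

End PowerSeries.

(** * Termwise differentiation in z and convergence of the hypergeometric series *)

Section JacobiSeries.
Local Open Scope classical_set_scope.
Variable K : numFieldType.
Hypothesis K_complete : forall u : nat -> K,
  (exists B, forall n, \sum_(j < n) `|u j| <= B) -> cvgn (series u).
Hypothesis K_archi : forall x : K, exists n : nat, `|x| <= n%:R.
Implicit Types (c : int -> K) (x z rho : K).

Definition zval c z : K := val c ((1 - z) / 2).

(** The series in x converge for |z - 1| < 2, and this disc contains the unit disc. *)
Lemma disc_half z : `|z| < 1 -> `|(1 - z) / 2| < 1.
Proof.
move=> z1; rewrite normrM normrV ?unitfE ?pnatr_eq0 // normr_nat.
rewrite ltr_pdivrMr ?ltr0n // mul1r; apply: le_lt_trans (ler_normB _ _) _.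
by rewrite normr1 [ltRHS](_ : 2 = 1 + 1) // ltrD2l.
Qed.

Definition zder c : int -> K := fun i => - 2^-1 * @sder K K^o c i.

Lemma conv_zder c : conv c -> conv (zder c).
Proof. by move=> Hc; apply: conv_scale; apply: conv_der. Qed.

(** By the Taylor estimate with increment -h/2 in x, the error of the difference quotient is at most
    |h| B. Only the values of g inside the disc |z - 1| < 2 enter, so the lemma can be iterated on
    derivatives that are known only there. *)
Lemma derive1_zval c (g : K -> K) z : conv c -> `|(1 - z) / 2| < 1 ->
  (forall z', `|(1 - z') / 2| < 1 -> g z' = zval c z') ->
  derive1 g z = zval (zder c) z.
Proof.
move=> Hc z1 Hg; set x := (1 - z) / 2 in z1.
pose rho := (`|x| + 1) / 2.
have r1 : rho < 1 by rewrite /rho ltr_pdivrMr ?ltr0n // mul1r [ltRHS](_ : 2 = 1 + 1) // ltrD2r.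
have xr : `|x| < rho by rewrite /rho ltr_pdivlMr ?ltr0n // mulr_natr mulr2n ltrD2l.
have [B B0 HB] := val_taylor K_complete Hc (ltW xr) r1.
rewrite /zval -/x /zder val_scale //; last exact: conv_der.
set d := val _ x.
rewrite /derive1; apply: cvg_lim; first exact: norm_hausdorff.
apply/cvgrPdist_lt => e e0.
have d0 : 0 < rho - `|x| by rewrite subr_gt0.
have e1 : 0 < e / (B + 1) by rewrite divr_gt0 // ltr_wpDl.
near=> h.
have h0 : h != 0 by near: h; exact: nbhs_dnbhs_neq.
have h1 : `|h| < rho - `|x| by near: h; exact: dnbhs0_lt.
have h2 : `|h| < e / (B + 1) by near: h; exact: dnbhs0_lt.
pose k := - h / 2.
have nk : `|k| = `|h| / 2.
  by rewrite /k normrM normrN normrV ?unitfE ?pnatr_eq0 // normr_nat.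
have kh : `|k| <= `|h|.
  rewrite nk ler_pdivrMr ?ltr0n // ler_peMr // ler1n; by [].
have xk : `|x + k| <= rho.
  apply: le_trans (ler_normD _ _) _; rewrite -lerBrDl.
  exact: le_trans kh (ltW h1).
have E : (1 - (h + z)) / 2 = x + k by rewrite /x /k; field.
have := HB k xk; rewrite -/d => T.
rewrite Hg ?E; last exact: le_lt_trans xk r1.
rewrite Hg // /zval E -/x.
have -> : - 2^-1 * d - h^-1 *: (val c (x + k) - val c x) =
    - h^-1 * (val c (x + k) - val c x - k * d).
  by rewrite /k -[_ *: _]/(_ * _); field; rewrite h0.
rewrite normrM normrN normrV ?unitfE //.
have hp : 0 < `|h| by rewrite normr_gt0.
rewrite mulrC ltr_pdivrMr //; apply: le_lt_trans T _.
apply: (@le_lt_trans _ _ (`|h| * (`|h| * B))).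
  rewrite mulrA -expr2 ler_wpM2r //.
  by rewrite lerXn2r ?nnegrE.
rewrite [ltRHS]mulrC ltr_pM2l //.
apply: (@le_lt_trans _ _ (`|h| * (B + 1))).
  by rewrite ler_wpM2l // lerDl.
by rewrite -ltr_pdivlMr // ltr_wpDl.
Unshelve. all: by end_near.
Qed.

Lemma derive1n_zval c (g : K -> K) j z : conv c -> `|(1 - z) / 2| < 1 ->
  (forall z', `|(1 - z') / 2| < 1 -> g z' = zval c z') ->
  derive1n j g z = zval (iter j zder c) z.
Proof.
move=> Hc z1 Hg.
have Hconv j' : conv (iter j' zder c) by elim: j' => //= j' IH; apply: conv_zder.
elim: j z z1 => [|j IH] z z1; first exact: Hg.
by rewrite /derive1n /= (@derive1_zval (iter j zder c)).
Qed.

Lemma iter_zder c j i : iter j zder c i = (- 2^-1) ^+ j * iter j (@sder K K^o) c i.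
Proof.
elim: j i => [|j IH] i; first by rewrite mul1r.
rewrite /= /zder /sder IH exprS; move: ((- 2^-1) ^+ j) (iter j _ c _) => p w.
change (- 2^-1 * ((i + 1)%:~R * (p * w)) = - 2^-1 * p * ((i + 1)%:~R * w)); ring.
Qed.

Lemma ratio_bounded (u : nat -> K) q J : 0 <= q -> q < 1 -> (forall j, 0 <= u j) ->
  (forall j, (J <= j)%N -> u j.+1 <= q * u j) ->
  exists B, forall n, \sum_(j < n) u j <= B.
Proof.
move=> q0 q1 u0 Hu; have d0 : 0 < 1 - q by rewrite subr_gt0.
exists (\sum_(j < J) u j + u J / (1 - q)) => n.
have mono : forall k m, \sum_(j < m) u j <= \sum_(j < m + k) u j.
  elim=> [|k IH] m; first by rewrite addn0.
  by apply: le_trans (IH m) _; rewrite addnS big_ord_recr lerDl.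
have key k : \sum_(j < J + k) u j + u (J + k)%N / (1 - q) <= \sum_(j < J) u j + u J / (1 - q).
  elim: k => [|k IH]; first by rewrite addn0.
  apply: le_trans IH; rewrite addnS big_ord_recr -addrA lerD2l.
  have := Hu (J + k)%N (leq_addr _ _) => h.
  have -> : u (J + k)%N / (1 - q) = u (J + k)%N + q * u (J + k)%N / (1 - q).
    by field; rewrite gt_eqF.
  by rewrite lerD2l ler_wpM2r // invr_ge0 ltW.
have [h|h] := leqP n J.
  have := mono (J - n)%N n; rewrite subnKC // => h'; apply: le_trans h' _.
  by rewrite lerDl divr_ge0 //; exact: ltW.
have := key (n - J)%N; rewrite subnKC ?(ltnW h) // => h'; apply: le_trans h'.
by rewrite lerDl divr_ge0 //; exact: ltW.
Qed.

Lemma natr_ge_eventually (y : K) : 0 <= y -> exists n0 : nat, forall n, (n0 <= n)%N -> y <= n%:R.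
Proof.
move=> y0; have [n0] := K_archi y; rewrite ger0_norm // => h.
by exists n0 => n hn; apply: le_trans h _; rewrite ler_nat.
Qed.

(** Ratio test: the quotient of consecutive coefficients tends to 1, so it is eventually at most 1 +
    dl in absolute value, and dl = (1 - r) / 2 gives (1 + dl) r < 1. *)
Lemma conv_hcoef (a s N : K) : conv (hcoef a s N).
Proof.
move=> r r0 r1; pose dl := (1 - r) / 2.
have dl0 : 0 < dl by rewrite divr_gt0 ?subr_gt0 ?ltr0n.
pose q := (1 + dl) * r.
have q0 : 0 <= q by rewrite mulr_ge0 // addr_ge0 // ltW.
have q1 : q < 1.
  rewrite /q mulrDl mul1r -ltrBrDl; apply: (@le_lt_trans _ _ dl).
    by rewrite ler_piMr // ltW.
  by rewrite /dl ltr_pdivrMr ?ltr0n // mulr_natr mulr2n ltrDr subr_gt0.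
pose lam := N * (N + s).
(* [A1] and [A0] collect the terms of degree 1 and 0 in t = j that dl t^2 has to dominate. *)
pose A1 := `|s| + (1 + dl) * `|a + 1|.
pose A0 := (1 + dl) * `|a + 1| + `|lam|.
have dl1 : 0 <= 1 + dl by rewrite addr_ge0 // ltW.
have A10 : 0 <= A1 by rewrite addr_ge0 // mulr_ge0.
have A00 : 0 <= A0 by rewrite addr_ge0 // mulr_ge0.
have [n1 Hn1] : exists n0 : nat, forall n, (n0 <= n)%N -> (A1 + A0) / dl + 1 <= n%:R.
  apply: natr_ge_eventually; apply: addr_ge0 => //.
  by apply: divr_ge0; [exact: addr_ge0|exact: ltW].
have [n2 Hn2] : exists n0 : nat, forall n, (n0 <= n)%N -> `|a + 1| + 1 <= n%:R.
  by apply: natr_ge_eventually; apply: addr_ge0.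
have key (j : nat) : (n1 + n2 <= j)%N ->
    `|j%:R * (j%:R + s) - lam| <= (1 + dl) * (`|a + 1 + j%:R| * j.+1%:R).
  move=> hj; set t := j%:R.
  have t1 : (A1 + A0) / dl + 1 <= t by apply: Hn1; lia.
  have t2 : `|a + 1| + 1 <= t by apply: Hn2; lia.
  have tn : `|t| = t by rewrite normr_nat.
  have tge : 1 <= t by apply: le_trans t2; rewrite lerDr.
  have L1 : `|t * (t + s) - lam| <= t ^+ 2 + t * `|s| + `|lam|.
    apply: le_trans (ler_normB _ _) _; rewrite lerD2r mulrDr expr2.
    by apply: le_trans (ler_normD _ _) _; rewrite !normrM tn.
  have L2 : t - `|a + 1| <= `|a + 1 + t|.
    have := ler_normB (a + 1 + t) (a + 1).
    by rewrite (_ : a + 1 + t - (a + 1) = t) ?tn ?lerBlDr //; ring.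
  have L3 : (1 + dl) * ((t - `|a + 1|) * (t + 1)) <= (1 + dl) * (`|a + 1 + t| * j.+1%:R).
    by rewrite -[j.+1%:R]natr1 ler_wpM2l // ler_wpM2r // addr_ge0 // /t ler0n.
  apply: le_trans L1 (le_trans _ L3).
  have D : A1 + A0 <= dl * t.
    rewrite mulrC -ler_pdivrMr //; apply: le_trans t1; by rewrite lerDl.
  have D2 : A1 * t + A0 <= dl * t ^+ 2.
    apply: (@le_trans _ _ ((A1 + A0) * t)); last first.
      by rewrite expr2 mulrA ler_wpM2r // (le_trans ler01).
    by rewrite [leRHS](mulrDl A1 A0 t) lerD2l ler_peMr.
  rewrite -subr_ge0.
  have -> : (1 + dl) * ((t - `|a + 1|) * (t + 1)) - (t ^+ 2 + t * `|s| + `|lam|) =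
     (dl * t ^+ 2 - (A1 * t + A0)) + (1 + dl) * t.
    by rewrite /A1 /A0; ring.
  by rewrite addr_ge0 ?subr_ge0 // mulr_ge0 // (le_trans ler01).
apply: (@ratio_bounded (fun j => `|hcoef a s N j| * r ^+ j) q (n1 + n2)) => //.
  by move=> j; rewrite mulr_ge0 ?exprn_ge0.
move=> j hj; rewrite hcoef_nat normrM exprSr.
have aj : 0 < `|a + 1 + j%:R|.
  rewrite normr_gt0; apply/eqP => h.
  have := Hn2 j ltac:(lia); have -> : a + 1 = - j%:R by apply/eqP; rewrite -addr_eq0 h.
  by rewrite normrN normr_nat gerDl ler10.
have den : 0 < `|a + 1 + j%:R| * j.+1%:R by rewrite mulr_gt0 ?ltr0n.
have R : `|(j%:R * (j%:R + s) - N * (N + s)) / ((a + 1 + j%:R) * j.+1%:R)| <= 1 + dl.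
  rewrite normrM normfV normrM normr_nat ler_pdivrMr //; exact: key.
rewrite [leRHS](_ : _ = (`|hcoef a s N j| * (1 + dl)) * (r ^+ j * r)); last by rewrite /q; ring.
by rewrite ler_wpM2r ?mulr_ge0 ?exprn_ge0 // ler_wpM2l.
Qed.

End JacobiSeries.

(** * Rational functions and complex numbers *)

Section RationalFunctions.
Variable K : numFieldType.
Implicit Types (p q : {poly K}) (r : {fraction {poly K}}) (z : K).
Local Notation "x %:F" := (FracField.tofrac x).
Local Open Scope quotient_scope.

Lemma frac_pi (y : {ratio {poly K}}) p q : (frac y).1 * q = (frac y).2 * p ->
  (\pi_({fraction {poly K}}) y : {fraction {poly K}}) * q%:F = p%:F.
Proof.
move=> H; rewrite -[LHS]/(FracField.mul _ _) !piE; apply/eqmodP.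
rewrite /= FracField.equivfE /FracField.mulf !numden_Ratio ?mulf_neq0 ?oner_neq0 ?denom_ratioP //.
by rewrite !mulr1 H.
Qed.

Lemma frac_repr r : r * (frac (repr r)).2%:F = (frac (repr r)).1%:F.
Proof. by rewrite -{1}[r]reprK; apply: frac_pi; rewrite mulrC. Qed.

Lemma ratfrac r : r * (ratden r)%:F = (ratnum r)%:F /\ coprimep (ratnum r) (ratden r) /\
  ratden r != 0.
Proof.
have H := frac_repr r; rewrite /ratden /ratnum; set n := _.1 in H *; set d := _.2 in H *.
have d0 : d != 0 by exact: denom_ratioP.
have g0 : gcdp n d != 0 by rewrite gcdp_eq0 (negPf d0) andbF.
have dE := divpK (dvdp_gcdr n d); have nE := divpK (dvdp_gcdl n d).
split; last split.
- have gF : (gcdp n d)%:F != 0 by rewrite tofrac_eq0.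
  by apply: (mulIf gF); rewrite -mulrA -!tofracM dE nE.
- by rewrite coprimep_div_gcd // d0 orbT.
- by apply: contraNneq d0 => E; rewrite -dE E mul0r.
Qed.

(** The reduced denominator divides the denominator of every representation, so it does not vanish
    where q does not. *)
Lemma rateval_frac p q z : q.[z] != 0 -> rateval (p%:F / q%:F) z = p.[z] / q.[z].
Proof.
move=> qz; have q0 : q != 0 by apply: contraNneq qz => ->; rewrite horner0.
have [H [cop d0]] := ratfrac (p%:F / q%:F); rewrite /rateval.
move: (ratnum _) (ratden _) H cop d0 => n d H cop d0.
have E : p * d = n * q.
  apply/eqP; rewrite -tofrac_eq !tofracM -H; apply/eqP.
  by rewrite mulrAC mulfVK // tofrac_eq0.
have dq : d %| q by rewrite coprimep_sym in cop; rewrite -(Gauss_dvdpr q cop) -E dvdp_mulIr.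
have dz : d.[z] != 0.
  by apply: contraNneq qz => dz; rewrite -(divpK dq) hornerM dz mulr0.
by apply/eqP; rewrite eqr_div // -!hornerM E.
Qed.

End RationalFunctions.


Section ComplexCompleteness.
Local Open Scope classical_set_scope.
Variable R : realType.
Let K : numFieldType := R[i].
Implicit Types (x : R[i]) (u : nat -> K).

Lemma normci : `|'i%C : R[i]| = 1.
Proof. by rewrite normc_def /= expr0n expr1n add0r sqrtr1. Qed.

Lemma normc_ge_Im x : `|complex.Im x|%:C%C <= `|x|.
Proof.
by have := normc_ge_Re (x * 'i%C); rewrite ReiNIm normrN normrM normci mulr1.
Qed.

Lemma complex_archi x : exists n : nat, `|x| <= n%:R.
Proof.
have [n] : exists n : nat, complex.Re `|x| <= n%:R.
  exists (Num.truncn (complex.Re `|x|)).+1; exact: ltW (truncnS_gt _).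
rewrite -lecR => H; exists n; rewrite -[`|x|]RRe_real ?normr_real //.
by move: H; rewrite rmorph_nat.
Qed.

(** The real and the imaginary part are absolutely summable real series, whose absolute sums
    converge as bounded monotone sequences. *)
Lemma complex_abs_cvg u : (exists B, forall n, \sum_(j < n) `|u j| <= B) ->
  cvgn (series u).
Proof.
move=> [B HB].
have real_part (v : nat -> R) : (forall j, `|v j|%:C%C <= `|u j|) -> cvgn (series v).
  move=> Hv; apply: normed_cvg; apply: nondecreasing_is_cvgn.
    by apply: nondecreasing_series => n _ _; exact: normr_ge0.
  exists (complex.Re B) => _ [n _ <-]; rewrite -lecR /=.
  have B0 : 0 <= B by have := HB 0%N; rewrite big_ord0.
  rewrite RRe_real ?ger0_real //; apply: le_trans (HB n).
  by rewrite /series /= big_mkord rmorph_sum; apply: ler_sum => j _; exact: Hv.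
have /cvg_ex [a Ha] := real_part (fun j => complex.Re (u j)) (fun j => normc_ge_Re _).
have /cvg_ex [b Hb] := real_part (fun j => complex.Im (u j)) (fun j => normc_ge_Im _).
apply/cvg_ex; exists (a%:C + 'i * b%:C)%C.
apply/cvgrPdist_lt => e e0.
have e2 : 0 < complex.Re e / 2.
  by move: e0; rewrite ltcE /= => /andP[_ h]; rewrite divr_gt0.
move/cvgrPdist_lt/(_ _ e2): Ha => Ha; move/cvgrPdist_lt/(_ _ e2): Hb => Hb.
near=> n.
have h1 : `|a - series (fun j => complex.Re (u j)) n| < complex.Re e / 2 by near: n.
have h2 : `|b - series (fun j => complex.Im (u j)) n| < complex.Re e / 2 by near: n.
have E : series u n = ((series (fun j => complex.Re (u j)) n)%:C +
    'i * (series (fun j => complex.Im (u j)) n)%:C)%C.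
  rewrite /series /= !big_mkord !rmorph_sum mulr_sumr -big_split.
  by apply: eq_bigr => j _; exact: complexE.
rewrite E; set s := series _ n in h1 *; set t := series _ n in h2 *.
have -> : (a%:C + 'i * b%:C)%C - (s%:C + 'i * t%:C)%C = ((a - s)%:C + 'i * (b - t)%:C)%C.
  by rewrite !rmorphB; ring.
apply: le_lt_trans (ler_normD _ _) _.
rewrite [`|'i%C * _|]normrM normci mul1r !normc_def /= !expr0n /= !addr0 !sqrtr_sqr -rmorphD /=.
rewrite ltcE /=; move: e0; rewrite ltcE /= => /andP[/eqP -> _]; rewrite eqxx /=.
by rewrite [ltRHS]splitr ltrD.
Unshelve. all: by end_near.
Qed.

End ComplexCompleteness.

(** * Bispectrality of the Darboux transforms *)

Section JacobiFunctions.
Variable K : numFieldType.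
Hypothesis K_complete : forall u : nat -> K,
  (exists B, forall n, \sum_(j < n) `|u j| <= B) -> cvgn (series u).
Hypothesis K_archi : forall x : K, exists n : nat, `|x| <= n%:R.
Implicit Types (c : int -> K) (x z : K).

Lemma conv_shiftn (m : nat) c : conv c -> conv (fun i => c (i - m%:Z)).
Proof.
move=> Hc; elim: m => [|m IH].
  by have -> : (fun i => c (i - 0)) = c by apply/funext => i; rewrite subr0.
have -> : (fun i => c (i - m.+1%:Z)) = (fun i => (fun i => c (i - m%:Z)) (i - 1)).
  by apply/funext => i; congr c; lia.
exact: (@conv_shift _ (fun i => c (i - m%:Z))).
Qed.

Lemma val_shiftn (m : nat) c x : (forall i : int, i < 0 -> c i = 0) -> conv c -> `|x| < 1 ->
  val (fun i => c (i - m%:Z)) x = x ^+ m * val c x.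
Proof.
move=> c0 Hc x1; elim: m => [|m IH].
  have -> : (fun i => c (i - 0)) = c by apply/funext => i; rewrite subr0.
  by rewrite mul1r.
have -> : (fun i => c (i - m.+1%:Z)) = (fun i => (fun i => c (i - m%:Z)) (i - 1)).
  by apply/funext => i; congr c; lia.
rewrite (@val_shift _ K_complete (fun i => c (i - m%:Z))) //; first by rewrite IH exprS mulrA.
  by apply: c0; lia.
exact: conv_shiftn.
Qed.

Lemma hypergeomE (a s N x : K) : hypergeom (- N) (N + s) (a + 1) x = val (hcoef a s N) x.
Proof.
rewrite /hypergeom /val; congr (limn (series _)); apply/funext => j.
by rewrite hcoef_poch.
Qed.

(** The Darboux operator is a finite combination of shifts in n, so it acts on power series
    coefficient by coefficient. *)
Lemma darboux_zval p (f : 'I_p -> int -> K) (y : int -> K -> K) (G : int -> int -> K) :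
  (forall n, conv (G n)) ->
  (forall n z, `|(1 - z) / 2| < 1 -> y n z = zval (G n) z) ->
  forall n, conv (fun i => darboux f (fun m => G m i) n) /\
  forall z, `|(1 - z) / 2| < 1 ->
    darboux f (fun m => y m z) n = zval (fun i => darboux f (fun m => G m i) n) z.
Proof.
move=> HG Hy n.
pose c j i := dcoef f j n * G (n - p%:Z + j%:Z) i.
have -> : (fun i => darboux f (fun m => G m i) n) = fun i => \sum_(j < p.+1) c j i.
  by apply/funext => i; rewrite darbouxE.
have Hc (j : nat) : (j < p.+1)%N -> conv (c j) by move=> _; apply: conv_scale.
split.
  by have [] := val_sum (x := 0) K_complete Hc; rewrite ?normr0.
move=> z z1; rewrite /zval; have [_ ->] := val_sum K_complete Hc z1.
rewrite darbouxE; apply: eq_bigr => j _.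
by rewrite /c val_scale // Hy.
Qed.

Section Jacobi.
Variables (alpha beta eps : K).
Let m := xget 0%N [set m : nat | alpha = - m%:R]%classic.

Lemma xget_pos : (0 < m)%N -> alpha = - m%:R.
Proof. by rewrite /m; case: xgetP => // x ->. Qed.

Lemma xget_zero : m = 0%N -> forall t : nat, alpha + 1 + t%:R != 0.
Proof.
move=> m0 t; apply/eqP => H.
have := @xgetI _ 0%N [set m : nat | alpha = - m%:R]%classic t.+1.
rewrite -/m m0 /= => E; have aE : alpha = - t.+1%:R.
  by apply/eqP; rewrite -addr_eq0 -nat1r addrA H.
have := E aE; rewrite aE => /eqP; rewrite eqr_opp eqr_nat; exact/negP.
Qed.

Lemma pser_conv n : conv (pser alpha beta eps m n).
Proof.
rewrite /pser; case: eqP => _.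
  by apply: conv_scale; apply: conv_hcoef.
by apply: conv_scale; apply: conv_shiftn; apply: conv_hcoef.
Qed.

Lemma pser_neg n i : i < 0 -> pser alpha beta eps m n i = 0.
Proof.
have h a b e (j : int) : j < 0 -> chcoef a b e j n = 0 by case: j.
move=> i0; rewrite /pser; case: eqP => _; rewrite h ?mulr0 //; lia.
Qed.

Lemma jacobi_pE n z : `|(1 - z) / 2| < 1 ->
  jacobi_p alpha beta eps n z = zval (pser alpha beta eps m n) z.
Proof.
move=> z1; rewrite /jacobi_p -/m /zval /pser; case: eqP => _.
  rewrite val_scale //; last exact: conv_hcoef.
  rewrite /chcoef -hypergeomE /gauge.
  by congr (_ * hypergeom _ _ _ _); ring.
rewrite val_scale //; last by apply: conv_shiftn; apply: conv_hcoef.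
rewrite val_shiftn //; first last.
- exact: conv_hcoef.
- by case.
rewrite /chcoef -hypergeomE /gauge /pcst mulrA.
rewrite [eps + alpha + beta - alpha](_ : _ = eps + beta); last by ring.
by congr (_ * hypergeom _ _ _ _); ring.
Qed.

Lemma jacobi_p_eigen n z :
  (forall i n, tridiag_app (jacobi_op alpha beta eps) (fun n => pser alpha beta eps m n i) n =
     pser alpha beta eps m n i - 2 * pser alpha beta eps m n (i - 1)) ->
  `|(1 - z) / 2| < 1 ->
  tridiag_app (jacobi_op alpha beta eps) (fun n => jacobi_p alpha beta eps n z) n =
  z * jacobi_p alpha beta eps n z.
Proof.
move=> H z1; rewrite /tridiag_app !jacobi_pE // /zval; set x := _ / 2 in z1 *.
set a := coef_up _ _; set b := coef_mid _ _; set c := coef_down _ _.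
pose P := pser alpha beta eps m.
have S d k : conv (fun i => d * P k i) by apply: conv_scale; apply: pser_conv.
transitivity (val (sadd (sadd (fun i => a * P (n + 1) i) (fun i => b * P n i))
    (fun i => c * P (n - 1) i)) x).
  rewrite !val_add ?val_scale //; try exact: pser_conv; try exact: S.
  by apply: conv_add; apply: S.
have -> : sadd (sadd (fun i => a * P (n + 1) i) (fun i => b * P n i))
    (fun i => c * P (n - 1) i) = sadd (P n) (fun i => - 2 * (fun i => P n (i - 1)) i).
  by apply/funext => i; rewrite /sadd; have := H i n; rewrite /tridiag_app => ->; rewrite mulNr.
have S1 : conv (fun i => P n (i - 1)) by apply: conv_shift; apply: pser_conv.
rewrite val_add //; [|exact: pser_conv|exact: conv_scale].
rewrite val_scale // val_shift //; [|exact: pser_neg|exact: pser_conv].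
by rewrite /x; field.
Qed.

End Jacobi.
End JacobiFunctions.

(** * From operators on series in x to differential operators in z *)

Section DifferentialOperator.
Variable K : numFieldType.
Hypothesis K_complete : forall u : nat -> K,
  (exists B, forall n, \sum_(j < n) `|u j| <= B) -> cvgn (series u).
Implicit Types (c : int -> K) (x z : K).

Let half : {poly K} := 2^-1 *: (1 - 'X).

Lemma horner_half z : half.[z] = (1 - z) / 2.
Proof. by rewrite /half !hornerE mulrC. Qed.

Lemma size_half : (1 < size half)%N.
Proof.
rewrite /half size_scale ?invr_eq0 ?pnatr_eq0 // -opprB size_polyN -polyC1.
by rewrite size_XsubC.
Qed.

(** The powers of -2 come from d/dx = -2 d/dz; dividing by g turns an equation with g on the
    eigenvalue side into a genuine eigenvalue equation. *)
Definition diffop (d : nat) (p : nat -> {poly K}) (g : {poly K}) :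
    {poly {fraction {poly K}}} :=
  \poly_(j < d) (FracField.tofrac ((- 2) ^+ j *: (p j \Po half)) /
                 FracField.tofrac (g \Po half)).

Lemma diffop_appE d p g (F : K -> K) z : g.[(1 - z) / 2] != 0 ->
  g.[(1 - z) / 2] * diffop_app (diffop d p g) F z =
  \sum_(j < d) (p j).[(1 - z) / 2] * ((- 2) ^+ j * derive1n j F z).
Proof.
move=> gz; rewrite /diffop_app.
have E j : (j < d)%N -> rateval (diffop d p g)`_j z =
    (- 2) ^+ j * (p j).[(1 - z) / 2] / g.[(1 - z) / 2].
  move=> jd; rewrite /diffop coef_poly jd rateval_frac ?horner_comp ?horner_half //.
  by rewrite hornerZ horner_comp horner_half.
have r0 : rateval (0 : {fraction {poly K}}) z = 0.
  have -> : (0 : {fraction {poly K}}) = FracField.tofrac 0 / FracField.tofrac 1.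
    by rewrite rmorph0 mul0r.
  by rewrite rateval_frac ?hornerE ?oner_eq0.
transitivity (g.[(1 - z) / 2] * \sum_(j < d) rateval (diffop d p g)`_j z * derive1n j F z).
  congr (_ * _); have sd : (size (diffop d p g) <= d)%N by exact: size_poly.
  rewrite (big_ord_widen d (fun j => rateval (diffop d p g)`_j z * derive1n j F z)) //.
  rewrite big_mkcond; apply: eq_bigr => j _; case: ltnP => // h.
  by rewrite nth_default // r0 mul0r.
rewrite mulr_sumr; apply: eq_bigr => j _; rewrite E //.
by move: ((- 2) ^+ j) (derive1n j F z) => a b; field.
Qed.

Lemma diffop_order0 d p g : g != 0 -> (size (diffop d p g) <= 1)%N ->
  forall j, (0 < j < d)%N -> p j = 0.
Proof.
move=> g0 s1 j /andP[j0 jd]; apply/eqP.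
rewrite -(comp_poly_eq0 _ size_half).
have : (diffop d p g)`_j == 0 by rewrite nth_default // (leq_trans s1).
rewrite /diffop coef_poly jd mulf_eq0 invr_eq0 !tofrac_eq0.
rewrite scaler_eq0 expf_eq0 oppr_eq0 pnatr_eq0 andbF !(comp_poly_eq0 _ size_half).
by rewrite (negPf g0) orbF.
Qed.

Lemma iter_sder_neg c j : (forall i : int, i < 0 -> c i = 0) ->
  forall i : int, i < 0 -> iter j (@sder K K^o) c i = 0.
Proof.
move=> Hc; elim: j => //= j IH i i0; rewrite /sder.
have [->|h] := eqVneq i (-1); first by rewrite scale0r.
by rewrite IH ?scaler0 //; lia.
Qed.

Lemma diffop_eigen d (p : nat -> {poly K}) g c (F : K -> K) (t z : K) :
  (forall i : int, i < 0 -> c i = 0) -> conv c ->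
  (fun i => \sum_(j < d) pmul (p j) (iter j (@sder K K^o) c) i) =
    (fun i => t * @pmul K K^o g c i) ->
  (forall z', `|(1 - z') / 2| < 1 -> F z' = zval c z') ->
  `|(1 - z) / 2| < 1 -> g.[(1 - z) / 2] != 0 ->
  diffop_app (diffop d p g) F z = t * F z.
Proof.
move=> c0 Hc E HF z1 gz; apply: (mulfI gz); rewrite diffop_appE //.
set x := (1 - z) / 2 in z1 gz *.
have Hi j : conv (iter j (@sder K K^o) c) by elim: j => //= j; apply: conv_der.
transitivity (\sum_(j < d) (p j).[x] * val (iter j (@sder K K^o) c) x).
  apply: eq_bigr => j _; congr (_ * _); rewrite (derive1n_zval K_complete j Hc z1 HF).
  have -> : iter j (@zder K) c = fun i => (- 2^-1) ^+ j * iter j (@sder K K^o) c i.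
    by apply/funext => i; exact: iter_zder.
  rewrite /zval val_scale // mulrA -exprMn mulrNN divff ?pnatr_eq0 //.
  by rewrite expr1n mul1r.
transitivity (val (fun i => \sum_(j < d) pmul (p j) (iter j (@sder K K^o) c) i) x).
  have [_ ->] := @val_sum K K_complete d (fun j => pmul (p j) (iter j (@sder K K^o) c)) x
     (fun j _ => conv_pmul (p j) (Hi j)) z1.
  by apply: eq_bigr => j _; rewrite val_pmul //; exact: iter_sder_neg.
rewrite E val_scale //; last exact: conv_pmul.
by rewrite val_pmul // mulrCA HF.
Qed.

End DifferentialOperator.

Section Bispectrality.
Variable K : numFieldType.
Hypothesis K_complete : forall u : nat -> K,
  (exists B, forall n, \sum_(j < n) `|u j| <= B) -> cvgn (series u).
Hypothesis K_archi : forall x : K, exists n : nat, `|x| <= n%:R.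

(** The operator Q is fixed before n is chosen. The index n enters only through the linear map P ->
    a P(N), which commutes with operators in x. *)
Lemma bispectral_diffop (w : wop K) (u : int -> {poly K}) (theta g : {poly K}) :
  (forall i : int, i < 0 -> u i = 0) -> u <> (fun=> 0) -> (1 < size theta)%N -> g != 0 ->
  act w u = smul theta (pmul g u) ->
  exists Q : {poly {fraction {poly K}}}, (1 < size Q)%N /\
  forall (a N : K) (F : K -> K) z, conv (fun i => a * (u i).[N]) ->
    (forall z', `|(1 - z') / 2| < 1 -> F z' = zval (fun i => a * (u i).[N]) z') ->
    `|(1 - z) / 2| < 1 -> g.[(1 - z) / 2] != 0 ->
    diffop_app Q F z = theta.[N] * F z.
Proof.
move=> u0 uN0 th1 g0 Hw; have [d [p Hp]] := act_normal w.
exists (diffop d p g); split.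
  rewrite ltnNge; apply/negP => s1; have pj := diffop_order0 g0 s1.
  (* With all higher coefficients zero, w would act as multiplication by p_0, or by 0 if the normal
     form is empty. *)
  apply: (@no_order0 K u (if d == 0%N then 0 else p 0%N) g theta) => //.
  rewrite -Hw Hp; apply/funext => i; case: d {s1 Hp} pj => [|d] pj /=.
    by rewrite pmul0 big_ord0.
  rewrite big_ord_recl big1 ?addr0 // => j _.
  by rewrite pj ?pmul0 // lift0 /= ltnS.
move=> a N F z Hc HF z1 gz.
apply: (diffop_eigen K_complete _ Hc _ HF z1 gz).
  by move=> i i0; rewrite u0 // horner0 mulr0.
pose phi (P : {poly K}) : K^o := a * P.[N].
have phiD P1 P2 : phi (P1 + P2) = phi P1 + phi P2 by rewrite /phi hornerD mulrDr.
have phiZ (b : K) P1 : phi (b *: P1) = b *: phi P1.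
  by rewrite /phi hornerZ -[_ *: _]/(_ * _) mulrCA.
rewrite -[fun i => a * _]/(phi \o u) -Hp (act_map w u phiD phiZ) Hw pmul_map //.
by apply/funext => i; rewrite /= /smul /phi hornerM mulrCA.
Qed.

Theorem jacobi_bispectral (alpha beta eps : K) (k l : nat)
    (A B : 'I_k -> K) (C D : 'I_l -> K) :
  ~ isint eps -> ~ isint (eps + alpha) -> ~ isint (eps + beta) ->
  ~ isint (eps + alpha + beta) -> ~ isint (2 * eps + alpha + beta) ->
  ((0 < k)%N -> isint alpha /\ k%:R <= `|alpha|) ->
  ((0 < l)%N -> isint beta /\ l%:R <= `|beta|) ->
  admissible alpha beta eps A B C D ->
  let Psi := darboux_Psi alpha beta eps A B C D in
  exists L : tridiag K,
    [/\ unique (intertwines alpha beta eps A B C D) L,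
        forall n z, `|z| < 1 -> tridiag_app L (fun m => Psi m z) n = z * Psi n z
      & exists (Q : {poly {fraction {poly K}}}) (theta : int -> K),
          (1 < size Q)%N /\
          forall n z, `|z| < 1 -> diffop_app Q (Psi n) z = theta n * Psi n z].
Proof.
move=> e0 ea0 eb0 eab0 eeab0 Hk Hl adm Psi.
have far (x : K) (j t : nat) : j%:R <= `|x| -> (t.+1 < j)%N ->
    x + 1 + t%:R != 0 /\ - x + 1 + t%:R != 0.
  move=> hj ht; have H (s : K) : `|s| = 1 -> s * x + 1 + t%:R != 0.
    move=> s1; apply/eqP => E.
    have : `|s * x| = t.+1%:R.
      have -> : s * x = - t.+1%:R.
        by apply/eqP; rewrite -addr_eq0 -nat1r addrA E.
      by rewrite normrN normr_nat.
    rewrite normrM s1 mul1r => xE; move: hj; rewrite xE ler_nat.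
    by rewrite leqNgt ht.
  by have := H 1 (normr1 _); have := H (- 1) (normrN1 _); rewrite mulN1r mul1r.
have ka t (h : (t.+1 < k)%N) := far alpha k t (proj2 (Hk (leq_ltn_trans (leq0n _) h))) h.
have lb t (h : (t.+1 < l)%N) := far beta l t (proj2 (Hl (leq_ltn_trans (leq0n _) h))) h.
pose f := kernel_fun alpha beta eps A B C D.
pose L0 := jacobi_op alpha beta eps.
pose y m z := jacobi_p alpha beta eps m z.
have [Hrec [e [u [eta [u0 uN0 eta0 Hu [w [c [d [theta [th1 Hw]]]]]]]]]] :=
  jacobi_darboux_formal e0 ea0 eb0 eab0 eeab0 ka lb (fun h => proj1 (Hk h))
    (fun h => proj1 (Hl h)) (@xget_pos K alpha) (@xget_zero K alpha) adm.
have [L HL] : exists L, forall g n, tridiag_app L (darboux f g) n = darboux f (tridiag_app L0 g) n.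
  apply: intertwiner_exists adm _ _ => i n; exact: wronsk_L_kernel.
exists L; split.
- split=> [|L' HL']; first exact: HL.
  by apply: (intertwiner_inj (f := f) adm) => g n; rewrite HL HL'.
- move=> n z z1; rewrite -[LHS]/(tridiag_app L (darboux f (y^~ z)) n) HL.
  have -> : tridiag_app L0 (y^~ z) = fun m => z * y m z + 0.
    apply/funext => m; rewrite addr0; apply: jacobi_p_eigen => //; exact: disc_half.
  rewrite /darboux (wronsk_lin f z (y^~ z) (fun=> 0)).
  by rewrite wronsk0 addr0 mulrCA.
have g0 : 'X^c * xfac K k l ^+ d != 0.
  by rewrite mulf_neq0 ?expf_neq0 ?polyX_eq0 ?xfac_neq0.
have [Q [Q1 HQ]] := bispectral_diffop u0 uN0 th1 g0 Hw.
exists Q, (fun n => theta.[n%:~R + e]); split=> // n z z1.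
have z2 := disc_half z1.
set m := xget _ _ in Hu Hrec.
have PsiE : (fun i => darboux f (fun x => pser alpha beta eps m x i) n) =
    fun i => (caso f n)^-1 * eta n * (u i).[n%:~R + e].
  by apply/funext => i; rewrite /darboux Hu mulrA.
have [Hc HP] := darboux_zval K_complete f (pser_conv K_archi alpha beta eps)
  (fun n z => @jacobi_pE K K_complete K_archi alpha beta eps n z) n.
rewrite PsiE in Hc HP.
apply: HQ Hc HP z2 _.
(* Up to a constant, the denominator is a product of powers of 1 - z and 1 + z; its possible zeros 1
   and -1 lie on the boundary of the disc. *)
have h1 : 1 - z != 0.
  by rewrite subr_eq0; apply: contraTneq z1 => <-; rewrite normr1 ltxx.
have h2 : 1 + z != 0.
  by rewrite addr_eq0; apply: contraTneq z1 => E; rewrite -normrN -E normr1 ltxx.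
have n2 : (2 : K) != 0 by rewrite pnatr_eq0.
rewrite hornerM hornerXn horner_exp /xfac hornerM !horner_exp.
have -> : (- 2 *: 'X).[(1 - z) / 2] = - (1 - z) by rewrite hornerZ hornerX; field.
have -> : (2%:P - 2 *: 'X).[(1 - z) / 2] = 1 + z.
  by rewrite hornerD hornerN hornerZ hornerX hornerC; field.
by rewrite !(mulf_neq0, expf_neq0) // ?oppr_eq0 ?invr_eq0.
Qed.

End Bispectrality.
Theorem theorem1p1 (R : realType) (alpha beta eps : R[i]) (k l : nat) :
  ~ isint eps -> ~ isint (eps + alpha) -> ~ isint (eps + beta) ->
  ~ isint (eps + alpha + beta) -> ~ isint (2 * eps + alpha + beta) ->
  [\/ [/\ isint alpha, k%:R <= `|alpha| & l = 0%N],
      [/\ isint beta, l%:R <= `|beta| & k = 0%N] |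
      [/\ isint alpha, isint beta, k%:R <= `|alpha| & l%:R <= `|beta|]] ->
  forall (A B : 'I_k -> R[i]) (C D : 'I_l -> R[i]),
  admissible alpha beta eps A B C D ->
  let Psi := darboux_Psi alpha beta eps A B C D in
  exists L : tridiag R[i],
    [/\ unique (intertwines alpha beta eps A B C D) L,
        forall (n : int) (z : R[i]), `|z| < 1 ->
          tridiag_app L (fun m => Psi m z) n = z * Psi n z
      & exists (Q : {poly {fraction {poly R[i]}}}) (theta : int -> R[i]),
          (1 < size Q)%N /\
          forall (n : int) (z : R[i]), `|z| < 1 ->
            (forall j : nat, ~~ is_pole Q`_j z) ->
            diffop_app Q (Psi n) z = theta n * Psi n z].
Proof.
move=> e0 ea0 eb0 eab0 eeab0 cases A B C D adm Psi.
have [Hk Hl] : ((0 < k)%N -> isint alpha /\ k%:R <= `|alpha|) /\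
    ((0 < l)%N -> isint beta /\ l%:R <= `|beta|).
  by case: cases => [[ia ka l0]|[ib lb k0]|[ia ib ka lb]]; split=> //; rewrite ?l0 ?k0.
have [L [HL Heig [Q [theta [Q1 HQ]]]]] := jacobi_bispectral (@complex_abs_cvg R)
  (@complex_archi R) e0 ea0 eb0 eab0 eeab0 Hk Hl adm.
by exists L; split=> //; exists Q, theta; split=> // n z z1 _; exact: HQ.
Qed.
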